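(* Let $G$ be a graph with a distinguished vertex $q$, $K$ a field, $R=K[x_v:v\in V(G)]$, and let $\mathsf A=\mathbb Z$ or $\mathsf A=\mathrm{Pic}(G)$. Then $$\beta_{i,\mathsf j}(R/I_G)=|\mathfrak S_{i+1,\mathsf j}(G,q)|\qquad\text{for all } i\ge0,\ \mathsf j\in\mathsf A,$$ and the same holds with $I_G$ replaced by $\mathrm{in}(I_G)$.
   Context: A graph is a finite connected undirected multigraph without loops; $n=|V(G)|$. $\mathrm{Div}(G)$ is the free abelian group on $V(G)$; $D$ is effective if all coefficients $D(v)\ge0$, and then $\mathbf x^D=\prod_vx_v^{D(v)}$. The Laplacian of $f:V(G)\to\mathbb Z$ is $\Delta(f)=\sum_v\sum_{\{v,w\}\in E(G)}(f(v)-f(w))(v)$; $\mathrm{Pic}(G)=\mathrm{Div}(G)/\mathrm{Image}(\Delta)$; $D_1\sim D_2$ means equality in $\mathrm{Pic}(G)$. Gradings of $R$: $\deg_{\mathbb Z}(\mathbf x^D)=\deg_{\mathbb Z}(D)=\sum_vD(v)$ and $\deg_{\mathrm{Pic}(G)}(\mathbf x^D)=\deg_{\mathrm{Pic}(G)}(D)=[D]$; Nakayama's lemma holds for both gradings, so minimal graded free resolutions and graded Betti numbers $\beta_{i,\mathsf j}$ (number of degree-$\mathsf j$ generators of the $i$-th free module in a minimal $\mathsf A$-graded free resolution) are well defined. $I_G=\langle\mathbf x^{D_1}-\mathbf x^{D_2}:D_1\sim D_2\text{ both effective}\rangle$. $\mathrm{in}(I_G)$ is its initial ideal for the degree reverse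 lexicographic order induced by a fixed total ordering of the variables satisfying $\mathrm{dist}(w,q)<\mathrm{dist}(v,q)\Rightarrow x_w<x_v$ (graph distance). A connected $k$-flag of $(G,q)$ ($1\le k\le n$; none for $k>n$) is a sequence $\mathcal U:U_1\subsetneq\cdots\subsetneq U_k=V(G)$ with $q\in U_1$ and $G[U_i]$, $G[U_{i+1}\setminus U_i]$ connected for $1\le i\le k-1$. $G(\mathcal U)$ is the partial orientation of $G$ orienting, for all $1\le i\le k-1$, the edges between $U_i$ and $U_{i+1}\setminus U_i$ towards $U_{i+1}\setminus U_i$, other edges unoriented. Two connected $k$-flags are equivalent if their partial orientations coincide. Fix a total order $\preceq$ on $\{U\subseteq V(G):q\in U\}$ with $U\supseteq V\Rightarrow U\preceq V$; for distinct connected $k$-flags, $\mathcal U\prec_k\mathcal V$ iff $U_\ell\prec V_\ell$ for the largest $\ell\le k-1$ with $U_\ell\ne V_\ell$. $\mathfrak S_k(G,q)$ is the set of $\prec_k$-minimal representatives of the equivalence classes. For disjoint $A,B\subseteq V(G)$, $D(A,B)=\sum_{v\in A}(\text{number of edges between }v\text{ and }B)(v)$, and $D(\mathcal U)=\sum_{i=1}^{k-1}D(U_{i+1}\setminus U_i,U_i)$. For $\mathsf j\in\mathsf A$, $\mathfrak S_{k,\mathsf j}(G,q)=\{\mathcal U\in\mathfrak S_k(G,q):\deg_{\mathsf A}(D(\mathcal U))=\mathsf j\}$. *)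

(* Defs.v *)
From HB Require Import structures.
From mathcomp Require Import all_boot all_order all_algebra.
From mathcomp Require Import boolp mpoly.

Set Implicit Arguments.
Unset Strict Implicit.
Unset Printing Implicit Defensive.

Import GRing.Theory.

Local Open Scope ring_scope.

Definition total_order_on (T : Type) (D : {pred T}) (r : rel T) : Prop :=
  [/\ {in D, reflexive r}, {in D &, antisymmetric r},
      {in D & &, transitive r} & {in D &, total r}].

Section Graphs.
Variable V : finType.

(* A multigraph is given by its edge multiplicities: mult u v is the number of
   edges between u and v. *)
Record multigraph := Multigraph {
  mult : V -> V -> nat;
  mult_sym : forall u v, mult u v = mult v u;
  mult_loopless : forall v, mult v v = 0%N;
  mult_connected : forall u v, connect (fun a b => 0 < mult a b)%N u v
}.

Variable G : multigraph.

Definition adj : rel V := fun u v => (0 < mult G u v)%N.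

(* The least length of a walk from u to v; it is less than #|V| because G is
   connected, so the default value of find is never reached. *)
Definition dist (u v : V) : nat :=
  find (fun k => [exists p : k.-tuple V, path adj u p && (last u p == v)])
       (iota 0 #|V|).

Definition induced_connected (U : {set V}) : bool :=
  (U != set0) &&
  [forall u in U, forall v in U,
     connect (fun a b => [&& a \in U, b \in U & adj a b]) u v].

End Graphs.

Notation Div V := {ffun V -> int}.

Section Divisors.
Variables (V : finType) (G : multigraph V).

Definition effective (D : Div V) : bool := [forall v, 0 <= D v].

Definition laplacian (f : V -> int) : Div V :=
  [ffun v => \sum_(w : V) (f v - f w) *+ mult G v w].

Definition principal : {pred Div V} :=
  fun D => `[< exists f : V -> int, D = laplacian f >].

Fact principal_zmod_closed : zmod_closed principal.
Proof.
split; first by apply/asboolP; exists (fun=> 0); apply/ffunP => v;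
  rewrite !ffunE big1 // => w _; rewrite subrr mul0rn.
move=> D E /asboolP[f ->] /asboolP[g ->]; apply/asboolP.
exists (fun v => f v - g v); apply/ffunP => v.
rewrite !ffunE -sumrB; apply: eq_bigr => w _.
by rewrite -mulrnBl; congr (_ *+ _); rewrite !opprD addrACA.
Qed.

HB.instance Definition _ := GRing.isZmodClosed.Build (Div V) principal
  principal_zmod_closed.

Definition Pic : Type := Quotient.quot principal.
HB.instance Definition _ := GRing.Zmodule.on Pic.

Definition degZ (D : Div V) : int := \sum_v D v.
Definition degPic (D : Div V) : Pic := (\pi_(Quotient.quot principal) D)%qT.

End Divisors.

(* The polynomial ring K[x_v : v in V] is {mpoly K[#|V|]}; the variable x_v is
   'X_(enum_rank v). *)
Section Ideals.
Variables (V : finType) (K : fieldType).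

Notation R := {mpoly K[#|V|]}.
Notation monom := 'X_{1..#|V|}.

Definition ideal_gen (S : R -> Prop) : R -> Prop := fun p =>
  exists (s : nat) (c g : 'I_s -> R),
    (forall t, S (g t)) /\ p = \sum_(t < s) c t * g t.

(* The exponent of x^D; meaningful for effective D only. *)
Definition mnm_of_div (D : Div V) : monom :=
  [multinom absz (D (enum_val t)) | t < #|V|].

Definition div_of_mnm (m : monom) : Div V := [ffun v => (m (enum_rank v))%:Z].

Definition toppling_ideal (G : multigraph V) : R -> Prop :=
  ideal_gen (fun p => exists D1 D2 : Div V,
    [/\ effective D1, effective D2, degPic G D1 = degPic G D2
      & p = 'X_[mnm_of_div D1] - 'X_[mnm_of_div D2]]).

(* Degree reverse lexicographic order for the ordering xle of the variables:
   in equal degrees, m1 < m2 when m1 has the larger exponent at the smallest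
   variable at which m1 and m2 differ. *)
Definition degrevlex_lt (xle : rel V) (m1 m2 : monom) : bool :=
  (mdeg m1 < mdeg m2)%N ||
  (mdeg m1 == mdeg m2) &&
  [exists v, (m2 (enum_rank v) < m1 (enum_rank v))%N &&
     [forall w, (w != v) && xle w v ==>
        (m1 (enum_rank w) == m2 (enum_rank w))]].

Definition is_initial_mnm (xle : rel V) (p : R) (m : monom) : Prop :=
  m \in msupp p /\
  forall m', m' \in msupp p -> m' != m -> degrevlex_lt xle m' m.

Definition initial_ideal (xle : rel V) (I : R -> Prop) : R -> Prop :=
  ideal_gen (fun g => exists (p : R) (m : monom),
    [/\ I p, is_initial_mnm xle p m & g = 'X_[m]]).

End Ideals.

Section Resolutions.
Variables (V : finType) (K : fieldType) (A : zmodType) (deg : Div V -> A).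

Notation R := {mpoly K[#|V|]}.

Definition homogeneous (d : A) (p : R) : Prop :=
  forall m, m \in msupp p -> deg (div_of_mnm m) = d.

(* Data of a sequence of finitely generated graded free modules
     ... -> F_2 -> F_1 -> F_0 -> R,
   where F_i = 'rV[R]_(rk i) has its basis element a in degree gdeg a, and the
   maps u |-> u *m bdry i and u |-> u *m augm act on row vectors.  For an ideal
   I, the last map lifts the augmentation F_0 -> R/I. *)
Record free_complex := FreeComplex {
  rk : nat -> nat;
  gdeg : forall i, 'I_(rk i) -> A;
  bdry : forall i, 'M[R]_(rk i.+1, rk i);
  augm : 'cV[R]_(rk 0)
}.

Definition graded (F : free_complex) : Prop :=
  (forall i a b, homogeneous (gdeg a - gdeg b) (@bdry F i a b)) /\
  (forall b, homogeneous (gdeg b) (augm F b 0)).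

Definition resolves (I : R -> Prop) (F : free_complex) : Prop :=
  [/\ (* F_0 -> R/I is surjective *)
      forall p : R, exists u : 'rV_(rk F 0), I (p - (u *m augm F) 0 0),
      (* exactness at F_0 *)
      forall u : 'rV_(rk F 0),
        I ((u *m augm F) 0 0) <->
        exists w : 'rV_(rk F 1), u = w *m bdry F 0
    & (* exactness at F_(i+1) *)
      forall i (u : 'rV_(rk F i.+1)),
        u *m bdry F i = 0 <->
        exists w : 'rV_(rk F i.+2), u = w *m bdry F i.+1].

(* The image of F_(i+1) lies in m F_i for m the ideal generated by all the
   variables. *)
Definition minimal (F : free_complex) : Prop :=
  forall i a b, (@bdry F i a b)@_0%MM = 0.

Definition minimal_graded_free_resolution (I : R -> Prop) (F : free_complex) :
  Prop := [/\ graded F, resolves I F & minimal F].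

(* beta_(i,j)(R/I) = b: minimal graded free resolutions of R/I exist, and in
   each of them the i-th free module has exactly b generators of degree j. *)
Definition graded_betti (I : R -> Prop) (i : nat) (j : A) (b : nat) : Prop :=
  (exists F, minimal_graded_free_resolution I F) /\
  (forall F, minimal_graded_free_resolution I F ->
     #|[set a : 'I_(rk F i) | gdeg a == j]| = b).

End Resolutions.

(* In a k-flag U_1, ..., U_k the set U_(l+1) is nth set0 U l. *)
Section Flags.
Variables (V : finType) (G : multigraph V) (q : V).

Definition connected_flag (k : nat) (U : k.-tuple {set V}) : bool :=
  [&& q \in nth set0 U 0, last set0 U == [set: V] &
      [forall l : 'I_k.-1,
         [&& nth set0 U l \proper nth set0 U l.+1,
             induced_connected G (nth set0 U l) &
             induced_connected G (nth set0 U l.+1 :\: nth set0 U l)]]].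

(* The partial orientation G(U), as the set of pairs (u, v) of adjacent
   vertices whose edges are oriented from u to v; parallel edges are always
   treated alike. *)
Definition flag_orientation (k : nat) (U : k.-tuple {set V}) : {set V * V} :=
  [set e | adj G e.1 e.2 &&
     [exists l : 'I_k.-1, (e.1 \in nth set0 U l) &&
        (e.2 \in nth set0 U l.+1 :\: nth set0 U l)]].

Definition flag_lt (sle : rel {set V}) (k : nat) (U W : k.-tuple {set V}) :
    bool :=
  [exists l : 'I_k.-1,
     [&& nth set0 U l != nth set0 W l, sle (nth set0 U l) (nth set0 W l) &
         [forall m : 'I_k.-1, (l < m)%N ==> (nth set0 U m == nth set0 W m)]]].

Definition flag_reps (sle : rel {set V}) (k : nat) : {set k.-tuple {set V}} :=
  [set U | connected_flag U &&
     [forall W : k.-tuple {set V},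
        connected_flag W && (flag_orientation W == flag_orientation U) ==>
        ~~ flag_lt sle W U]].

Definition div_between (A B : {set V}) : Div V :=
  [ffun v => if v \in A then (\sum_(w in B) mult G v w)%N%:Z else 0].

Definition flag_div (k : nat) (U : k.-tuple {set V}) : Div V :=
  \sum_(l < k.-1)
     div_between (nth set0 U l.+1 :\: nth set0 U l) (nth set0 U l).

Definition flag_reps_deg (sle : rel {set V}) (A : zmodType) (deg : Div V -> A)
    (k : nat) (j : A) : {set k.-tuple {set V}} :=
  [set U in flag_reps sle k | deg (flag_div U) == j].

End Flags.

(* Main.v *)
(* Consider all chains q in U_1 < ... < U_k = V, i.e. ordered set partitions of V
   with q in the first block, and let d merge consecutive blocks P_i, P_(i+1)
   with coefficient +-x^D(P_(i+1), P_i); for I_G the last block is also merged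
   cyclically into the first one. This complex resolves R/I_G, respectively
   R/in(I_G): with respect to a weight that is superharmonic off q, the leading
   term of the boundary comes from merging the first two blocks, and sending a
   monomial to this leading term matches the monomials x^a[U] with no subset of
   U_1 - q that can be fired from a against those that have one.

   The complex is not minimal: merging blocks not joined by an edge has
   coefficient +-1. Label the connected parts of each acyclic partial orientation
   by a linear extension that puts q after all other sources. Writing blocks in
   decreasing order of labels, an ordered partition is a word together with bars
   at all ascents and at some descents; toggling the bar at the first descent is
   an acyclic matching. Its critical elements are the words without descents, one
   for each orientation with unique source q, and they are matched with the
   representatives of connected flags by choosing these as linear extensions.
   Unit coefficients preserve the set of unoriented edges, hence the number of
   blocks of critical elements, so the reduced resolution is minimal. *)
Require Import Defs.
From HB Require Import structures.
From mathcomp Require Import all_boot all_order all_algebra.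
From mathcomp Require Import zify.
From mathcomp Require Import boolp mpoly.

Set Implicit Arguments.
Unset Strict Implicit.
Unset Printing Implicit Defensive.

Import GRing.Theory.

Local Open Scope ring_scope.

(** * Uniqueness of graded Betti numbers *)

(** One complex serves both ideals because the cyclic merge never gives a leading term. For an inner
    merge the weighted indegree of a partition is shared out exactly between the face and the
    coefficient; the cyclic merge fires a block without q and loses weight. Its coefficient [eps]
    may therefore be 1 or 0, and an ideal enters only through two facts: it contains the boundaries
    of the two-block partitions, and no nonzero combination of monomials reduced at q. The weighted
    indegree of the partition alone drops under every merge other than an inner one with unit
    coefficient, which makes the matching acyclic up to a count of inversions.

    The obstacle in the matching is that inserting a bar must keep q in the first block and must not
    change the labels. Labels are therefore chosen for the orientation, which the toggle preserves,
    and the position of q among the sources makes its part the one that stays in front when the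
    first block is split. *)

Section HomogeneousPolynomials.
Variables (V : finType) (K : fieldType) (A : zmodType) (deg : Div V -> A).
Hypothesis degD : {morph deg : x y / x + y}.
Notation R := {mpoly K[#|V|]}.
Notation monom := 'X_{1..#|V|}.

Definition mdg (m : monom) : A := deg (div_of_mnm m).

Lemma deg_zero : deg 0 = 0.
Proof. by apply: (addIr (deg 0)); rewrite -degD !add0r. Qed.

Lemma mdgD (m1 m2 : monom) : mdg (m1 + m2)%MM = mdg m1 + mdg m2.
Proof.
rewrite /mdg -degD; congr deg; apply/ffunP => v.
by rewrite !ffunE mnmDE PoszD.
Qed.

Lemma mdg0 : mdg 0%MM = 0.
Proof.
rewrite /mdg -deg_zero; congr deg; apply/ffunP => v.
by rewrite !ffunE mnm0E.
Qed.

Lemma homogeneousP d (p : R) :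
  homogeneous deg d p <-> forall m, mdg m != d -> p@_m = 0.
Proof.
split=> [hp m|hp m mp].
  by apply: contraNeq; rewrite -mcoeff_msupp /mdg => /hp ->.
by apply/eqP; apply: contraLR mp; rewrite mcoeff_msupp negbK => /hp ->.
Qed.

Lemma homogeneous0 d : homogeneous deg d (0 : R).
Proof. by move=> m; rewrite msupp0. Qed.

Lemma homogeneousD d (p g : R) :
  homogeneous deg d p -> homogeneous deg d g -> homogeneous deg d (p + g).
Proof.
move=> /homogeneousP hp /homogeneousP hg; apply/homogeneousP => m mP.
by rewrite mcoeffD hp // hg // addr0.
Qed.

Lemma homogeneousZ d c (p : R) :
  homogeneous deg d p -> homogeneous deg d (c *: p).
Proof.
by move=> /homogeneousP hp; apply/homogeneousP => m mP; rewrite mcoeffZ hp ?mulr0.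
Qed.

Lemma homogeneousN d (p : R) : homogeneous deg d p -> homogeneous deg d (- p).
Proof. by rewrite -scaleN1r; apply: homogeneousZ. Qed.

Lemma homogeneous_sum d (I : Type) (r : seq I) (P : pred I) (F : I -> R) :
  (forall i, P i -> homogeneous deg d (F i)) ->
  homogeneous deg d (\sum_(i <- r | P i) F i).
Proof.
move=> hF; elim/big_rec: _ => [|i p Pi hp]; first exact: homogeneous0.
by apply: homogeneousD => //; apply: hF.
Qed.

Lemma homogeneousM d e (p g : R) : homogeneous deg d p -> homogeneous deg e g ->
  homogeneous deg (d + e) (p * g).
Proof.
move=> hp hg m /msuppM_le /allpairsP [[m1 m2] /= [/hp <- /hg <- ->]].
exact: mdgD.
Qed.

Lemma homogeneousX (m : monom) : homogeneous deg (mdg m) ('X_[m] : R).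
Proof. by move=> m'; rewrite msuppX inE => /eqP ->. Qed.

Lemma homogeneous1 : homogeneous deg 0 (1 : R).
Proof. by rewrite -mpolyX0 -mdg0; apply: homogeneousX. Qed.

Lemma homogeneous_const d (p : R) :
  homogeneous deg d p -> p@_0%MM != 0 -> d = 0.
Proof. by move=> hp; rewrite -mcoeff_msupp => /hp <-; apply: mdg0. Qed.

Definition hpart d (p : R) : R :=
  \sum_(m <- msupp p | mdg m == d) p@_m *: 'X_[m].

Lemma mcoeff_hpart d p m : (hpart d p)@_m = if mdg m == d then p@_m else 0.
Proof.
rewrite /hpart linear_sum /=.
under eq_bigr do rewrite mcoeffZ mcoeffX.
case: (boolP (m \in msupp p)) => [mp|mp].
  rewrite big_mkcond (bigD1_seq m) ?msupp_uniq //= eqxx mulr1.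
  rewrite big1 ?addr0 // => i /negbTE ->; rewrite mulr0.
  by case: ifP.
have /eqP -> : p@_m == 0 by rewrite mcoeff_eq0.
rewrite if_same big_seq_cond big1 // => i /andP [ip _].
by case: eqP ip mp => [->->|]; rewrite ?mulr0.
Qed.

Lemma hpart_homogeneous d p : homogeneous deg d (hpart d p).
Proof.
by apply/homogeneousP => m /negbTE mP; rewrite mcoeff_hpart mP.
Qed.

Lemma hpart_id d p : homogeneous deg d p -> hpart d p = p.
Proof.
move=> /homogeneousP hp; apply/mpolyP => m; rewrite mcoeff_hpart.
by case: eqP => // /eqP /hp ->.
Qed.

Lemma hpart_is_linear d : linear (hpart d).
Proof.
move=> c p g; apply/mpolyP => m.
by rewrite mcoeffD mcoeffZ !mcoeff_hpart mcoeffD mcoeffZ; case: ifP; rewrite ?mulr0 ?addr0.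
Qed.
HB.instance Definition _ d := GRing.isLinear.Build K R R _ (hpart d)
  (hpart_is_linear d).

Lemma hpartMr d e p g : homogeneous deg e g ->
  hpart d (p * g) = hpart (d - e) p * g.
Proof.
move=> hg; apply/mpolyP => m; rewrite mcoeff_hpart !mcoeffM.
case: ifP => mP; last first.
  rewrite big1 // => -[k1 k2] /= /eqP mk.
  rewrite mcoeff_hpart; case: eqP => [k1P|]; last by rewrite mul0r.
  case: (boolP (bmnm k2 \in msupp g)) => [/hg k2P|]; last first.
    by rewrite -mcoeff_eq0 => /eqP ->; rewrite mulr0.
  case/eqP: mP; rewrite mk mdgD k1P.
  by move: k2P; rewrite -/(mdg _) => ->; rewrite subrK.
apply: eq_bigr => -[k1 k2] /= /eqP mk.
case: (boolP (bmnm k2 \in msupp g)) => [/hg k2P|]; last first.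
  by rewrite -mcoeff_eq0 => /eqP ->; rewrite !mulr0.
have -> : d = mdg (bmnm k1) + e.
  by move/eqP: mP => <-; rewrite [in LHS]mk mdgD; congr (_ + _).
by rewrite mcoeff_hpart addrK eqxx.
Qed.

End HomogeneousPolynomials.

Section Ideals.
Variables (V : finType) (K : fieldType).
Notation R := {mpoly K[#|V|]}.

Definition is_ideal (I : R -> Prop) : Prop :=
  [/\ I 0, forall p g, I p -> I g -> I (p + g) & forall p g, I g -> I (p * g)].

Lemma ideal_gen_ideal (S : R -> Prop) : is_ideal (ideal_gen S).
Proof.
split.
- exists 0%N, (fun=> 0), (fun=> 0); split; first by case.
  by rewrite big_ord0.
- move=> p g [s1 [c1 [g1 [S1 ->]]]] [s2 [c2 [g2 [S2 ->]]]].
  exists (s1 + s2)%N,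
    (fun t => match split t with inl i => c1 i | inr i => c2 i end),
    (fun t => match split t with inl i => g1 i | inr i => g2 i end).
  split=> [t|]; first by case: (split t).
  rewrite big_split_ord /=; congr (_ + _); apply: eq_bigr => i _.
    by rewrite (unsplitK (inl _ i)).
  by rewrite (unsplitK (inr _ i)).
- move=> p g [s [c [h [Sh ->]]]]; exists s, (fun t => p * c t), h; split=> //.
  by rewrite mulr_sumr; apply: eq_bigr => i _; rewrite mulrA.
Qed.

Lemma ideal_gen_sub (S : R -> Prop) p : S p -> ideal_gen S p.
Proof.
move=> Sp; exists 1%N, (fun=> 1), (fun=> p); split=> //.
by rewrite big_ord1 mul1r.
Qed.

Lemma ideal_sum (I : R -> Prop) (T : Type) (r : seq T) (P : pred T) F :
  is_ideal I -> (forall t, P t -> I (F t)) -> I (\sum_(t <- r | P t) F t).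
Proof.
by case=> I0 ID _ IF; elim/big_rec: _ => // t p Pt Ip; apply: ID => //; apply: IF.
Qed.

Lemma ideal_gen_hpart (A : zmodType) (deg : Div V -> A) (S : R -> Prop) :
  {morph deg : x y / x + y} ->
  (forall p, S p -> exists d, homogeneous deg d p) ->
  forall d p, ideal_gen S p -> ideal_gen S (hpart deg d p).
Proof.
move=> degD hS d p [s [c [g [Sg ->]]]]; rewrite linear_sum /=.
have iS := ideal_gen_ideal S.
apply: ideal_sum => // t _; have [e he] := hS _ (Sg t).
rewrite (hpartMr degD _ _ he); case: iS => _ _; apply.
exact: ideal_gen_sub.
Qed.

End Ideals.

Section Uniqueness.
Variables (V : finType) (K : fieldType) (A : zmodType) (deg : Div V -> A).
Hypothesis degD : {morph deg : x y / x + y}.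
Notation R := {mpoly K[#|V|]}.

Lemma mxB_entry p q (X Y : 'M[R]_(p, q)) a b : (X - Y) a b = X a b - Y a b.
Proof. by rewrite !mxE. Qed.

Lemma row_image p q r (I : 'rV[R]_q -> Prop) (D : 'M[R]_(r, q)) (U : 'M[R]_(p, q)) :
  (forall u, I u -> exists w : 'rV_r, u = w *m D) ->
  (forall a, I (row a U)) -> exists W : 'M[R]_(p, r), U = W *m D.
Proof.
move=> im IU.
have /fin_all_exists [f fP] : forall a, exists w : 'rV_r, row a U = w *m D.
  by move=> a; apply: im.
exists (\matrix_a f a); apply/row_matrixP => a.
by rewrite row_mul rowK.
Qed.

Definition homog_mx p q (ga : 'I_p -> A) (gb : 'I_q -> A) (X : 'M[R]_(p, q)) :=
  forall a b, homogeneous deg (ga a - gb b) (X a b).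

Definition const_mx0 p q (X : 'M[R]_(p, q)) : 'M[K]_(p, q) :=
  map_mx (mcoeff 0%MM) X.

Lemma homog_mx_mul p q r (ga : 'I_p -> A) (gb : 'I_q -> A) (gc : 'I_r -> A)
  (X : 'M[R]_(p, q)) (Y : 'M[R]_(q, r)) : homog_mx ga gb X -> homog_mx gb gc Y ->
  homog_mx ga gc (X *m Y).
Proof.
move=> hX hY a c; rewrite mxE; apply: homogeneous_sum => b _.
by rewrite -(subrKA (gb b)); apply: homogeneousM.
Qed.

(** Replacing each entry of a lift by its component of the required degree does not change the
    product, because [C] and [D] are homogeneous. *)
Lemma homog_lift p q r (ga : 'I_p -> A) (gb : 'I_q -> A) (gc : 'I_r -> A)
  (C : 'M[R]_(p, r)) (X : 'M[R]_(p, q)) (D : 'M[R]_(q, r)) :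
  homog_mx ga gc C -> homog_mx gb gc D -> C = X *m D ->
  exists X', homog_mx ga gb X' /\ C = X' *m D.
Proof.
move=> hC hD CE; exists (\matrix_(a, b) hpart deg (ga a - gb b) (X a b)).
split=> [a b|]; first by rewrite mxE; apply: hpart_homogeneous.
apply/matrixP => a c; rewrite -(hpart_id (hC a c)) CE !mxE linear_sum.
apply: eq_bigr => b _. rewrite mxE /= (hpartMr degD _ _ (hD b c)).
by rewrite opprB addrA subrK.
Qed.

Lemma const_mx0M p q r (X : 'M[R]_(p, q)) (Y : 'M[R]_(q, r)) :
  const_mx0 (X *m Y) = const_mx0 X *m const_mx0 Y.
Proof. exact: map_mxM. Qed.

Lemma const_mx0_block p q (ga : 'I_p -> A) (gb : 'I_q -> A) (X : 'M[R]_(p, q)) a b :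
  homog_mx ga gb X -> const_mx0 X a b != 0 -> ga a = gb b.
Proof.
move=> hX; rewrite mxE => /(homogeneous_const degD (hX a b))/eqP.
by rewrite subr_eq0 => /eqP.
Qed.

(** A nonzero constant entry of [X] joins equal degrees, so rows of degree j meet only columns of
    degree j. The blocks of degree j still multiply to the identity, which bounds their size. *)
Lemma block_count p q (ga : 'I_p -> A) (gb : 'I_q -> A)
    (X : 'M[R]_(p, q)) (Y : 'M[R]_(q, p)) j :
  homog_mx ga gb X -> const_mx0 X *m const_mx0 Y = 1%:M ->
  (#|[set a | ga a == j]| <= #|[set b | gb b == j]|)%N.
Proof.
move=> hX XY1.
set Sa := [set a | _]; set Sb := [set b | _].
pose X' := \matrix_(a < #|Sa|, b < #|Sb|) const_mx0 X (enum_val a) (enum_val b).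
pose Y' := \matrix_(b < #|Sb|, a < #|Sa|) const_mx0 Y (enum_val b) (enum_val a).
suff: X' *m Y' = 1%:M by apply: mulmx1_min.
apply/matrixP => a a'; rewrite !mxE.
transitivity (\sum_(b in Sb)
   const_mx0 X (enum_val a) b * const_mx0 Y b (enum_val a')).
  apply/esym; rewrite big_enum_val /=; apply: eq_bigr => b _. by rewrite !mxE.
transitivity ((const_mx0 X *m const_mx0 Y) (enum_val a) (enum_val a')).
  rewrite mxE [RHS](bigID (mem Sb)) /= [X in _ = _ + X]big1 ?addr0 // => b.
  have [->|/(const_mx0_block hX) gab] := eqVneq (const_mx0 X (enum_val a) b) 0.
    by rewrite mul0r.
  by rewrite inE -gab; have := enum_valP a; rewrite inE => ->.
by rewrite XY1 mxE (inj_eq enum_val_inj).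
Qed.

(** * Comparison of two minimal resolutions *)

Section Comparison.
Variables (I : R -> Prop).
Hypotheses (idI : is_ideal I) (hI : forall d p, I p -> I (hpart deg d p)).

Lemma lift_zero (F F' : free_complex V K A) :
  minimal_graded_free_resolution deg I F ->
  minimal_graded_free_resolution deg I F' ->
  exists phi : 'M_(rk F 0, rk F' 0),
   [/\ homog_mx (@gdeg V K A F 0) (@gdeg V K A F' 0) phi,
      forall a, I ((augm F - phi *m augm F') a 0)
    & exists W, bdry F 0 *m phi = W *m bdry F' 0].
Proof.
have [I0 ID IM] := idI.
move=> [[hb ha] [sur ex0 ex] mi] [[hb' ha'] [sur' ex0' ex'] mi'].
have [f fP] := fin_all_exists (fun a => sur' (augm F a 0)).
pose phi := \matrix_(a, b) hpart deg (@gdeg V K A F 0 a - @gdeg V K A F' 0 b) (f a 0 b).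
have phiP a : I ((augm F - phi *m augm F') a 0).
  have := hI (@gdeg V K A F 0 a) (fP a).
  rewrite linearB /= (hpart_id (ha a)).
  suff -> : hpart deg (gdeg a) ((f a *m augm F') 0 0) = (phi *m augm F') a 0.
    by rewrite !mxE.
  rewrite !mxE linear_sum /=; apply: eq_bigr => b _.
  by rewrite (hpartMr degD _ _ (ha' b)) mxE.
exists phi; split=> //; first by move=> a b; rewrite mxE; apply: hpart_homogeneous.
apply: (@row_image _ _ _ (fun u => I ((u *m augm F') 0 0))).
  by move=> u /ex0'.
move=> a; rewrite -row_mul mxE.
have -> : (bdry F 0 *m phi *m augm F') a 0 =
    (bdry F 0 *m augm F) a 0 + (-1) * (bdry F 0 *m (augm F - phi *m augm F')) a 0.
  by rewrite mulmxBr -mulmxA mulN1r mxB_entry opprB addrC subrK.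
apply: ID.
  have := (ex0 (row a (bdry F 0))).2; rewrite -row_mul mxE; apply.
  by exists (delta_mx 0 a); rewrite rowE.
by apply: (IM); rewrite mxE; apply: ideal_sum => // c _; apply: (IM); apply: phiP.
Qed.

(** This is the homotopy formula 1 - phi psi = h d + d h in one degree: [N] is the term d h built
    from the previous degree, zero in degree 0. Only what the induction needs of it is kept: it is
    killed by the boundary on its left, which permits the next lift, and by minimality it has no
    constant terms. *)
Lemma homotopy (F F' : free_complex V K A) i :
  minimal_graded_free_resolution deg I F ->
  minimal_graded_free_resolution deg I F' ->
  exists (phi : 'M_(rk F i, rk F' i)) (psi : 'M_(rk F' i, rk F i))
         (h : 'M_(rk F i, rk F i.+1)) (N : 'M_(rk F i)),
   [/\ homog_mx (@gdeg V K A F i) (@gdeg V K A F' i) phi,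
      (exists W, bdry F i *m phi = W *m bdry F' i) /\
      (exists W, bdry F' i *m psi = W *m bdry F i),
      1%:M - phi *m psi = h *m bdry F i + N,
      bdry F i *m N = 0
    & const_mx0 N = 0].
Proof.
move=> mF mF'; have [gF rF miF] := mF; have [gF' rF' miF'] := mF'.
have [I0 ID IM] := idI.
elim: i => [|i [phi [psi [h [N [hphi [[W WE] [psi' psiE]] hN bN cN]]]]]].
  have [phi [hphi augphi lphi]] := lift_zero mF mF'.
  have [psi [_ augpsi lpsi]] := lift_zero mF' mF.
  have [h hE] : exists h, 1%:M - phi *m psi = h *m bdry F 0.
    apply: (@row_image _ _ _ (fun u => I ((u *m augm F) 0 0))).
      by case: rF => _ ex0 _ u /ex0.
    move=> a; rewrite -row_mul mxE.
    have -> : ((1%:M - phi *m psi) *m augm F) a 0 =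
       (augm F - phi *m augm F') a 0 + (phi *m (augm F' - psi *m augm F)) a 0.
      by rewrite mulmxBl mulmxBr mul1mx mulmxA !mxB_entry addrA subrK.
    apply: ID => //; rewrite mxE; apply: ideal_sum => // c _.
    exact: IM.
  exists phi, psi, h, 0; split=> //; first by rewrite hE addr0.
    by rewrite mulmx0.
  by apply/matrixP => a b; rewrite !mxE mcoeff0.
have [phi' [hphi' phiE]] := homog_lift (homog_mx_mul (gF.1 i) hphi) (gF'.1 i) WE.
have bb (G : free_complex V K A) (rG : resolves I G) : forall k, bdry G k.+1 *m bdry G k = 0.
  move=> k; case: rG => _ _ ex; apply/row_matrixP => a.
  rewrite row_mul row0; apply/ex; exists (delta_mx 0 a); exact: rowE.
have lift (G : free_complex V K A) (rG : resolves I G) p (U : 'M_(p, rk G i.+1)) :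
    U *m bdry G i = 0 -> exists W, U = W *m bdry G i.+1.
  move=> U0; apply: (@row_image _ _ _ (fun u => u *m bdry G i = 0)).
    by case: rG => _ _ ex u /ex.
  by move=> a; rewrite -row_mul U0 row0.
(* Multiplied by [bdry F i] on the right, this matrix becomes [bdry F i] times 1 - phi psi - h d,
   that is [bdry F i *m N], which vanishes. *)
have [h' h'E] : exists h', 1%:M - phi' *m psi' - bdry F i *m h = h' *m bdry F i.+1.
  apply: lift => //.
  rewrite mulmxBl mulmxBl mul1mx -mulmxA -psiE mulmxA -phiE -!mulmxA.
  rewrite -[X in X - _ - _]mulmx1 -!mulmxBr hN addrAC subrr add0r.
  exact: bN.
exists phi', psi', h', (bdry F i *m h); split=> //.
- split; apply: lift => //.
    by rewrite -mulmxA -phiE mulmxA bb // mul0mx.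
  by rewrite -mulmxA -psiE mulmxA bb // mul0mx.
- by rewrite -h'E subrK.
- by rewrite mulmxA bb // mul0mx.
- rewrite const_mx0M; suff -> : const_mx0 (bdry F i) = 0 by rewrite mul0mx.
  by apply/matrixP => a b; rewrite !mxE; apply: miF.
Qed.

(** Modulo the variables both terms on the right of [homotopy] vanish, so the constant parts of phi
    and psi multiply to the identity. *)
Lemma betti_le (F F' : free_complex V K A) i j :
  minimal_graded_free_resolution deg I F ->
  minimal_graded_free_resolution deg I F' ->
  (#|[set a : 'I_(rk F i) | gdeg a == j]| <=
   #|[set a : 'I_(rk F' i) | gdeg a == j]|)%N.
Proof.
move=> mF mF'.
have [phi [psi [h [N [hphi _ hN _ cN]]]]] := homotopy i mF mF'.
apply: (block_count (Y := psi) j hphi).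
have cb : const_mx0 (bdry F i) = 0.
  by apply/matrixP => a b; rewrite !mxE; case: mF => _ _ ->.
have /eqP : const_mx0 (1%:M - phi *m psi) = 0.
  rewrite hN /const_mx0 map_mxD; have := const_mx0M h (bdry F i).
  by rewrite cb mulmx0 /const_mx0 => ->; rewrite add0r.
rewrite /const_mx0 map_mxB map_mx1 subr_eq0 => /eqP.
by rewrite -[map_mx _ (phi *m psi)]/(const_mx0 _) const_mx0M => <-.
Qed.

Lemma graded_betti_of (F : free_complex V K A) i j :
  minimal_graded_free_resolution deg I F ->
  graded_betti deg I i j #|[set a : 'I_(rk F i) | gdeg a == j]|.
Proof.
move=> mF; split=> [|F' mF']; first by exists F.
by apply/eqP; rewrite eqn_leq !betti_le.
Qed.

End Comparison.

End Uniqueness.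

(** * Reduction of a resolution along an acyclic matching *)

Section FreeModules.
Variables (T : finType) (R : comNzRingType).
Implicit Types (M : T -> T -> R) (z w : {ffun T -> R}).

Definition apply_kernel M z : {ffun T -> R} := [ffun s => \sum_t z t * M t s].
Definition ffscale (p : R) z : {ffun T -> R} := [ffun t => p * z t].
Definition ffbasis (t : T) : {ffun T -> R} := [ffun s => (s == t)%:R].

Lemma apply_kernelD M z w :
  apply_kernel M (z + w) = apply_kernel M z + apply_kernel M w.
Proof.
apply/ffunP => s; rewrite !ffunE -big_split; apply: eq_bigr => t _.
by rewrite ffunE mulrDl.
Qed.

Lemma apply_kernel_scale M p z :
  apply_kernel M (ffscale p z) = ffscale p (apply_kernel M z).
Proof.
apply/ffunP => s; rewrite !ffunE mulr_sumr; apply: eq_bigr => t _.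
by rewrite ffunE mulrA.
Qed.

Lemma apply_kernel0 M : apply_kernel M 0 = 0.
Proof. by apply/ffunP => s; rewrite !ffunE big1 // => t _; rewrite ffunE mul0r. Qed.

Lemma apply_kernelN M z : apply_kernel M (- z) = - apply_kernel M z.
Proof.
apply/ffunP => s; rewrite !ffunE -sumrN; apply: eq_bigr => t _.
by rewrite ffunE mulNr.
Qed.

Lemma apply_kernel_sum M (J : Type) (r : seq J) (P : pred J) (F : J -> {ffun T -> R}) :
  apply_kernel M (\sum_(i <- r | P i) F i) =
  \sum_(i <- r | P i) apply_kernel M (F i).
Proof. exact: (big_morph _ (apply_kernelD M) (apply_kernel0 M)). Qed.

Lemma apply_kernel_basis M t s : apply_kernel M (ffbasis t) s = M t s.
Proof.
rewrite ffunE (bigD1 t) //= big1 => [|r /negbTE rt]; rewrite ffunE.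
  by rewrite eqxx mul1r addr0.
by rewrite rt mul0r.
Qed.

Lemma sum_basis z : z = \sum_t ffscale (z t) (ffbasis t).
Proof.
apply/ffunP => s; rewrite sum_ffunE (bigD1 s) //= big1 => [|t /negbTE ts].
  by rewrite !ffunE eqxx mulr1 addr0.
by rewrite !ffunE eq_sym ts mulr0.
Qed.

End FreeModules.

Section Reduction.
Variables (V : finType) (K : fieldType) (A : zmodType) (deg : Div V -> A).
Hypothesis degD : {morph deg : x y / x + y}.
Notation R := {mpoly K[#|V|]}.
Notation const p := (p@_0%MM).
Variables (T : finType) (S : eqType) (M : T -> T -> R).
Variables (lev : T -> nat) (gd : T -> A) (chi : T -> S) (t0 : T).
Variables (I : R -> Prop).
Hypothesis idI : is_ideal I.
Hypothesis M_lev : forall t s, M t s != 0 -> lev t = (lev s).+1.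
Hypothesis M_hom : forall t s, homogeneous deg (gd t - gd s) (M t s).
Hypothesis M_chi : forall t s, const (M t s) != 0 -> chi t = chi s.
Hypothesis M_square : forall z, apply_kernel M (apply_kernel M z) = 0.
Hypothesis M_exact : forall z, apply_kernel M z = 0 -> I (z t0) ->
  exists w, z = apply_kernel M w.
Hypothesis M_image : forall z, I (apply_kernel M z t0).
Hypothesis lev0P : forall t, (lev t == 0%N) = (t == t0).
Hypothesis gd0 : gd t0 = 0.

Variables (src tgt : pred T) (mu : T -> T) (meas : T -> nat).
Hypothesis src_tgt : forall t, src t -> ~~ tgt t.
Hypothesis src0 : ~~ src t0.
Hypothesis tgt0 : ~~ tgt t0.
Hypothesis mu_tgt : forall t, src t -> tgt (mu t).
Hypothesis mu_inj : {in src &, injective mu}.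
Hypothesis mu_surj : forall t, tgt t -> exists2 s, src s & mu s = t.
Hypothesis M_mu : forall t, src t -> M t (mu t) = 1 \/ M t (mu t) = -1.
Hypothesis M_tri : forall t s, src t -> tgt s -> M t s != 0 -> s != mu t ->
  (meas s < meas (mu t))%N.

Definition critical t := ~~ src t && ~~ tgt t.

Hypothesis critical_lev : forall t s, critical t -> critical s ->
  chi t = chi s -> lev t = lev s.

Notation d := (apply_kernel M).
Notation vec := {ffun T -> R}.

(** Among the sources in the support of y, take the one whose partner has the largest [meas]. By
    [M_tri] no other source of the support reaches this partner, so the boundary has a nonzero
    coordinate there. *)
Lemma src_inj (y : vec) : (forall t, ~~ src t -> y t = 0) ->
  (forall t, tgt t -> d y t = 0) -> y = 0.
Proof.
move=> ysrc yd; apply/eqP/negPn/negP => y0.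
have [t yt] : exists t, y t != 0.
  apply/existsP; apply: contraNT y0; rewrite negb_exists => /forallP y0.
  by apply/eqP/ffunP => t; rewrite ffunE; apply/eqP; rewrite -[_ == _]negbK.
case: (arg_maxnP (P := fun t => y t != 0) (fun t => meas (mu t)) yt) => {yt}t yt tmax.
have st : src t by apply: contraNT yt => /ysrc ->.
have := yd _ (mu_tgt st); rewrite ffunE (bigD1 t) //= big1 ?addr0.
  move=> /eqP; rewrite mulf_eq0 (negbTE yt) /=.
  by case: (M_mu st) => ->; rewrite ?oppr_eq0 oner_eq0.
move=> s st'; have [->|ys] := eqVneq (y s) 0; first by rewrite mul0r.
have [->|Ms] := eqVneq (M s (mu t)) 0; first by rewrite mulr0.
have ss : src s by apply: contraNT ys => /ysrc ->.
have tm : (meas (mu s) <= meas (mu t))%N := tmax s ys.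
suff : (meas (mu t) < meas (mu s))%N by rewrite ltnNge tm.
apply: M_tri => //; first exact: mu_tgt.
by apply: contra_neq st' => /mu_inj ->.
Qed.

(** The last clause follows [chi] only through coefficients with a nonzero constant term. It
    survives all the corrections below and is what finally yields minimality. *)
Definition vec_type (e : A) (l : nat) (x : S) (y : vec) : Prop :=
  forall t, [/\ homogeneous deg (e - gd t) (y t), y t != 0 -> lev t = l
              & const (y t) != 0 -> chi t = x].

Lemma vec_typeD e l x y y' :
  vec_type e l x y -> vec_type e l x y' -> vec_type e l x (y + y').
Proof.
move=> ty ty' t; have [hy ly cy] := ty t; have [hy' ly' cy'] := ty' t.
rewrite ffunE; split; first exact: homogeneousD.
  by have [->|/ly//] := eqVneq (y t) 0; rewrite add0r.
by rewrite mcoeffD; have [->|/cy//] := eqVneq (const (y t)) 0; rewrite add0r.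
Qed.

Lemma vec_type0 e l x : vec_type e l x 0.
Proof.
by move=> t; rewrite ffunE mcoeff0 !eqxx; split=> //; apply: homogeneous0.
Qed.

Lemma vec_type_sum e l x (J : Type) (r : seq J) (P : pred J) F :
  (forall i, P i -> vec_type e l x (F i)) ->
  vec_type e l x (\sum_(i <- r | P i) F i).
Proof.
move=> tF; elim/big_rec: _ => [|i y Pi ty]; first exact: vec_type0.
by apply: vec_typeD => //; apply: tF.
Qed.

Lemma vec_type_scale e l x e' l' x' p y :
  homogeneous deg (e' - e) p -> (p != 0 -> l' = l) -> (const p != 0 -> x' = x) ->
  vec_type e l x y -> vec_type e' l' x' (ffscale p y).
Proof.
move=> hp lp cp ty t; have [hy ly cy] := ty t; rewrite ffunE; split.
- by rewrite -(subrKA e); apply: homogeneousM.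
- by rewrite mulf_eq0 negb_or => /andP [/lp -> /ly].
- by rewrite rmorphM mulf_eq0 negb_or => /andP [/cp -> /cy].
Qed.

Lemma vec_typeN e l x y : vec_type e l x y -> vec_type e l x (- y).
Proof.
move=> ty t; have [hy ly cy] := ty t; rewrite ffunE mcoeffN !oppr_eq0.
by split=> //; apply: homogeneousN.
Qed.

Lemma vec_type_basis t : vec_type (gd t) (lev t) (chi t) (ffbasis R t).
Proof.
move=> s; rewrite ffunE; have [->|st] := eqVneq s t.
  by split=> //; rewrite subrr; apply: homogeneous1.
by split; [apply: homogeneous0 | rewrite eqxx | rewrite mcoeff0 eqxx].
Qed.

(** The block of [M] from sources to targets is triangular with diagonal entries 1 or -1; [y] is its
    inverse, built by induction on [meas]. *)
Lemma src_lift : exists y : T -> vec, forall b, tgt b ->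
  [/\ vec_type (gd b) (lev b).+1 (chi b) (y b), forall t, ~~ src t -> y b t = 0
    & forall b', tgt b' -> d (y b) b' = (b' == b)%:R].
Proof.
suff lift n : exists y : T -> vec, forall b, tgt b -> (meas b < n)%N ->
  [/\ vec_type (gd b) (lev b).+1 (chi b) (y b), forall t, ~~ src t -> y b t = 0
    & forall b', tgt b' -> d (y b) b' = (b' == b)%:R].
  have [y yP] := lift (\max_b meas b).+1; exists y => b tb; apply: yP => //.
  by rewrite ltnS leq_bigmax.
elim: n => [|n [y yP]]; first by exists (fun=> 0).
suff /choice [f fP] : forall b, exists z : vec, tgt b -> (meas b < n.+1)%N ->
  [/\ vec_type (gd b) (lev b).+1 (chi b) z, forall t, ~~ src t -> z t = 0
    & forall b', tgt b' -> d z b' = (b' == b)%:R] by exists f.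
move=> b; case: (boolP (tgt b)) => [tb|]; last by exists 0.
have [a sa ab] := mu_surj tb.
pose P b' := tgt b' && (meas b' < meas b)%N.
(* The partner a of b, freed of its targets of smaller measure; [M a b] is its own inverse, so it
   normalizes the coefficient at b to 1. *)
exists (ffscale (M a b) (ffbasis R a - \sum_(b' | P b') ffscale (M a b') (y b'))).
move=> _; rewrite ltnS => bn.
have {}yP b' : P b' -> [/\ vec_type (gd b') (lev b').+1 (chi b') (y b'),
    forall t, ~~ src t -> y b' t = 0
    & forall b'', tgt b'' -> d (y b') b'' = (b'' == b')%:R].
  by case/andP => tb' b'b; apply: yP => //; apply: leq_trans bn.
have cu : const (M a b) != 0.
  rewrite -ab; case: (M_mu sa) => ->; rewrite ?mcoeffN ?oppr_eq0 mcoeff1 eqxx oner_eq0 //.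
have u0 : M a b != 0 by apply: contraNneq cu => ->; rewrite mcoeff0.
have gab : gd a = gd b.
  by have /eqP := homogeneous_const degD (@M_hom a b) cu; rewrite subr_eq0 => /eqP.
split.
- apply: (@vec_type_scale (gd a) (lev a) (chi a)).
  + by have := @M_hom a b; rewrite gab.
  + by move=> _; rewrite (M_lev u0).
  + by rewrite (M_chi cu).
  apply: vec_typeD; first exact: vec_type_basis.
  apply/vec_typeN/vec_type_sum => b' /yP [ty _ _].
  by apply: vec_type_scale ty; [apply: M_hom | apply: M_lev | apply: M_chi].
- move=> t st; rewrite !ffunE sum_ffunE big1 ?subr0 => [|b' /yP[_ y0 _]].
    by case: eqP st => [->|]; rewrite ?sa // mulr0.
  by rewrite ffunE y0 // mulr0.
- move=> b' tb'; rewrite apply_kernel_scale ffunE apply_kernelD apply_kernelN.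
  rewrite apply_kernel_sum ffunE apply_kernel_basis ffunE sum_ffunE.
  have -> : \sum_(b'' | P b'') d (ffscale (M a b'') (y b'')) b' =
            \sum_(b'' | P b'') M a b'' * (b' == b'')%:R.
    apply: eq_bigr => b'' /yP [_ _ dy].
    by rewrite apply_kernel_scale ffunE dy.
  have [->|bb'] := eqVneq b' b.
    rewrite big1 ?subr0 => [|b'' /andP[_]].
      by rewrite -ab; case: (M_mu sa) => ->; rewrite ?mulrNN mulr1.
    by case: eqP => [->|]; rewrite ?ltnn ?mulr0.
  case: (boolP (P b')) => [Pb'|nP].
    rewrite (bigD1 b') //= eqxx mulr1 big1 ?addr0 ?subrr ?mulr0 // => b''.
    by rewrite eq_sym => /andP [_ /negbTE ->]; rewrite mulr0.
  rewrite big1 => [|b'' Pb'']; last first.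
    by case: eqP => [bE|]; [rewrite bE Pb'' in nP | rewrite mulr0].
  have [->|Mab'] := eqVneq (M a b') 0; first by rewrite subrr mulr0.
  have := M_tri sa tb' Mab'; rewrite ab => /(_ bb').
  by rewrite /P tb' /= in nP; rewrite (negbTE nP).
Qed.

(* The reduced complex lives on the critical basis elements: each critical c is
   corrected by source elements until its boundary has no target component. *)
Section Reduced.
Variable y : T -> vec.
Hypothesis yP : forall b, tgt b ->
  [/\ vec_type (gd b) (lev b).+1 (chi b) (y b), forall t, ~~ src t -> y b t = 0
    & forall b', tgt b' -> d (y b) b' = (b' == b)%:R].

Definition corrected c : vec :=
  ffbasis R c - \sum_(b | tgt b) ffscale (M c b) (y b).

Definition reduced_kernel c c' : R :=
  if critical c && critical c' then d (corrected c) c' else 0.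

Notation N := reduced_kernel.

Lemma corrected_type c : vec_type (gd c) (lev c) (chi c) (corrected c).
Proof.
apply: vec_typeD; first exact: vec_type_basis.
apply/vec_typeN/vec_type_sum => b /yP [ty _ _].
by apply: vec_type_scale ty; [apply: M_hom | apply: M_lev | apply: M_chi].
Qed.

Lemma corrected_nsrc c t : ~~ src t -> corrected c t = (t == c)%:R.
Proof.
move=> st; rewrite !ffunE sum_ffunE big1 ?subr0 // => b /yP[_ y0 _].
by rewrite ffunE y0 // mulr0.
Qed.

Lemma corrected_tgt c b : tgt b -> d (corrected c) b = 0.
Proof.
move=> tb; rewrite apply_kernelD apply_kernelN apply_kernel_sum ffunE.
rewrite apply_kernel_basis ffunE sum_ffunE (bigD1 b) //= big1 ?addr0.
  have [_ _ dy] := yP tb.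
  by rewrite apply_kernel_scale ffunE dy // eqxx mulr1 subrr.
move=> b' /andP [tb' /negbTE bb']; have [_ _ dy] := yP tb'.
by rewrite apply_kernel_scale ffunE dy // eq_sym bb' mulr0.
Qed.

Lemma reduced_hom c c' : homogeneous deg (gd c - gd c') (N c c').
Proof.
rewrite /reduced_kernel; case: ifP => _; last exact: homogeneous0.
rewrite ffunE; apply: homogeneous_sum => t _; rewrite -(subrKA (gd t)).
apply: homogeneousM => //; by have [] := corrected_type c t.
Qed.

Lemma reduced_term c c' (f : {additive R -> K}) : f (N c c') != 0 ->
  exists t, f (corrected c t * M t c') != 0.
Proof.
rewrite /reduced_kernel; case: ifP => _; last by rewrite raddf0 eqxx.
rewrite ffunE raddf_sum => f0; apply/existsP; apply: contraNT f0.
rewrite negb_exists => /forallP f0; rewrite big1 // => t _.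
by apply/eqP; rewrite -[_ == _]negbK.
Qed.

Lemma reduced_lev c c' : N c c' != 0 -> lev c = (lev c').+1.
Proof.
move=> N0; have [m Nm] : exists m, (N c c')@_m != 0.
  by apply/not_existsP => Nm; case/eqP: N0; apply/mpolyP => m;
     rewrite mcoeff0; apply/eqP; have /negP := Nm m; rewrite negbK.
have [t] := reduced_term (f := mcoeff m) Nm.
move=> tm; have : corrected c t * M t c' != 0.
  by apply: contraNneq tm => ->; rewrite raddf0.
rewrite mulf_eq0 negb_or => /andP [ct /M_lev <-].
by have [_ /(_ ct) ->] := corrected_type c t.
Qed.

(** A nonzero constant term can only come from entries of [M] with the same property, along which
    [chi] is constant. By [critical_lev] the levels of c and c' would agree, although the boundary
    lowers the level by one. *)
Lemma reduced_minimal c c' : const (N c c') = 0.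
Proof.
apply/eqP/negPn/negP => N0.
have [t] := reduced_term (f := mcoeff 0%MM) N0.
rewrite /= rmorphM mulf_eq0 negb_or => /andP [ct /M_chi cc'].
have [_ _ /(_ ct)] := corrected_type c t; rewrite cc' => chicc'.
have N1 : N c c' != 0 by apply: contraNneq N0 => ->; rewrite mcoeff0.
have /andP [cc c'c] : critical c && critical c'.
  by move: N1; rewrite /reduced_kernel; case: ifP => //; rewrite eqxx.
have := reduced_lev N1; rewrite (critical_lev cc c'c (esym chicc')) => /eqP.
by rewrite eqn_leq ltnn andbF.
Qed.

Definition crit_supp (u : vec) := forall t, ~~ critical t -> u t = 0.

Definition correct (u : vec) : vec := \sum_(c | critical c) ffscale (u c) (corrected c).

Lemma correct_nsrc u t : crit_supp u -> ~~ src t -> correct u t = u t.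
Proof.
move=> su st; rewrite /correct sum_ffunE.
under eq_bigr => c _ do rewrite ffunE corrected_nsrc //.
have [ct|nct] := boolP (critical t).
  rewrite (bigD1 t) //= eqxx mulr1 big1 ?addr0 // => c /andP[_].
  by rewrite eq_sym => /negbTE ->; rewrite mulr0.
rewrite su // big1 // => c cc; case: eqP => [tc|]; last by rewrite mulr0.
by rewrite tc cc in nct.
Qed.

Lemma correct_tgt u b : tgt b -> d (correct u) b = 0.
Proof.
move=> tb; rewrite apply_kernel_sum sum_ffunE big1 // => c _.
by rewrite apply_kernel_scale ffunE corrected_tgt // mulr0.
Qed.

Lemma correct_crit u c : crit_supp u -> critical c ->
  d (correct u) c = apply_kernel N u c.
Proof.
move=> su cc; rewrite apply_kernel_sum sum_ffunE [RHS]ffunE [RHS](bigID critical) /=.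
rewrite [X in _ = _ + X]big1 ?addr0 => [|t /su ->]; last by rewrite mul0r.
apply: eq_bigr => c' cc'.
by rewrite apply_kernel_scale ffunE /reduced_kernel cc cc'.
Qed.

Lemma reduced_supp u : crit_supp (apply_kernel N u).
Proof.
move=> t nt; rewrite ffunE big1 // => c _.
by rewrite /reduced_kernel (negbTE nt) andbF mulr0.
Qed.

Lemma critical0 : critical t0.
Proof. by rewrite /critical src0. Qed.

Lemma vec_src_eq (z z' : vec) : (forall t, ~~ src t -> z t = z' t) ->
  (forall t, tgt t -> d z t = d z' t) -> z = z'.
Proof.
move=> zz' dzz'; apply/eqP; rewrite -subr_eq0; apply/eqP/src_inj => [t|t].
  by move=> /zz' E; rewrite !ffunE E subrr.
by move=> /dzz' E; rewrite apply_kernelD apply_kernelN !ffunE in E *; rewrite E subrr.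
Qed.

(** [correct] is a chain map. Both sides vanish on targets and have boundaries without target
    coordinates, so by [vec_src_eq] it is enough to compare critical coordinates. *)
Lemma reduced_image u : crit_supp u ->
  d (correct u) = correct (apply_kernel N u).
Proof.
move=> su; apply: vec_src_eq => [t st|t tt].
  rewrite correct_nsrc //; last exact: reduced_supp.
  have [tt|ntt] := boolP (tgt t).
    by rewrite correct_tgt // reduced_supp // /critical tt andbF.
  by rewrite correct_crit // /critical st.
by rewrite M_square correct_tgt // ffunE.
Qed.

Lemma reduced_square u : crit_supp u -> apply_kernel N (apply_kernel N u) = 0.
Proof.
move=> su; apply/ffunP => t; rewrite [RHS]ffunE.
have [ct|/reduced_supp-> //] := boolP (critical t).
rewrite -correct_crit //; last exact: reduced_supp.
by rewrite -reduced_image // M_square ffunE.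
Qed.

Lemma reduced_exact u : crit_supp u -> apply_kernel N u = 0 -> I (u t0) ->
  exists2 w, crit_supp w & u = apply_kernel N w.
Proof.
move=> su Nu Iu.
have dcu : d (correct u) = 0.
  by rewrite reduced_image // Nu /correct big1 // => c _; apply/ffunP => t; rewrite !ffunE mul0r.
have [|w wE] := M_exact dcu; first by rewrite correct_nsrc.
pose x := \sum_(b | tgt b) ffscale (w b) (y b).
(* Subtracting a boundary keeps [d w], and this one clears all target coordinates of w. *)
pose w1 := w - d x.
have w1E : d w1 = correct u by rewrite apply_kernelD apply_kernelN M_square subr0.
have w1b b : tgt b -> w1 b = 0.
  move=> tb; rewrite /w1 apply_kernel_sum !ffunE sum_ffunE (bigD1 b) //= big1.
    have [_ _ dy] := yP tb.
    by rewrite addr0 apply_kernel_scale ffunE dy // eqxx mulr1 subrr.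
  move=> b' /andP [tb' /negbTE bb']; have [_ _ dy] := yP tb'.
  by rewrite apply_kernel_scale ffunE dy // eq_sym bb' mulr0.
pose w2 : vec := [ffun t => if critical t then w1 t else 0].
have sw2 : crit_supp w2 by move=> t /negbTE ct; rewrite ffunE ct.
exists w2 => //.
have w12 : w1 = correct w2.
  apply: vec_src_eq => [t st|t tt]; last first.
    rewrite w1E correct_tgt // correct_nsrc //; first by rewrite su // /critical tt andbF.
    by apply/negP => /src_tgt; rewrite tt.
  rewrite correct_nsrc // [w2 _]ffunE /critical st /=; case: ifP => // /negbFE tt.
  exact: w1b.
apply/ffunP => t; have [ct|ct] := boolP (critical t); last first.
  by rewrite reduced_supp // su.
rewrite -correct_crit // -w12 w1E correct_nsrc //.
by case/andP: ct.
Qed.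

Lemma reduced_image_ideal u : crit_supp u -> I (apply_kernel N u t0).
Proof. by move=> su; rewrite -correct_crit ?critical0 //; apply: M_image. Qed.

End Reduced.

(** * Critical elements as bases of a graded free complex *)

Section CriticalComplex.
Variable N : T -> T -> R.
Hypothesis N_crit : forall c c', N c c' != 0 -> critical c && critical c'.
Hypothesis N_lev : forall c c', N c c' != 0 -> lev c = (lev c').+1.
Hypothesis N_hom : forall c c', homogeneous deg (gd c - gd c') (N c c').
Hypothesis N_minimal : forall c c', const (N c c') = 0.
Hypothesis N_square : forall u, crit_supp u -> apply_kernel N (apply_kernel N u) = 0.
Hypothesis N_exact : forall u, crit_supp u -> apply_kernel N u = 0 -> I (u t0) ->
  exists2 w, crit_supp w & u = apply_kernel N w.
Hypothesis N_image : forall u, crit_supp u -> I (apply_kernel N u t0).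

Definition crit_set i := [set t | critical t && (lev t == i)].

Definition crit_complex : free_complex V K A :=
  @FreeComplex V K A (fun i => #|crit_set i|)
    (fun i a => gd (enum_val a))
    (fun i => \matrix_(a, b) N (enum_val a) (enum_val b))
    (const_mx 1).

Definition extend i (u : 'rV[R]_#|crit_set i|) : vec :=
  [ffun t => \sum_a u 0 a * (enum_val a == t)%:R].

Lemma extend_val i (u : 'rV[R]_#|crit_set i|) a : extend u (enum_val a) = u 0 a.
Proof.
rewrite ffunE (bigD1 a) //= eqxx mulr1 big1 ?addr0 // => b ba.
by rewrite (inj_eq enum_val_inj) (negbTE ba) mulr0.
Qed.

Lemma extend_out i (u : 'rV[R]_#|crit_set i|) t : t \notin crit_set i -> extend u t = 0.
Proof.
move=> nt; rewrite ffunE big1 // => a _; case: eqP => [at_|]; last by rewrite mulr0.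
by rewrite -at_ enum_valP in nt.
Qed.

Lemma extend_supp i (u : 'rV[R]_#|crit_set i|) : crit_supp (extend u).
Proof.
by move=> t nt; rewrite extend_out // inE (negbTE nt).
Qed.

Lemma extend_kernel i (u : 'rV[R]_#|crit_set i.+1|) :
  apply_kernel N (extend u) = extend (u *m bdry crit_complex i).
Proof.
apply/ffunP => s; rewrite ffunE.
have [si|si] := boolP (s \in crit_set i); last first.
  rewrite extend_out // big1 // => t _.
  have [ti|ti] := boolP (t \in crit_set i.+1); last by rewrite extend_out // mul0r.
  have [->|Nts] := eqVneq (N t s) 0; first by rewrite mulr0.
  move: ti si; rewrite !inE => /andP [_ /eqP]; rewrite (N_lev Nts) => -[->].
  by have /andP [_ ->] := N_crit Nts; rewrite eqxx.
rewrite -[s in RHS](enum_rankK_in si si) extend_val mxE.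
rewrite (bigID (mem (crit_set i.+1))) /= [X in _ + X]big1 ?addr0; last first.
  by move=> t nt; rewrite extend_out // mul0r.
rewrite big_enum_val /=; apply: eq_bigr => a _.
by rewrite extend_val mxE enum_rankK_in.
Qed.

Lemma extend_zero i (u : 'rV[R]_#|crit_set i|) : extend u = 0 -> u = 0.
Proof. by move=> u0; apply/rowP => a; rewrite -extend_val u0 ffunE mxE. Qed.

Lemma extend0 i : extend (0 : 'rV[R]_#|crit_set i|) = 0.
Proof. by apply/ffunP => s; rewrite !ffunE big1 // => a _; rewrite mxE mul0r. Qed.

(** Entries of [N] join adjacent levels only, so the coordinates of w outside level i+1 do not reach
    level i and may be dropped. *)
Lemma kernel_level i (u : 'rV[R]_#|crit_set i|) w : extend u = apply_kernel N w ->
  exists w' : 'rV_#|crit_set i.+1|, u = w' *m bdry crit_complex i.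
Proof.
move=> uE; exists (\row_a w (enum_val a)); apply/rowP => b.
rewrite -extend_val uE ffunE mxE (bigID (mem (crit_set i.+1))) /=.
rewrite [X in _ + X]big1 ?addr0; last first.
  move=> t nt; have [->|Ntb] := eqVneq (N t (enum_val b)) 0; first by rewrite mulr0.
  move: nt; rewrite inE (N_lev Ntb); have /andP [-> _] := N_crit Ntb.
  by have := enum_valP b; rewrite inE => /andP [_ /eqP ->]; rewrite eqxx.
by rewrite big_enum_val /=; apply: eq_bigr => a _; rewrite !mxE.
Qed.

Lemma extend_augm (u : 'rV[R]_#|crit_set 0|) :
  (u *m augm crit_complex) 0 0 = extend u t0.
Proof.
rewrite mxE ffunE; apply: eq_bigr => a _; rewrite mxE.
have := enum_valP a; rewrite inE => /andP [_]; rewrite lev0P => /eqP ->.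
by rewrite eqxx.
Qed.

Lemma kernel_level0 (u : 'rV[R]_#|crit_set 0|) : apply_kernel N (extend u) = 0.
Proof.
apply/ffunP => s; rewrite !ffunE big1 // => t _.
have [ti|ti] := boolP (t \in crit_set 0); last by rewrite extend_out // mul0r.
have [->|Nts] := eqVneq (N t s) 0; first by rewrite mulr0.
by move: ti; rewrite inE (N_lev Nts) andbF.
Qed.

Lemma crit_complex_minimal : minimal_graded_free_resolution deg I crit_complex.
Proof.
have [I0 _ _] := idI.
split; last by move=> i a b; rewrite mxE N_minimal.
- split=> [i a b|b]; first by rewrite mxE; apply: N_hom.
  rewrite mxE /= ; have := enum_valP b; rewrite inE lev0P => /andP [_ /eqP ->].
  by rewrite gd0; apply: homogeneous1.
split.
- move=> p; have t00 : t0 \in crit_set 0.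
    by rewrite inE /critical src0 tgt0 lev0P eqxx.
  pose a0 := enum_rank_in t00 t0; exists (\row_a (p * (a == a0)%:R)).
  have := extend_val (\row_a (p * (a == a0)%:R)) a0.
  by rewrite extend_augm enum_rankK_in // mxE eqxx mulr1 => ->; rewrite subrr.
- move=> u; rewrite extend_augm; split=> [Iu|[w ->]].
    have [w _ uE] := N_exact (extend_supp u) (kernel_level0 u) Iu.
    exact: kernel_level uE.
  by rewrite -extend_kernel; apply/N_image/extend_supp.
- move=> i u; split=> [u0|[w ->]].
    have Nu : apply_kernel N (extend u) = 0 by rewrite extend_kernel u0 extend0.
    have [|w _ uE] := N_exact (extend_supp u) Nu.
      have lt0 : lev t0 = 0%N by apply/eqP; rewrite lev0P.
      by rewrite extend_out // inE lt0 andbF.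
    exact: kernel_level uE.
  by apply: extend_zero; rewrite -!extend_kernel N_square //; apply: extend_supp.
Qed.

Lemma crit_complex_count i j :
  #|[set a : 'I_(rk crit_complex i) | gdeg a == j]| =
  #|[set t | [&& critical t, lev t == i & gd t == j]]|.
Proof.
rewrite -(card_imset _ enum_val_inj); congr #|pred_of_set _|; apply/setP => t.
rewrite inE andbA; apply/imsetP/andP => [[a]|[ti tj]].
  by rewrite inE => aj ->; have := enum_valP a; rewrite inE.
have tc : t \in crit_set i by rewrite inE.
by exists (enum_rank_in tc t); rewrite ?inE /= ?enum_rankK_in.
Qed.

End CriticalComplex.

Lemma minimal_reduction : exists F : free_complex V K A,
  minimal_graded_free_resolution deg I F /\ forall i j, #|[set a : 'I_(rk F i) | gdeg a == j]| =
              #|[set t | [&& critical t, lev t == i & gd t == j]]|.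
Proof.
have [y yP] := src_lift; exists (crit_complex (reduced_kernel y)).
split; last exact: crit_complex_count.
apply: crit_complex_minimal.
- by move=> c c'; rewrite /reduced_kernel; case: ifP => //; rewrite eqxx.
- exact: reduced_lev.
- exact: reduced_hom.
- exact: reduced_minimal.
- exact: reduced_square.
- exact: reduced_exact.
- exact: reduced_image_ideal.
Qed.

End Reduction.

(** * Ordered partitions and their complex *)

(* Merging the cyclically consecutive blocks j and nxt L j of an ordered
   partition into blocks 0, ..., L sends level x to faceF L j x. *)
Definition nxt (L j : nat) : nat := if j == L then 0%N else j.+1.
Definition faceF (L j x : nat) : nat :=
  if (x <= j)%N then (if x == L then 0%N else x) else x.-1.

Lemma nxt_lt L j : (j < L)%N -> nxt L j = j.+1.
Proof. by rewrite /nxt => jL; rewrite (ltn_eqF jL). Qed.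

Ltac split_ifs := repeat match goal with
  |- context [if ?b then _ else _] =>
    lazymatch b with context [if _ then _ else _] => fail | _ => case: (boolP b) => ? end
  end.

Lemma faceF_comm L i j x : (i < j <= L)%N -> (x <= L)%N ->
  faceF L.-1 i (faceF L j x) = faceF L.-1 j.-1 (faceF L i x).
Proof. rewrite /faceF => ij xL; split_ifs; lia. Qed.

(** An edge with head at level a and tail at level b is collected when their blocks are merged; both
    orders of merging collect the same edges. [1 < L] excludes two blocks, where the second merge
    would join a block to itself. *)
Lemma faceF_expo L i j a b : (i < j <= L)%N -> (1 < L)%N -> (a <= L)%N -> (b <= L)%N ->
  (((a == nxt L j) && (b == j)) +
   ((faceF L j a == nxt L.-1 i) && (faceF L j b == i)) =
   ((a == nxt L i) && (b == i)) +
   ((faceF L i a == nxt L.-1 j.-1) && (faceF L i b == j.-1)))%N.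
Proof.
move=> ij L1 aL bL; rewrite /nxt.
have -> : (i == L) = false by lia.
have -> : (i == L.-1) = (j == L) && (i == j.-1) by lia.
have -> : (j.-1 == L.-1) = (j == L) by lia.
have -> : (faceF L j b == i) = (b == i) || [&& j == L, b == L & i == 0%N].
  by rewrite /faceF; split_ifs; lia.
have -> : (faceF L i b == j.-1) = (b == j) || (j == i.+1) && (b == i).
  by rewrite /faceF; split_ifs; lia.
have [jL|jL] := eqVneq j L; rewrite /=; last first.
  have -> : (faceF L j a == i.+1) = (a == i.+1) || (a == j.+1) && (i.+1 == j).
    by rewrite /faceF; split_ifs; lia.
  have -> : (faceF L i a == j.-1.+1) = (a == j.+1).
    by rewrite /faceF; split_ifs; lia.
  by have [bj|bj] := eqVneq b j; have [bi|bi] := eqVneq b i; lia.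
have -> : (faceF L i a == 0%N) = (a == 0%N) || (a == 1%N) && (i == 0%N).
  by rewrite /faceF; split_ifs; lia.
case: (eqVneq i j.-1) => [iL|iL] /=.
  have -> : (faceF L j a == 0%N) = (a == 0%N) || (a == L).
    by rewrite /faceF; split_ifs; lia.
  by have [bj|bj] := eqVneq b j; have [bi|bi] := eqVneq b i; lia.
have -> : (faceF L j a == i.+1) = (a == i.+1).
  by rewrite /faceF; split_ifs; lia.
by have [bj|bj] := eqVneq b j; have [bi|bi] := eqVneq b i; lia.
Qed.

Lemma faceF_inner L j a b : (j < L)%N -> (a <= L)%N -> (b <= L)%N ->
  ((faceF L j b < faceF L j a) + ((a == nxt L j) && (b == j)) = (b < a))%N.
Proof. rewrite /nxt /faceF => *; split_ifs; lia. Qed.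

(** Firing the last block: its edges to the first block become unoriented and its other edges are
    reversed. The two extra terms are the positive and the negative part of the Laplacian of the
    indicator of this block, on opposite sides to avoid subtraction. *)
Lemma faceF_cyclic L a b : (0 < L)%N -> (a <= L)%N -> (b <= L)%N ->
  ((faceF L L b < faceF L L a) + ((a == nxt L L) && (b == L)) + ((a == L) && (b < L)) =
   (b < a) + ((a < L) && (b == L)))%N.
Proof. rewrite /nxt /faceF => *; split_ifs; lia. Qed.

Lemma faceF_eq L j a b : (0 < L)%N -> (j <= L)%N -> (a <= L)%N -> (b <= L)%N ->
  (faceF L j a == faceF L j b) =
  [|| a == b, (a == nxt L j) && (b == j) | (b == nxt L j) && (a == j)].
Proof. rewrite /nxt /faceF => *; split_ifs; lia. Qed.

Lemma simplicial_sum (Z : zmodType) L (F : nat -> nat -> Z) :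
  (forall i j, (i < j <= L)%N -> F j i = - F i j.-1) ->
  \sum_(j < L.+1) \sum_(i < L) F j i = 0.
Proof.
move=> Fij.
have -> : \sum_(j < L.+1) \sum_(i < L) F j i =
  \sum_(j < L.+1) \sum_(i < L | (i < j)%N) F j i +
  \sum_(j < L.+1) \sum_(i < L | (j <= i)%N) F j i.
  rewrite -big_split; apply: eq_bigr => j _; rewrite (bigID (fun i : 'I_L => (i < j)%N)) /=.
  by congr (_ + _); apply: eq_bigl => i; rewrite -leqNgt.
have -> : \sum_(j < L.+1) \sum_(i < L | (i < j)%N) F j i =
  - (\sum_(j < L) \sum_(i < L | (i <= j)%N) F i j).
  rewrite big_ord_recl [X in X + _]big_pred0 ?add0r // -sumrN; apply: eq_bigr => j _.
  rewrite -sumrN; apply: eq_big => [i|i ij]; first by rewrite lift0 ltnS.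
  by rewrite lift0 in ij *; rewrite Fij // ij /=.
rewrite big_ord_recr /= [X in _ + (_ + X)]big_pred0 ?addr0 => [|i]; last first.
  by rewrite leqNgt ltn_ord.
rewrite [X in _ + X](eq_bigr (fun i : 'I_L => \sum_(j < L) (if (i <= j)%N then F i j else 0))).
  rewrite exchange_big /= addrC; apply/eqP; rewrite subr_eq0; apply/eqP.
  by apply: eq_bigr => j _; rewrite [RHS]big_mkcond.
by move=> i _; rewrite big_mkcond.
Qed.

Section Levels.
Variables (V : finType) (G : multigraph V) (q : V).

(* An ordered set partition of V with q in its first block, encoded by the
   function sending a vertex to the index of its block. *)
Definition is_leveling (h : {ffun V -> 'I_#|V|.+1}) : bool :=
  (h q == ord0) && [forall v, forall j : 'I_#|V|.+1, (j < h v)%N ==> [exists u, h u == j]].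

Definition leveling : Type := {h : {ffun V -> 'I_#|V|.+1} | is_leveling h}.
HB.instance Definition _ := SubFinite.on leveling.

Definition level (t : leveling) (v : V) : nat := val t v.
Definition height (t : leveling) : nat := \max_v level t v.

Lemma trivial_leveling_proof : is_leveling [ffun=> ord0].
Proof.
rewrite /is_leveling ffunE eqxx; apply/forallP => v; apply/forallP => j.
by rewrite ffunE ltn0.
Qed.

Definition trivial_leveling : leveling :=
  exist is_leveling _ trivial_leveling_proof.

Lemma level_q t : level t q = 0%N.
Proof. by have /andP [/eqP tq _] := valP t; rewrite /level tq. Qed.

Lemma level_le t v : (level t v <= height t)%N.
Proof. exact: leq_bigmax. Qed.

Lemma level_onto t i : (i <= height t)%N -> exists v, level t v = i.
Proof.
have V0 : (0 < #|V|)%N by apply/card_gt0P; exists q.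
have [v vE] := eq_bigmax (level t) V0; rewrite /height vE.
rewrite leq_eqVlt => /predU1P[->|iv]; first by exists v.
have /andP [_ /forallP/(_ v)/forallP tP] := valP t.
have iV : (i < #|V|.+1)%N by apply: ltn_trans iv (ltn_ord _).
have := tP (Ordinal iV); rewrite iv => /existsP [u /eqP uE].
by exists u; rewrite /level uE.
Qed.

Lemma level_inj t t' : level t =1 level t' -> t = t'.
Proof. by move=> tt'; apply/val_inj/ffunP => v; apply/val_inj/tt'. Qed.

Definition leveling_conditions (f : V -> nat) L :=
  [/\ f q = 0%N, forall v, (f v <= L)%N & forall i, (i <= L)%N -> exists v, f v = i].

(* Kept opaque so that unification never unfolds faces of levelings. *)
Lemma leveling_of (f : V -> nat) : {t : leveling |
  forall L, leveling_conditions f L -> level t =1 f /\ height t = L}.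
Proof.
pose h : {ffun V -> 'I_#|V|.+1} := [ffun v => inord (f v)].
exists (insubd trivial_leveling h) => L [fq fL fonto].
have LV : (L < #|V|.+1)%N.
  have /fin_all_exists [g gP] : forall i : 'I_L.+1, exists v, f v = i.
    by move=> i; apply: fonto; rewrite -ltnS.
  have g_inj : injective g by move=> i j ij; apply/val_inj; rewrite /= -(gP i) -(gP j) ij.
  by have := leq_card g g_inj; rewrite card_ord; apply: leqW.
have fV v : (f v < #|V|.+1)%N by apply: leq_ltn_trans LV.
have isl : is_leveling h.
  rewrite /is_leveling ffunE -val_eqE /= inordK ?fV // fq eqxx.
  apply/forallP => v; apply/forallP => j; rewrite ffunE inordK //; apply/implyP => jv.
  have [|u fu] := fonto j; first by rewrite ltnW // (leq_trans jv).
  by apply/existsP; exists u; rewrite ffunE -val_eqE /= inordK // fu.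
have lE : level (insubd trivial_leveling h) =1 f.
  by move=> v; rewrite /level val_insubd isl ffunE inordK.
split=> //; rewrite /height; apply/eqP; rewrite eqn_leq; apply/andP; split.
  by apply/bigmax_leqP => v _; rewrite lE.
have [v <-] := fonto L (leqnn _); rewrite -lE; exact: leq_bigmax.
Qed.

Definition mk_leveling f : leveling := sval (leveling_of f).

Lemma mk_levelingP f L : leveling_conditions f L ->
  level (mk_leveling f) =1 f /\ height (mk_leveling f) = L.
Proof. exact: (svalP (leveling_of f)). Qed.

Lemma height0P t : (height t == 0%N) = (t == trivial_leveling).
Proof.
apply/eqP/eqP => [t0|->].
  apply: level_inj => v; rewrite [RHS]/level /= ffunE /=.
  by apply/eqP; rewrite -leqn0 -t0 level_le.
by apply/eqP; rewrite -leqn0; apply/bigmax_leqP => v _; rewrite /level ffunE.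
Qed.

Definition face (j : nat) (t : leveling) : leveling :=
  mk_leveling (fun v => faceF (height t) j (level t v)).

Lemma faceP j t : (0 < height t)%N -> (j <= height t)%N ->
  (forall v, level (face j t) v = faceF (height t) j (level t v)) /\
  height (face j t) = (height t).-1.
Proof.
move=> t0 jt; apply: mk_levelingP; split=> [|v|i it].
- by rewrite level_q /faceF /=; case: eqP.
- by have := level_le t v; rewrite /faceF; split_ifs; lia.
have [u ui] := @level_onto t i (leq_trans it (leq_pred _)).
have [w wi] : exists w, level t w = i.+1 by apply: level_onto; lia.
have [ij|ij] := leqP i j; [exists u | exists w]; rewrite /faceF ?ui ?wi;
  split_ifs; lia.
Qed.

Definition merge_expo (j : nat) (t : leveling) (v : V) : nat :=
  \sum_u mult G v u * ((level t v == nxt (height t) j) && (level t u == j)).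

Definition indeg (t : leveling) (v : V) : nat :=
  \sum_u mult G v u * (level t u < level t v).

Lemma merge_expo_comm i j t v : (1 < height t)%N -> (i < j <= height t)%N ->
  (merge_expo j t v + merge_expo i (face j t) v =
   merge_expo i t v + merge_expo j.-1 (face i t) v)%N.
Proof.
move=> t1 ij; have t0 : (0 < height t)%N by lia.
have [fj hj] : _ /\ _ := faceP t0 (proj2 (andP ij)).
have [fi hi] : _ /\ _ := @faceP i t t0 ltac:(lia).
rewrite /merge_expo hj hi -!big_split; apply: eq_bigr => u _ /=.
by rewrite -!mulnDr !fj !fi faceF_expo ?level_le.
Qed.

Lemma face_comm i j t : (1 < height t)%N -> (i < j <= height t)%N ->
  face i (face j t) = face j.-1 (face i t).
Proof.
move=> t1 ij; have t0 : (0 < height t)%N by lia.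
have [fj hj] : _ /\ _ := faceP t0 (proj2 (andP ij)).
have [fi hi] : _ /\ _ := @faceP i t t0 ltac:(lia).
have [fij _] : _ /\ _ := @faceP i (face j t) ltac:(lia) ltac:(lia).
have [fji _] : _ /\ _ := @faceP j.-1 (face i t) ltac:(lia) ltac:(lia).
apply: level_inj => v.
rewrite fij fji hi hj fj fi.
apply: faceF_comm => //; exact: level_le.
Qed.

Lemma indeg_inner j t v : (j < height t)%N ->
  (indeg (face j t) v + merge_expo j t v = indeg t v)%N.
Proof.
move=> jt; have [fj hj] : _ /\ _ := @faceP j t ltac:(lia) ltac:(lia).
rewrite -big_split; apply: eq_bigr => u _ /=.
by rewrite -mulnDr !fj faceF_inner ?level_le.
Qed.

Lemma indeg_cyclic t v : (0 < height t)%N ->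
  (indeg (face (height t) t) v + merge_expo (height t) t v +
   \sum_u mult G v u * ((level t v == height t) && (level t u < height t)) =
   indeg t v +
   \sum_u mult G v u * ((level t v < height t) && (level t u == height t)))%N.
Proof.
move=> t0; have [fj hj] : _ /\ _ := @faceP (height t) t t0 (leqnn _).
rewrite -!big_split; apply: eq_bigr => u _ /=.
by rewrite -!mulnDr !fj faceF_cyclic ?level_le.
Qed.

(** Plays the role of [chi] in the reduction. The orientation could not do so: the cyclic merge
    reverses edges at the last block even when no edge joins it to the first. *)
Definition unoriented_edges (t : leveling) : {set V * V} :=
  [set e | adj G e.1 e.2 && (level t e.1 == level t e.2)].

Lemma merge_expo0_unoriented j t : (0 < height t)%N -> (j <= height t)%N ->
  (forall v, merge_expo j t v = 0%N) -> unoriented_edges (face j t) = unoriented_edges t.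
Proof.
move=> t0 jt e0; have [fj hj] := faceP t0 jt.
have nadj u v : level t u = nxt (height t) j -> level t v = j -> adj G u v = false.
  move=> uj vj; apply/negbTE; rewrite -leqNgt leqn0.
  have /eqP := e0 u; rewrite sum_nat_eq0 => /forallP/(_ v).
  by rewrite uj vj !eqxx muln1.
apply/setP => -[u v]; rewrite !inE /= !fj faceF_eq ?level_le //.
case uv: (adj G u v) => //=; case: eqP => //= _.
apply/norP; split; apply/andP => -[/eqP au /eqP av].
  by rewrite nadj in uv.
by rewrite /adj mult_sym -/(adj G v u) nadj in uv.
Qed.

Lemma merge_expo0_level j t u v : (j < height t)%N ->
  (forall v, merge_expo j t v = 0%N) -> adj G u v ->
  (level (face j t) u < level (face j t) v)%N = (level t u < level t v)%N.
Proof.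
move=> jt e0 uv; have [fj hj] : _ /\ _ := @faceP j t ltac:(lia) ltac:(lia).
have := faceF_inner jt (level_le t v) (level_le t u); rewrite -!fj.
have -> : (level t v == nxt (height t) j) && (level t u == j) = false.
  apply/negbTE/negP => jvu; have /eqP := e0 v; rewrite sum_nat_eq0 => /forallP/(_ u).
  by rewrite jvu muln1 mult_sym eqn0Ngt -/(adj G u v) uv.
by rewrite /= addn0; case: (_ < _)%N; case: (_ < _)%N.
Qed.

End Levels.

(** * The boundary map of the partition complex and its grading *)

Section Kernel.
Variables (V : finType) (G : multigraph V) (q : V) (K : fieldType) (eps : bool).
Notation R := {mpoly K[#|V|]}.
Notation monom := 'X_{1..#|V|}.
Notation T := (leveling q).

Definition mnm_of (f : V -> nat) : monom := [multinom f (enum_val i) | i < #|V|].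

Lemma mnm_of_rank f v : mnm_of f (enum_rank v) = f v.
Proof. by rewrite mnmE enum_rankK. Qed.

Lemma monomP (m m' : monom) :
  (forall v, m (enum_rank v) = m' (enum_rank v)) <-> m = m'.
Proof.
split=> [mm'|-> //]; apply/mnmP => i; rewrite -(enum_valK i); exact: mm'.
Qed.

Definition merge_mnm j (t : T) : monom := mnm_of (merge_expo G j t).

(* The complex resolves the toppling ideal for eps = true, and its initial ideal
   for eps = false, where the last block is never merged into the first one. *)
Definition face_coef j (t : T) : K :=
  (-1) ^+ j * (if j == height t then eps%:R else 1).

(** A sum, because different merges can have the same result: for two blocks the inner and the
    cyclic merge both give the trivial partition, and the entry is a binomial when [eps] holds. *)
Definition flag_kernel (t s : T) : R :=
  \sum_(j < (height t).+1)
     if (0 < height t)%N && (s == face j t) then face_coef j t *: 'X_[merge_mnm j t] else 0.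

Lemma flag_kernel_neq0 t s (f : {additive R -> K}) : f (flag_kernel t s) != 0 ->
  exists j, [/\ (0 < height t)%N, (j <= height t)%N, s = face j t
    & f (face_coef j t *: 'X_[merge_mnm j t]) != 0].
Proof.
rewrite raddf_sum => f0.
have /existsP [j] : [exists j : 'I_(height t).+1,
    f (if (0 < height t)%N && (s == face j t) then face_coef j t *: 'X_[merge_mnm j t] else 0) != 0].
  apply: contraNT f0; rewrite negb_exists => /forallP f0; rewrite big1 // => j _.
  by apply/eqP; rewrite -[_ == _]negbK.
case: ifP => [/andP [t0 /eqP sj] fj|]; last by rewrite raddf0 eqxx.
by exists j; split=> //; rewrite -ltnS.
Qed.

Lemma mpoly_neq0 (p : R) : p != 0 -> exists m, p@_m != 0.
Proof.
move=> p0; apply/not_existsP => pm; case/eqP: p0; apply/mpolyP => m.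
by rewrite mcoeff0; apply/eqP; have /negP := pm m; rewrite negbK.
Qed.

Lemma flag_kernel_height t s : flag_kernel t s != 0 -> height t = (height s).+1.
Proof.
move=> /mpoly_neq0 [m /(flag_kernel_neq0 (f := mcoeff m)) [j [t0 jt -> _]]].
by rewrite (faceP t0 jt).2 prednK.
Qed.

Lemma face_coef_comm i j (t : T) : (1 < height t)%N -> (i < j <= height t)%N ->
  face_coef j t * face_coef i (face j t) = - (face_coef i t * face_coef j.-1 (face i t)).
Proof.
move=> t1 ij; rewrite /face_coef.
have -> : height (face j t) = (height t).-1 by apply: (faceP _ _).2; lia.
have -> : height (face i t) = (height t).-1 by apply: (faceP _ _).2; lia.
have -> : (i == height t) = false by lia.
have -> : (j.-1 == (height t).-1) = (j == height t) by lia.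
rewrite mulrACA [in RHS]mulrACA mul1r.
set x := if j == _ then _ else _; set y := if i == _ then _ else _.
(* If j is the last block and i the one before it, both merges are cyclic and [eps] occurs twice;
   being 0 or 1, it is idempotent. *)
have -> : x * y = x.
  rewrite /x /y; have [jL|jL] := eqVneq j (height t); last first.
    by case: eqP => [|_]; rewrite ?mulr1 //; lia.
  by case: eqP => _; rewrite ?mulr1 // -natrM mulnb andbb.
clearbody x; case: j ij => // j ij /=.
by rewrite exprS -!mulrA mulN1r mulrCA mulrA.
Qed.

Lemma flag_kernel_square (z : {ffun T -> R}) :
  apply_kernel flag_kernel (apply_kernel flag_kernel z) = 0.
Proof.
apply/ffunP => r; rewrite [LHS]ffunE [RHS]ffunE.
under eq_bigr do rewrite ffunE mulr_suml.
rewrite exchange_big big1 //= => t _; under eq_bigr do rewrite -mulrA.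
rewrite -mulr_sumr [X in _ * X](_ : _ = 0) ?mulr0 // => {z}.
have [t1|t1] := leqP (height t) 1.
  rewrite big1 // => s _.
  have [->|/flag_kernel_height ts] := eqVneq (flag_kernel t s) 0; first by rewrite mul0r.
  have [->|/flag_kernel_height sr] := eqVneq (flag_kernel s r) 0; first by rewrite mulr0.
  lia.
have t0 : (0 < height t)%N by lia.
pose F j i : R := if r == face i (face j t) then
  (face_coef j t * face_coef i (face j t)) *: 'X_[merge_mnm j t + merge_mnm i (face j t)] else 0.
transitivity (\sum_(j < (height t).+1) \sum_(i < height t) F j i).
  under eq_bigr do rewrite mulr_suml.
  rewrite exchange_big; apply: eq_bigr => j _ /=.
  have jt : (j <= height t)%N by rewrite -ltnS.
  have hj := (faceP t0 jt).2.
  rewrite (bigD1 (face j t)) //= t0 eqxx /= [X in _ + X]big1 ?addr0; last first.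
    by move=> s /negbTE ->; rewrite mul0r.
  rewrite /flag_kernel hj prednK // mulr_sumr; apply: eq_bigr => i _.
  have -> : (0 < (height t).-1)%N by lia.
  rewrite /F /=; case: ifP => _; last by rewrite mulr0.
  by rewrite -scalerAl -scalerAr scalerA mpolyXD.
apply: simplicial_sum => i j ij; rewrite /F face_comm // face_coef_comm //.
suff -> : (merge_mnm j t + merge_mnm i (face j t) = merge_mnm i t + merge_mnm j.-1 (face i t))%MM.
  by case: ifP => _; rewrite ?oppr0 // scaleNr.
apply/monomP => v; rewrite !mnmDE !mnm_of_rank; exact: merge_expo_comm.
Qed.

Lemma flag_kernel_unoriented t s : (flag_kernel t s)@_0%MM != 0 ->
  unoriented_edges G t = unoriented_edges G s.
Proof.
move=> /(flag_kernel_neq0 (f := mcoeff 0%MM)) [j [t0 jt -> /=]].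
rewrite mcoeffZ mcoeffX mulf_eq0 negb_or => /andP [_].
have [e0 _|_] := eqVneq (merge_mnm j t) 0%MM; last by rewrite eqxx.
apply/esym/merge_expo0_unoriented => // v.
by rewrite -mnm_of_rank -/(merge_mnm j t) e0 mnm0E.
Qed.

Section Degree.
Variables (A : zmodType) (deg : Div V -> A).
Hypothesis degD : {morph deg : x y / x + y}.
Hypothesis deg_laplacian : forall f, deg (laplacian G f) = 0.

Definition div_of (f : V -> nat) : Div V := [ffun v => (f v)%:Z].

Definition leveling_deg (t : T) : A := deg (div_of (indeg G t)).

Lemma mdg_mnm_of f : mdg deg (mnm_of f) = deg (div_of f).
Proof. by rewrite /mdg; congr deg; apply/ffunP => v; rewrite !ffunE mnm_of_rank. Qed.

(** An inner merge moves the contracted edges from the indegree into the monomial. The cyclic merge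
    does so up to the Laplacian of the indicator of the last block, which [deg] kills. *)
Lemma leveling_deg_face j t : (0 < height t)%N -> (j <= height t)%N ->
  leveling_deg t = mdg deg (merge_mnm j t) + leveling_deg (face j t).
Proof.
move=> t0; rewrite leq_eqVlt mdg_mnm_of -degD => /predU1P[->|jt].
  pose f v : int := (level t v == height t)%:R.
  rewrite -[RHS]addr0 -(deg_laplacian f) -degD; congr deg; apply/ffunP => v.
  rewrite !ffunE /= /f.
  have -> : \sum_w ((level t v == height t)%:R - (level t w == height t)%:R) *+ mult G v w =
     (\sum_u mult G v u * ((level t v == height t) && (level t u < height t)))%N%:Z -
     (\sum_u mult G v u * ((level t v < height t) && (level t u == height t)))%N%:Z :> int.
    rewrite !(big_morph Posz PoszD (erefl (0%N : int))) -sumrB; apply: eq_bigr => w _.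
    have := level_le t v; have := level_le t w.
    by case: ltngtP => //; case: ltngtP => // *; rewrite ?muln0 ?muln1; lia.
  have := indeg_cyclic G v t0; lia.
by congr deg; apply/ffunP => v; rewrite !ffunE; have := indeg_inner G v jt; lia.
Qed.

Lemma flag_kernel_homogeneous t s :
  homogeneous deg (leveling_deg t - leveling_deg s) (flag_kernel t s).
Proof.
apply: homogeneous_sum => // j _; case: ifP => [/andP [t0 /eqP ->]|_]; last first.
  exact: homogeneous0.
have jt : (j <= height t)%N by rewrite -ltnS.
rewrite (leveling_deg_face t0 jt) addrK; apply: homogeneousZ => //.
exact: homogeneousX.
Qed.

End Degree.
End Kernel.

(** * Exactness *)

Section Distance.
Variables (V : finType) (G : multigraph V).

Lemma dist_le u v p : path (adj G) u p -> last u p = v -> (dist G u v <= size p)%N.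
Proof.
move=> up lp; rewrite /dist; have [pV|pV] := ltnP (size p) #|V|; last first.
  by apply: leq_trans pV; rewrite -[X in (_ <= X)%N](size_iota 0) find_size.
rewrite leqNgt; apply/negP => /(before_find 0%N).
rewrite nth_iota // add0n => /negbT /existsP []; exists (in_tuple p).
by rewrite up lp eqxx.
Qed.

Lemma dist_path u v : exists p, [/\ path (adj G) u p, last u p = v & size p = dist G u v].
Proof.
have /connectP [p up ->] := mult_connected G u v.
(* A simple path has fewer than [#|V|] steps, so the search in [dist] succeeds. *)
case/shortenP: up => p' up' up'_uniq _.
set P := (fun k => [exists p0 : k.-tuple V, path (adj G) u p0 && (last u p0 == last u p')]).
have hasP : has P (iota 0 #|V|).
  apply/hasP; exists (size p'); last by apply/existsP; exists (in_tuple p'); rewrite up' /=.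
  rewrite mem_iota /= add0n; have := uniq_leq_size up'_uniq (fun x _ => mem_enum V x).
  by rewrite -cardE.
have := nth_find 0%N hasP; rewrite nth_iota -?has_find ?add0n; last first.
  by move: hasP; rewrite has_find size_iota.
case/existsP => p0 /andP [up0 /eqP lp0]; exists p0; split=> //.
by rewrite size_tuple.
Qed.

Variable q : V.

Lemma dist_step v : v != q -> exists2 w, adj G v w & (dist G w q < dist G v q)%N.
Proof.
move=> vq; have [[|w p] /= [vp lp <-]] := dist_path v q; first by rewrite lp eqxx in vq.
case/andP: vp => vw wp; exists w => //; exact: dist_le.
Qed.

Lemma dist_adj u v : adj G u v -> (dist G u q <= (dist G v q).+1)%N.
Proof.
move=> uv; have [p [vp lp <-]] := dist_path v q.
by apply: (@dist_le _ _ (v :: p)) => //=; rewrite uv.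
Qed.

Lemma dist_card v : (dist G v q <= #|V|)%N.
Proof. by rewrite -[X in (_ <= X)%N](size_iota 0) find_size. Qed.

(* A weight that is strictly superharmonic away from q: a step towards q loses
   more than all the steps away from q can gain. *)
Definition base : nat := (\sum_u \sum_v mult G u v).+1.
Definition radial (k : nat) : nat := \sum_(s < k) base ^ (#|V| - s).
Definition weight (v : V) : nat := radial (dist G v q).

Lemma radialS k : radial k.+1 = (radial k + base ^ (#|V| - k))%N.
Proof. exact: big_ord_recr. Qed.

Lemma radial_mono : {homo radial : k l / (k <= l)%N}.
Proof. by apply: homo_leq leqnn leq_trans _ => k; rewrite radialS leq_addr. Qed.

Lemma weight_gt0 v : v != q -> (0 < weight v)%N.
Proof.
move=> /dist_step [w _]; rewrite /weight.
by case: (dist G v q) => // n _; rewrite radialS addn_gt0 expn_gt0 orbT.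
Qed.

Lemma weight_superharmonic v : v != q ->
  (\sum_u mult G v u * weight u < \sum_u mult G v u * weight v)%N.
Proof.
move=> vq; have [w vw wv] := dist_step vq.
case dE : (dist G v q) wv => [//|d]; rewrite ltnS => wd.
(* The increment of [radial] beyond the distance of v, hence the largest gain at a neighbour. The
   loss towards q is [base * c], where [d < #|V|] keeps the truncated exponent exact, and [base]
   exceeds the degree of v. *)
pose c := (base ^ (#|V| - d.+1))%N.
have dV : (d < #|V|)%N by rewrite -dE dist_card.
have step u : adj G v u -> (weight u <= weight v + c)%N.
  move=> vu; rewrite /weight dE -radialS; apply: radial_mono.
  by rewrite -dE dist_adj // /adj mult_sym.
have wstep : (weight w + base * c <= weight v)%N.
  rewrite /weight dE radialS -expnS -subSn // subSS leq_add2r.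
  exact: radial_mono.
have c0 : (0 < c)%N by rewrite expn_gt0.
have sum_base : (\sum_u mult G v u < base)%N.
  by rewrite /base ltnS [X in (_ <= X)%N](bigD1 v) //= leq_addr.
have mw : (0 < mult G v w)%N := vw.
suff : (\sum_u mult G v u * weight u + base * c <=
        \sum_u mult G v u * (weight v + c))%N.
  under [X in (_ <= X)%N]eq_bigr do rewrite mulnDr.
  rewrite big_split /= -[X in (_ <= _ + X)%N]big_distrl /=; nia.
rewrite (bigD1 w) //= [X in (_ <= X)%N](bigD1 w) //= addnAC leq_add //; first nia.
apply: leq_sum => u _; have [uv|] := posnP (mult G v u); first by rewrite uv.
by move=> vu; rewrite leq_mul2l step ?orbT.
Qed.

End Distance.

Section Weights.
Variables (V : finType) (G : multigraph V) (q : V).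
Notation T := (leveling q).
Notation wt := (weight G q).

Definition leveling_weight (t : T) : nat := \sum_v wt v * indeg G t v.

(** Superharmonicity is summed over the last block, which avoids q. Edges inside the block cancel by
    symmetry, and what remains compares the two ends of the edges leaving it, as counted by
    [indeg_cyclic]. *)
Lemma cyclic_weight t : (0 < height t)%N ->
  (leveling_weight (face (height t) t) +
   \sum_v wt v * merge_expo G (height t) t v < leveling_weight t)%N.
Proof.
move=> t0; set P := fun v => level t v == height t.
have Plt v : (level t v < height t)%N = ~~ P v by rewrite ltn_neqAle level_le andbT.
have lt_sum : (\sum_(v | P v) \sum_u mult G v u * wt u <
               \sum_(v | P v) \sum_u mult G v u * wt v)%N.
  have [v0 v0P] := level_onto (leqnn (height t)).
  have Pq v : P v -> v != q.
    by apply: contraTneq => ->; rewrite /P level_q eq_sym -lt0n.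
  have Pv0 : P v0 by rewrite /P v0P.
  rewrite (bigD1 v0) //= [X in (_ < X)%N](bigD1 v0) //= -addSn.
  apply: leq_add; first by apply: weight_superharmonic; apply: Pq.
  by apply: leq_sum => v /andP [Pv _]; apply/ltnW/weight_superharmonic/Pq.
have split_sum (F : V -> V -> nat) : (\sum_(v | P v) \sum_u F v u =
   \sum_(v | P v) \sum_(u | P u) F v u + \sum_(v | P v) \sum_(u | ~~ P u) F v u)%N.
  by rewrite -big_split; apply: eq_bigr => v _; rewrite (bigID P).
move: lt_sum; rewrite split_sum [X in (_ < X)%N]split_sum.
have -> : (\sum_(v | P v) \sum_(u | P u) mult G v u * wt u =
           \sum_(v | P v) \sum_(u | P u) mult G v u * wt v)%N.
  rewrite exchange_big; apply: eq_bigr => v _; apply: eq_bigr => u _.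
  by rewrite mult_sym.
rewrite ltn_add2l => lt_sum.
have : (leveling_weight (face (height t) t) + \sum_v wt v * merge_expo G (height t) t v +
   \sum_(v | P v) \sum_(u | ~~ P u) mult G v u * wt v =
   leveling_weight t + \sum_(v | P v) \sum_(u | ~~ P u) mult G v u * wt u)%N.
  have -> : (\sum_(v | P v) \sum_(u | ~~ P u) mult G v u * wt v =
     \sum_v wt v * \sum_u mult G v u * (P v && ~~ P u))%N.
    rewrite [LHS]big_mkcond; apply: eq_bigr => v _; rewrite big_distrr /=.
    case: (P v); last by rewrite big1 // => u _; rewrite !muln0.
    rewrite big_mkcond; apply: eq_bigr => u _ /=.
    by case: (~~ P u); rewrite ?muln1 ?muln0 // mulnC.
  have -> : (\sum_(v | P v) \sum_(u | ~~ P u) mult G v u * wt u =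
     \sum_v wt v * \sum_u mult G v u * (~~ P v && P u))%N.
    rewrite (exchange_big_dep (fun u => ~~ P u)) //= [LHS]big_mkcond.
    apply: eq_bigr => v _; rewrite big_distrr /=.
    case: (P v) => /=; first by rewrite big1 // => u _; rewrite !muln0.
    rewrite big_mkcond; apply: eq_bigr => u _ /=.
    by rewrite mult_sym; case: (P u); rewrite ?muln1 ?muln0 // mulnC.
  rewrite -!big_split; apply: eq_bigr => v _ /=; rewrite -!mulnDr; congr (_ * _)%N.
  have := indeg_cyclic G v t0; rewrite -/(P v).
  by under eq_bigr do rewrite Plt; under [X in _ = (_ + X)%N]eq_bigr do rewrite Plt.
lia.
Qed.

Lemma inner_weight j t : (j < height t)%N ->
  (leveling_weight (face j t) + \sum_v wt v * merge_expo G j t v)%N = leveling_weight t.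
Proof.
move=> jt; rewrite -big_split; apply: eq_bigr => v _ /=.
by rewrite -mulnDr indeg_inner.
Qed.

End Weights.

Section Exactness.
Variables (V : finType) (G : multigraph V) (q : V) (K : fieldType) (eps : bool).
Notation R := {mpoly K[#|V|]}.
Notation monom := 'X_{1..#|V|}.
Notation T := (leveling q).
Notation M := (flag_kernel G K eps).
Notation d := (apply_kernel M).
Notation vec := {ffun T -> R}.

(* A nonempty part of the first block that can be fired from m towards the rest
   of this block. *)
Definition legal (t : T) (m : monom) (P : {set V}) : bool :=
  [&& P != set0, q \notin P &
    [forall v in P, (level t v == 0%N) &&
      (\sum_(u | (level t u == 0%N) && (u \notin P)) mult G v u <= m (enum_rank v))%N]].

(** For the trivial leveling this says that m is reduced at q: no nonempty set avoiding q can be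
    fired without leaving a vertex in debt. *)
Definition standard t m := ~~ [exists P, legal t m P].

(* For every basis monomial x^m[t], the boundary of x^m[t] has leading term
   x^(lead_mnm t m)[face 0 t] with respect to the measure key; this is a
   bijection between standard monomials and nonstandard ones. *)
Definition lead_mnm (t : T) (m : monom) : monom := (m + merge_mnm G 0 t)%MM.

(** Inner merges preserve the total weight and the cyclic one lowers it. Ties are broken by the size
    of the first block, which among the inner merges only the merge at 0 enlarges; the factor
    [#|V|.+1] makes the comparison lexicographic. *)
Definition key (t : T) (m : monom) : nat :=
  ((\sum_v weight G q v * m (enum_rank v) + leveling_weight G t) * #|V|.+1 +
   #|[set v | level t v == 0%N]|)%N.

Lemma legal_sum t m P v : legal t m P -> v \in P ->
  level t v = 0%N /\
  (\sum_(u | (level t u == 0%N) && (u \notin P)) mult G v u <= m (enum_rank v))%N.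
Proof. by case/and3P=> _ _ /forall_inP/(_ v)/[apply]/andP[/eqP]. Qed.

Lemma faceF_first L x : (0 < L)%N -> (x <= L)%N -> faceF L 0 x = x.-1.
Proof. by rewrite /faceF; case: x => //=; case: eqP. Qed.

Lemma merge_expo_first (t : T) v : (0 < height t)%N ->
  merge_expo G 0 t v =
  if level t v == 1%N then (\sum_(u | level t u == 0%N) mult G v u)%N else 0%N.
Proof.
move=> t0; rewrite /merge_expo nxt_lt //.
case: eqP => _ /=; last by rewrite big1 // => u _; rewrite muln0.
rewrite [RHS]big_mkcond; apply: eq_bigr => u _.
by case: eqP; rewrite ?muln1 ?muln0.
Qed.

(** The vertices in block 0 of t and block 1 of t' form a legal set for t: their exponents in the
    common leading monomial come from m alone, and on the side of t' they include all edges to its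
    block 0. *)
Lemma lead_inj_half (t t' : T) m m' : (0 < height t)%N -> (0 < height t')%N ->
  standard t m -> face 0 t = face 0 t' -> lead_mnm t m = lead_mnm t' m' ->
  forall v, level t v = 0%N -> level t' v = 0%N.
Proof.
move=> t0 t'0 std ff mm.
have lvE v : (level t v).-1 = (level t' v).-1.
  have := congr1 (fun s => level s v) ff.
  by rewrite (faceP t0 (leq0n _)).1 (faceP t'0 (leq0n _)).1 !faceF_first // level_le.
pose Q := [set v | (level t v == 0%N) && (level t' v == 1%N)].
suff Q0 : Q = set0.
  move=> v v0; have := lvE v; rewrite v0; case vE : (level t' v) => [//|[|//]] _.
  by have := in_set0 v; rewrite -Q0 inE v0 vE.
apply/eqP; apply: contraNT std => Q0; apply/existsP; exists Q.
rewrite /legal Q0 inE level_q level_q /=; apply/forall_inP => v.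
rewrite inE => /andP [/eqP v0 /eqP v1]; rewrite v0 /=.
have := congr1 (fun m : monom => m (enum_rank v)) mm.
rewrite !mnmDE !mnm_of_rank !merge_expo_first // v0 v1 /= addn0 => ->.
apply: leq_trans (leq_addl _ _); rewrite [X in (X <= _)%N]big_mkcond /=.
rewrite [X in (_ <= X)%N]big_mkcond /=; apply: leq_sum => u _.
rewrite inE; have := lvE u; case: (level t u) => [|?] //=.
by case: (level t' u) => [|[]] //=.
Qed.

Lemma lead_inj (t t' : T) m m' : (0 < height t)%N -> (0 < height t')%N ->
  standard t m -> standard t' m' -> face 0 t = face 0 t' ->
  lead_mnm t m = lead_mnm t' m' -> t = t' /\ m = m'.
Proof.
move=> t0 t'0 std std' ff mm.
have lv := lead_inj_half t0 t'0 std ff mm.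
have lv' := lead_inj_half t'0 t0 std' (esym ff) (esym mm).
have tt' : t = t'.
  apply: level_inj => v; have := congr1 (fun s => level s v) ff.
  rewrite (faceP t0 (leq0n _)).1 (faceP t'0 (leq0n _)).1 !faceF_first ?level_le //.
  move: (lv v) (lv' v); case: (level t v) => [|n]; first by move=> ->.
  by case: (level t' v) => [_ ->|n' _ _ /= ->].
split=> //; move: mm; rewrite /lead_mnm tt'.
by move=> /(congr1 (fun x => x - merge_mnm G 0 t')%MM); rewrite !addmK.
Qed.

(** A legal set P is split off the first block. It has maximal cardinality, since a set Q legal for
    the quotient monomial would make the union of P and Q legal for n. *)
Lemma lead_surj s n : ~~ standard s n ->
  exists (t : T) m, [/\ (0 < height t)%N, standard t m, face 0 t = s & lead_mnm t m = n].
Proof.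
rewrite negbK => /existsP [P0 P0l].
case: (arg_maxnP (P := legal s n) (fun P => #|P|) P0l) => P Pl Pmax.
have /and3P [Pn0 Pq _] := Pl.
pose f v := if level s v == 0%N then (v \in P : nat) else (level s v).+1.
have [tf ht] : level (mk_leveling q f) =1 f /\ height (mk_leveling q f) = (height s).+1.
  apply: mk_levelingP; split=> [|v|i].
  - by rewrite /f level_q /= (negbTE Pq).
  - by rewrite /f; case: eqP => _; [case: (v \in P) | rewrite ltnS level_le].
  case: i => [_|[_|i]]; first by exists q; rewrite /f level_q /= (negbTE Pq).
    case/set0Pn: Pn0 => v vP; exists v; have [v0 _] := legal_sum Pl vP.
    by rewrite /f v0 vP.
  by rewrite ltnS => si; have [v vi] := level_onto si; exists v; rewrite /f vi.
set t := mk_leveling q f in tf ht; have t0 : (0 < height t)%N by rewrite ht.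
have t_0 u : (level t u == 0%N) = (level s u == 0%N) && (u \notin P).
  by rewrite tf /f; have [su|su] := eqVneq (level s u) 0%N; [case: (u \in P) | case: (level s u)].
have t_1 u : (level t u == 1%N) = (u \in P).
  rewrite tf /f; have [su|su] := eqVneq (level s u) 0%N; first by case: (u \in P).
  rewrite eqSS (negbTE su); apply/esym/negbTE/negP => uP.
  by have [us _] := legal_sum Pl uP; rewrite us in su.
have fE v : merge_expo G 0 t v =
   if v \in P then (\sum_(u | (level s u == 0%N) && (u \notin P)) mult G v u)%N else 0%N.
  by rewrite merge_expo_first // t_1; case: ifP => // _; apply: eq_bigl => u; rewrite t_0.
exists t, (n - merge_mnm G 0 t)%MM; split=> //.
- apply/negP => /existsP [Q Ql]; have /and3P [Qn0 Qq _] := Ql.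
  have QP v : v \in Q -> (level s v == 0%N) && (v \notin P).
    by move=> vQ; rewrite -t_0; have [-> _] := legal_sum Ql vQ.
  have : legal s n (P :|: Q).
    apply/and3P; split; first by apply: contraNneq Pn0 => PQ; rewrite -subset0 -PQ subsetUl.
      by rewrite inE negb_or Pq.
    apply/forall_inP => v; rewrite inE; have [vP _|vP /= vQ] := boolP (v \in P).
      have [-> /=] := legal_sum Pl vP; apply: leq_trans.
      rewrite big_mkcond [X in (_ <= X)%N]big_mkcond /=; apply: leq_sum => u _.
      by rewrite inE; case: (level s u == 0%N); case: (u \in P); case: (u \in Q).
    have /andP [-> _] := QP v vQ; have [_] := legal_sum Ql vQ.
    rewrite mnmBE mnm_of_rank fE (negbTE vP) subn0; apply: leq_trans; apply: eq_leq.
    by apply: eq_bigl => u; rewrite t_0 inE negb_or andbA.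
  move=> /Pmax; rewrite /geq /= leqNgt -[#|P|]addn0 => /negP; apply.
  rewrite cardsU (_ : P :&: Q = set0) ?cards0 ?subn0 ?ltn_add2l ?card_gt0 //.
  apply/setP => v; rewrite !inE; apply/negbTE/negP => /andP [vP /QP].
  by rewrite vP andbF.
- apply: level_inj => v; rewrite (faceP t0 (leq0n _)).1 faceF_first ?level_le // tf /f.
  by case: eqP => [->|//]; case: (v \in P).
- rewrite /lead_mnm submK //; apply/mnm_lepP => i.
  rewrite -(enum_valK i) mnm_of_rank fE; case: ifP => // iP.
  by have [_] := legal_sum Pl iP.
Qed.

Lemma key_face j (t : T) m : (0 < j <= height t)%N ->
  (key (face j t) (m + merge_mnm G j t)%MM < key (face 0 t) (lead_mnm t m))%N.
Proof.
move=> /andP [j0 jt]; have t0 : (0 < height t)%N by apply: leq_trans jt.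
have sumE i : (\sum_v weight G q v * (m + merge_mnm G i t)%MM (enum_rank v) =
  \sum_v weight G q v * m (enum_rank v) + \sum_v weight G q v * merge_expo G i t v)%N.
  by rewrite -big_split; apply: eq_bigr => v _; rewrite mnmDE mnm_of_rank mulnDr.
rewrite /key /lead_mnm !sumE.
have W0 := inner_weight G t0; move: jt; rewrite leq_eqVlt => /predU1P [jE|jt].
  have := cyclic_weight G t0; rewrite -jE => Wj.
  have : (#|[set v | level (face j t) v == 0%N]| <= #|V|)%N by apply: max_card.
  move: #|[set v | level (face j t) v == 0%N]| #|[set v | level (face 0 t) v == 0%N]|.
  by move=> x y; nia.
have Wj := inner_weight G jt.
have /proper_card : [set v | level (face j t) v == 0%N] \proper [set v | level (face 0 t) v == 0%N].
  have [f0 _] := faceP t0 (leq0n _); have [fj _] := faceP t0 (ltnW jt).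
  apply/properP; split; last first.
    have [v v1] := level_onto t0; exists v; rewrite inE ?f0 ?fj v1 ?faceF_first //.
    by rewrite /faceF; split_ifs; lia.
  apply/subsetP => v; rewrite !inE f0 fj faceF_first ?level_le // /faceF.
  by have := level_le t v; split_ifs; lia.
move: #|[set v | level (face j t) v == 0%N]| #|[set v | level (face 0 t) v == 0%N]|.
by move=> x y; nia.
Qed.

Definition vmon (t : T) (m : monom) : vec := ffscale 'X_[m] (ffbasis R t).

Lemma kernel_vmon t m : d (vmon t m) =
  \sum_(j < (height t).+1)
    if (0 < height t)%N then
      ffscale (face_coef K eps j t)%:MP (vmon (face j t) (m + merge_mnm G j t)%MM) else 0.
Proof.
apply/ffunP => s; rewrite apply_kernel_scale ffunE apply_kernel_basis sum_ffunE.
rewrite /flag_kernel mulr_sumr; apply: eq_bigr => j _.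
case: (0 < height t)%N => /=; last by rewrite mulr0 ffunE.
rewrite !ffunE; case: eqP => _; last by rewrite !mulr0.
by rewrite mulr1 mul_mpolyC mpolyXD scalerAr.
Qed.

Lemma mcoeff_shift (p : R) (e n : monom) : (p * 'X_[e])@_n != 0 ->
  exists2 m, m \in msupp p & n = (m + e)%MM.
Proof.
rewrite -mcoeff_msupp => /msuppM_le /allpairsP [[m e'] /= [mp]].
by rewrite msuppX inE => /eqP -> ->; exists m.
Qed.

Definition standard_vec (z : vec) := forall t m, m \in msupp (z t) -> standard t m.

(** Take a term of z in positive height whose leading term has the largest [key]. Nothing in [d z]
    cancels this leading term: other merges give smaller keys, and other standard terms have other
    leading terms by [lead_inj]. The induction descends from the bound [B]. *)
Lemma standard_cycle (z : vec) t : standard_vec z -> d z = 0 -> (0 < height t)%N -> z t = 0.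
Proof.
move=> stdz dz.
pose keyL t m := key (face 0 t) (lead_mnm t m).
pose B := (\max_(t : T) \max_(m <- msupp (z t)) keyL t m)%N.
have leB s n : n \in msupp (z s) -> (keyL s n <= B)%N.
  move=> ns; apply: (@leq_trans (\max_(m <- msupp (z s)) keyL s m)%N).
    exact: leq_bigmax_seq.
  exact: (leq_bigmax (F := fun t => (\max_(m <- msupp (z t)) keyL t m)%N)).
suff supp0 k s n : (B - keyL s n < k)%N -> (0 < height s)%N -> n \notin msupp (z s).
  move=> t0; apply/msuppnil0; case zE : (msupp (z t)) => [//|m r].
  by have := supp0 _ t m (ltnSn _) t0; rewrite zE mem_head.
elim: k s n => // k IHk s n kB s0; apply/negP => ns.
have keyB := leB s n ns.
have := congr1 (fun y : vec => (y (face 0 s))@_(lead_mnm s n)) dz.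
rewrite /= [in RHS]ffunE mcoeff0 ffunE raddf_sum (bigD1 s) //=.
rewrite /flag_kernel mulr_sumr raddf_sum big_ord_recl /= s0 eqxx /=.
rewrite -scalerAr linearZ /=.
have -> : (z s * 'X_[merge_mnm G 0 s])@_(lead_mnm s n) = (z s)@_n.
  by rewrite /lead_mnm addmC mcoeffMX.
have -> : face_coef K eps 0 s = 1 by rewrite /face_coef expr0 mul1r ltn_eqF.
rewrite mul1r big1 => [|j _]; last first.
  have jP : (0 < lift ord0 j <= height s)%N by rewrite lift0 /= ltn_ord.
  case: ifP => [/eqP sj|_]; last by rewrite mulr0 raddf0.
  rewrite -scalerAr linearZ /=; apply/eqP; rewrite mulf_eq0; apply/orP; right.
  apply/negPn/negP => /mcoeff_shift [m ms nm].
  have := key_face m jP; rewrite -sj -nm -/(keyL s n) -/(keyL s m) => lt_key.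
  by have := IHk s m _ s0; rewrite ms => /(_ _)/implyP; have := leB s m ms; lia.
rewrite addr0 big1 => [|t' t's]; first by rewrite addr0 => /eqP; rewrite mcoeff_eq0 ns.
rewrite mulr_sumr raddf_sum big1 // => j _ /=.
case: ifP => [/andP [t'0 /eqP st']|_]; last by rewrite mulr0 raddf0.
rewrite -scalerAr linearZ /=; apply/eqP; rewrite mulf_eq0; apply/orP; right.
apply/negPn/negP => /mcoeff_shift [m mt' nm].
have [j0|j0] := posnP j.
  rewrite j0 in st' nm; case/eqP: t's.
  by have [] := lead_inj s0 t'0 (stdz _ _ ns) (stdz _ _ mt') st' nm.
have jP : (0 < j <= height t')%N by rewrite j0 -ltnS /=.
have := key_face m jP; rewrite -st' -nm -/(keyL s n) -/(keyL t' m) => lt_key.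
have := IHk t' m _ t'0; rewrite mt' => /(_ _)/implyP; have := leB t' m mt'; lia.
Qed.

Definition reducible_vec (z : vec) := exists w, standard_vec (z - d w).

Lemma reducible0 : reducible_vec 0.
Proof.
exists 0; rewrite apply_kernel0 subr0 => t m.
by rewrite ffunE msupp0.
Qed.

Lemma reducibleD z z' : reducible_vec z -> reducible_vec z' -> reducible_vec (z + z').
Proof.
move=> [w ws] [w' ws']; exists (w + w').
rewrite apply_kernelD opprD addrACA => t m; rewrite ffunE => /msuppD_le.
by rewrite mem_cat => /orP [/ws|/ws'].
Qed.

Lemma reducible_scale (c : K) z : reducible_vec z -> reducible_vec (ffscale c%:MP z).
Proof.
move=> [w ws]; exists (ffscale c%:MP w) => t m; rewrite apply_kernel_scale !ffunE.
rewrite -mulrBr mul_mpolyC => /msuppZ_le; have := @ws t m; by rewrite !ffunE.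
Qed.

Lemma reducible_sum (J : Type) (r : seq J) (P : pred J) (F : J -> vec) :
  (forall i, P i -> reducible_vec (F i)) -> reducible_vec (\sum_(i <- r | P i) F i).
Proof.
move=> rF; elim/big_rec: _ => [|i y Pi ry]; first exact: reducible0.
by apply: reducibleD => //; apply: rF.
Qed.

(** Normal forms modulo boundaries: a nonstandard basis monomial is the leading term of a boundary
    whose other terms have smaller [key]. *)
Lemma reducible_vmon s n : reducible_vec (vmon s n).
Proof.
move: {2}(key s n) (leqnn (key s n)) => k; elim: k s n => [|k IHk] s n.
all: have [std _|/lead_surj [t [m [t0 _ <- <-]]]] := boolP (standard s n).
1,3: exists 0; rewrite apply_kernel0 subr0 => t m; rewrite !ffunE;
  case: eqP => [->|_]; rewrite ?mulr0 ?msupp0 // mulr1 msuppX inE => /eqP -> //.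
all: move=> keyk.
  have jP : (0 < height t <= height t)%N by rewrite t0 leqnn.
  by have := leq_trans (key_face m jP) keyk; rewrite ltn0.
have -> : vmon (face 0 t) (lead_mnm t m) = d (vmon t m) +
   (vmon (face 0 t) (lead_mnm t m) - d (vmon t m)) by rewrite addrC subrK.
apply: reducibleD.
  by exists (vmon t m); rewrite subrr => s' n'; rewrite ffunE msupp0.
rewrite kernel_vmon big_ord_recl t0 /=.
have -> : face_coef K eps 0 t = 1 by rewrite /face_coef expr0 mul1r ltn_eqF.
have -> : ffscale 1%:MP (vmon (face 0 t) (m + merge_mnm G 0 t)) =
  vmon (face 0 t) (lead_mnm t m) by apply/ffunP => r; rewrite !ffunE mul1r.
rewrite opprD addNKr -sumrN; apply: reducible_sum => j _.
have -> : - ffscale (face_coef K eps (lift ord0 j) t)%:MP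
   (vmon (face (lift ord0 j) t) (m + merge_mnm G (lift ord0 j) t)) =
  ffscale (- face_coef K eps (lift ord0 j) t)%:MP
   (vmon (face (lift ord0 j) t) (m + merge_mnm G (lift ord0 j) t)).
  by apply/ffunP => r; rewrite !ffunE raddfN mulNr.
apply/reducible_scale/IHk; rewrite -ltnS; apply: leq_trans keyk.
by apply: key_face; rewrite lift0 /= ltn_ord.
Qed.

Lemma reducible_all z : reducible_vec z.
Proof.
rewrite (sum_basis z); apply: reducible_sum => t _.
have -> : ffscale (z t) (ffbasis R t) =
  \sum_(m <- msupp (z t)) ffscale ((z t)@_m)%:MP (vmon t m).
  apply/ffunP => s; rewrite sum_ffunE [in LHS]ffunE {1}[z t]mpolyE mulr_suml.
  by apply: eq_bigr => m _; rewrite !ffunE mulrA mul_mpolyC.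
by apply: reducible_sum => m _; apply/reducible_scale/reducible_vmon.
Qed.

(** Modulo boundaries a cycle becomes standard, and [standard_cycle] removes it in positive height.
    The coordinate left at the trivial leveling is a standard element of [I], so it vanishes by
    hypothesis. *)
Lemma flag_kernel_exact (I : R -> Prop) : is_ideal I ->
  (forall t, I (M t (trivial_leveling q))) ->
  (forall p, I p -> (forall m, m \in msupp p -> standard (trivial_leveling q) m) -> p = 0) ->
  (forall z, I (d z (trivial_leveling q))) /\
  forall z, d z = 0 -> I (z (trivial_leveling q)) -> exists w, z = d w.
Proof.
move=> idI IM Istd; have [I0 ID IS] := idI.
have Id z : I (d z (trivial_leveling q)).
  by rewrite ffunE; apply: ideal_sum => // t _; apply: IS.
split=> // z dz Iz; have [w ws] := reducible_all z; exists w.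
apply/eqP; rewrite -subr_eq0; apply/eqP/ffunP => t; rewrite [RHS]ffunE.
have [|t0] := posnP (height t); last first.
  apply: standard_cycle => //.
  by rewrite apply_kernelD apply_kernelN flag_kernel_square subr0.
move/eqP; rewrite height0P => /eqP ->; apply: Istd; last exact: ws.
rewrite !ffunE; apply: ID => //; rewrite -mulN1r; apply: (IS).
by have := Id w; rewrite ffunE.
Qed.

End Exactness.

(** * The matching *)

Section Orientations.
Variables (V : finType) (G : multigraph V) (q : V).
Notation T := (leveling q).

Definition orientation (t : T) : {set V * V} :=
  [set e | adj G e.1 e.2 && (level t e.1 < level t e.2)%N].

Definition unoriented (O : {set V * V}) : rel V :=
  fun a b => [&& adj G a b, (a, b) \notin O & (b, a) \notin O].

Definition upward (O : {set V * V}) : rel V :=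
  fun a b => adj G a b && ((b, a) \notin O).

Lemma adj_sym : ssrbool.symmetric (adj G).
Proof. by move=> u v; rewrite /adj mult_sym. Qed.

Lemma unoriented_connect_sym O : connect_sym (unoriented O).
Proof.
apply: sym_connect_sym => u v.
by rewrite /unoriented adj_sym; case: (adj G v u) => //=; rewrite andbC.
Qed.

Lemma unoriented_level t u v : unoriented (orientation t) u v =
  adj G u v && (level t u == level t v).
Proof.
rewrite /unoriented !inE /= [adj G v u]adj_sym; case: (adj G u v) => //=.
by case: ltngtP.
Qed.

Lemma upward_level t u v : upward (orientation t) u v = adj G u v && (level t u <= level t v)%N.
Proof.
rewrite /upward !inE /= [adj G v u]adj_sym; case: (adj G u v) => //=.
by rewrite -leqNgt.
Qed.

Lemma connect_unoriented_level t u v :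
  connect (unoriented (orientation t)) u v -> level t u = level t v.
Proof.
case/connectP => p; elim: p u => [|w p IHp] u /=; first by move=> _ ->.
by rewrite unoriented_level => /andP [/andP [_ /eqP ->] /IHp /[apply]].
Qed.

Lemma connect_unoriented_upward O u v :
  connect (unoriented O) u v -> connect (upward O) u v.
Proof.
apply: connect_sub => a b /and3P [ab _ ba]; apply: connect1.
by rewrite /upward ab ba.
Qed.

Lemma level_le_of_mono (t t' : T) :
  (forall u v, (level t u < level t v)%N -> (level t' u < level t' v)%N) ->
  forall v, (level t v <= level t' v)%N.
Proof.
move=> mono v; move: {2}(level t v) (erefl (level t v)) => n.
elim: n v => [|n IHn] v vn; first by rewrite vn.
have [u un] : exists u, level t u = n by apply: level_onto; rewrite ltnW // -vn level_le.
rewrite vn; apply: leq_ltn_trans (mono u v _); last by rewrite un vn.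
by rewrite -un; apply: IHn.
Qed.

Lemma leveling_order_eq (t t' : T) :
  (forall u v, (level t u < level t v)%N -> (level t' u < level t' v)%N) ->
  (forall u v, level t u = level t v -> level t' u = level t' v) -> t = t'.
Proof.
move=> mono eqv; apply: level_inj => v; apply/eqP; rewrite eqn_leq.
rewrite !level_le_of_mono // => a b; case: (ltngtP (level t a) (level t b)) => //.
  by move=> /mono /ltnW; rewrite leqNgt => /negbTE ->.
by move=> /eqv ->; rewrite ltnn.
Qed.

Lemma height_le_of_fibers (t s : T) :
  (forall u v, (level t u == level t v) = (level s u == level s v)) ->
  (height t <= height s)%N.
Proof.
move=> fib.
have /fin_all_exists [f fP] : forall i : 'I_(height t).+1, exists v, level t v = i.
  by move=> i; apply: level_onto; rewrite -ltnS.
have lt_s v : (level s v < (height s).+1)%N by rewrite ltnS level_le.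
pose g i := Ordinal (lt_s (f i)).
have g_inj : injective g.
  move=> i j /(congr1 val) /= /eqP; rewrite -fib !fP => /eqP; exact: val_inj.
by have := leq_card g g_inj; rewrite !card_ord.
Qed.

Lemma height_of_fibers (t s : T) :
  (forall u v, (level t u == level t v) = (level s u == level s v)) ->
  height t = height s.
Proof.
by move=> fib; apply/eqP; rewrite eqn_leq !height_le_of_fibers.
Qed.

(* A labelling of the connected parts of a partial acyclic orientation that
   increases along oriented edges; the parts above q get the largest labels, so
   that every source other than the part of q is labelled before it. *)
Definition good_labelling (O : {set V * V}) (l : V -> nat) : Prop :=
  [/\ forall u v, (u, v) \in O -> (l u < l v)%N,
      forall u v, unoriented O u v -> l u = l v,
      forall u v, l u = l v -> connect (unoriented O) u v
    & forall u, (l q <= l u)%N -> connect (upward O) q u].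

(** Lexicographic order of (k, r), coded in base [#|V|]. [k] lifts everything above q beyond all
    other levels, and [r] numbers the parts, so that equal labels occur only within one part. *)
Lemma good_labelling_exists t : exists l, good_labelling (orientation t) l.
Proof.
set O := orientation t.
pose above v := connect (upward O) q v.
pose k v := (if above v then level t v + (height t).+1 else level t v)%N.
pose r v := nat_of_ord (enum_rank (fingraph.root (unoriented O) v)).
have rV v : (r v < #|V|)%N by apply: ltn_ord.
have above_up u v : upward O u v -> above u -> above v.
  by move=> uv qu; apply: connect_trans qu (connect1 uv).
exists (fun v => k v * #|V| + r v)%N; split.
- move=> u v uvO.
  have kuv : (k u < k v)%N.
    have : (level t u < level t v)%N by move: uvO; rewrite inE => /andP [].
    have : above u -> above v.
      apply: above_up; rewrite upward_level.
      by move: uvO; rewrite inE /= => /andP [-> /ltnW].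
    rewrite /k; case: (above u) => [/(_ isT) ->|_]; first by rewrite ltn_add2r.
    by case: (above v) => // uv; rewrite ltn_addr.
  by have := rV u; have := rV v; nia.
- move=> u v uv; congr (_ * _ + _)%N.
    have ruv : above u = above v.
      apply/idP/idP; apply: above_up; move: uv; rewrite unoriented_level upward_level.
        by case/andP => -> /eqP -> /=.
      by rewrite adj_sym => /andP [-> /eqP ->] /=.
    by rewrite /k ruv; move: uv; rewrite unoriented_level => /andP [_ /eqP ->].
  rewrite /r; congr (nat_of_ord (enum_rank _)).
  by apply/fingraph.rootP; [apply: unoriented_connect_sym | apply: connect1].
- move=> u v uv; have ruv : r u = r v.
    by have := congr1 (modn^~ #|V|) uv; rewrite !modnMDl !modn_small.
  apply/fingraph.rootP; first exact: unoriented_connect_sym.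
  exact/enum_rank_inj/val_inj.
- move=> u qu; apply: contraLR qu => nu; rewrite -ltnNge.
  rewrite /k /above connect0 (negbTE nu) level_q add0n.
  by have := level_le t u; have := rV u; have := rV q; nia.
Qed.

End Orientations.

(** * Words of parts and the matching at the first descent *)

Section Matching.
Variables (V : finType) (G : multigraph V) (q : V).
Notation T := (leveling q).
Notation orient := (@orientation V G q).

Variable rep : pred T.
Hypothesis rep_good : forall t, rep t -> good_labelling G q (orient t) (level t).
Hypothesis rep_ex : forall t, good_labelling G q (orient t) (level t) ->
  exists2 t', rep t' & orient t' = orient t.
Hypothesis rep_uniq : forall t t', rep t -> rep t' -> orient t = orient t' -> t = t'.

Definition labelling_spec O l :=
  good_labelling G q O l /\ forall t, rep t -> orient t = O -> level t =1 l.

Lemma labelling_exists t : exists l, labelling_spec (orient t) l.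
Proof.
case: (EM (exists2 t', rep t' & orient t' = orient t)) => [[t' rt' tt']|no_rep].
  exists (level t'); split; first by rewrite -tt'; apply: rep_good.
  by move=> s rs st; rewrite (rep_uniq rs rt') // st tt'.
have [l lP] := good_labelling_exists G t; exists l; split=> // s rs st.
by case: no_rep; exists s.
Qed.

(** Chosen through [orient t] alone, so that levelings with one orientation share the same labels.
    The default is never reached, by [labelling_exists]. *)
Definition labelling (t : T) : V -> nat := 
  if pselect (exists l, labelling_spec (orient t) l) is left e then projT1 (cid e)
  else fun=> 0%N.

Lemma labellingP t : labelling_spec (orient t) (labelling t).
Proof.
rewrite /labelling; case: pselect => [e|[]]; last exact: labelling_exists.
exact: projT2 (cid e).
Qed.

Lemma labelling_eq t s : orient t = orient s -> labelling t = labelling s.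
Proof. by rewrite /labelling => ->. Qed.

Notation lam := labelling.

Lemma lam_lt t u v : adj G u v -> (level t u < level t v)%N -> (lam t u < lam t v)%N.
Proof.
by move=> uv tuv; have [[lt _ _ _] _] := labellingP t; apply: lt; rewrite inE /= uv.
Qed.

Lemma lam_adj t u v : adj G u v -> level t u = level t v -> lam t u = lam t v.
Proof.
move=> uv tuv; have [[_ eqv _ _] _] := labellingP t; apply: eqv.
by rewrite unoriented_level uv tuv eqxx.
Qed.

Lemma lam_connect t u v : lam t u = lam t v -> connect (unoriented G (orient t)) u v.
Proof. by have [[_ _ con _] _] := labellingP t; apply: con. Qed.

Lemma lam_level t u v : lam t u = lam t v -> level t u = level t v.
Proof. by move=> /lam_connect; apply: connect_unoriented_level. Qed.

Lemma lam_connected t u v : connect (unoriented G (orient t)) u v -> lam t u = lam t v.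
Proof.
case/connectP => p; elim: p u => [|w p IHp] u /=; first by move=> _ ->.
rewrite unoriented_level => /andP [/andP [uw /eqP tuw] /IHp /[apply] <-].
exact: lam_adj.
Qed.

Lemma lam_above_q t u : (lam t q <= lam t u)%N -> connect (upward G (orient t)) q u.
Proof. by have [[_ _ _ ab] _] := labellingP t; apply: ab. Qed.

(** A vertex labelled above q is reached from q along a path of nondecreasing levels. If it ends in
    the first block, the path is unoriented and its labels are constant. *)
Lemma lam_first_block t u : level t u = 0%N -> (lam t u <= lam t q)%N.
Proof.
move=> u0; case: ltnP => // qu; have /connectP [p qp up] := lam_above_q (ltnW qu).
have up_path p' w : path (upward G (orient t)) w p' -> (level t w <= level t (last w p'))%N.
  elim: p' w => //= a p' IHp w; rewrite upward_level => /andP [/andP [_ wa] /IHp].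
  exact: leq_trans.
have flat p' v : level t v = 0%N -> path (upward G (orient t)) v p' ->
    level t (last v p') = 0%N -> lam t v = lam t (last v p').
  elim: p' v => [|w p' IHp] v v0 //= /andP [+ wp] l0.
  have w0 : level t w = 0%N by apply/eqP; rewrite -leqn0 -l0 up_path.
  rewrite upward_level => /andP [vw _]; rewrite -(IHp w) //.
  by apply: lam_adj; rewrite // v0 w0.
by move: qu; rewrite (flat p q) -?up ?level_q // ltnn.
Qed.

(* Writing each block in decreasing order of labels turns t into a word of parts.
   Its first descent determines the matching: a bar at this descent is removed
   (src) and a missing one is inserted (tgt). Words without descents are
   critical. *)
Definition single (t : T) i :=
  [forall u, forall v, (level t u == i) && (level t v == i) ==> (lam t u == lam t v)].

Definition descent (t : T) i :=
  (i < height t)%N && [forall u, forall v,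
     (level t u == i) && (level t v == i.+1) ==> (lam t v < lam t u)%N].

Definition regular t i := single t i && ~~ descent t i.

(** The block in which the first descent of the word is met: at its end if the block is a single
    part, inside it otherwise. Without descents [find] returns [(height t).+1], hence the bounds in
    [src] and [tgt]. *)
Definition first_irregular t := find (fun i => ~~ regular t i) (iota 0 (height t).+1).

Definition src t := (first_irregular t <= height t)%N && single t (first_irregular t).
Definition tgt t := (first_irregular t <= height t)%N && ~~ single t (first_irregular t).
Definition mu t := face (first_irregular t) t.

Lemma singleP t i : reflect
  (forall u v, level t u = i -> level t v = i -> lam t u = lam t v) (single t i).
Proof.
apply: (iffP forallP) => [H u v ui vi|H u].
  by have /forallP/(_ v) := H u; rewrite ui vi eqxx => /eqP.
by apply/forallP => v; apply/implyP => /andP [/eqP ui /eqP vi]; rewrite (H u v).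
Qed.

Lemma descentP t i : (i < height t)%N -> reflect
  (forall u v, level t u = i -> level t v = i.+1 -> (lam t v < lam t u)%N) (descent t i).
Proof.
move=> it; rewrite /descent it; apply: (iffP forallP) => [H u v ui vi|H u].
  by have /forallP/(_ v) := H u; rewrite ui vi !eqxx.
by apply/forallP => v; apply/implyP => /andP [/eqP ui /eqP vi]; apply: H.
Qed.

Lemma not_descentP t i : (i < height t)%N -> reflect
  (exists u v, [/\ level t u = i, level t v = i.+1 & (lam t u <= lam t v)%N])
  (~~ descent t i).
Proof.
move=> it; apply: (iffP idP) => [nd|[u [v [ui vi uv]]]]; last first.
  by apply/negP => /(descentP it)/(_ u v ui vi); rewrite ltnNge uv.
apply/not_existsP => H; case/negP: nd; apply/descentP => // u v ui vi.
rewrite ltnNge; apply/negP => uv; apply: (H u); by exists v.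
Qed.

Lemma first_irregularP t : (first_irregular t <= height t)%N ->
  ~~ regular t (first_irregular t).
Proof.
move=> ft; have hasi : has (fun i => ~~ regular t i) (iota 0 (height t).+1).
  by rewrite has_find size_iota.
by have := nth_find 0%N hasi; rewrite nth_iota ?add0n.
Qed.

Lemma first_irregular_eq t i : (i <= height t)%N -> ~~ regular t i ->
  (forall k, (k < i)%N -> regular t k) -> first_irregular t = i.
Proof.
move=> it ni reg; apply/eqP; rewrite eqn_leq; apply/andP; split; rewrite leqNgt; apply/negP.
  by move=> /(before_find 0%N); rewrite nth_iota // add0n ni.
move=> lti; have := first_irregularP (leq_trans (ltnW lti) it).
by rewrite reg.
Qed.

Lemma before_first t k : (k < first_irregular t)%N -> (k <= height t)%N -> regular t k.
Proof.
by move=> /(before_find 0%N) + kt; rewrite nth_iota ?add0n // => /negbT; rewrite negbK.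
Qed.

Lemma srcP t : src t -> [/\ (first_irregular t < height t)%N,
  forall u v, level t u = first_irregular t -> level t v = first_irregular t ->
    lam t u = lam t v,
  forall u v, level t u = first_irregular t -> level t v = (first_irregular t).+1 ->
    (lam t v < lam t u)%N
  & forall k, (k < first_irregular t)%N -> regular t k].
Proof.
move=> /andP [ft st]; have := first_irregularP ft; rewrite /regular st negbK => dt.
have fh : (first_irregular t < height t)%N by case/andP: dt.
split=> //; [exact/singleP | exact/descentP|] => k kf.
by apply: before_first => //; apply: ltnW; apply: ltn_trans kf fh.
Qed.

Lemma faceF_lt L i x k : (i < L)%N -> (x <= L)%N -> (k < i)%N ->
  (faceF L i x == k) = (x == k).
Proof. by rewrite /faceF => *; split_ifs; lia. Qed.

Lemma faceF_le L i x k : (i < L)%N -> (k <= i)%N -> x = k -> faceF L i x = k.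
Proof. by rewrite /faceF => *; split_ifs; lia. Qed.

Lemma orientation_face j t : (j < height t)%N -> (forall v, merge_expo G j t v = 0%N) ->
  orient (face j t) = orient t.
Proof.
move=> jt e0; apply/setP => -[u v]; rewrite !inE /=.
by case uv: (adj G u v) => //=; rewrite (merge_expo0_level (G := G)).
Qed.

(** Labels increase along edges from one block to the next, so a descent leaves no such edge and the
    merge has a unit coefficient. *)
Lemma descent_merge_expo t j : (j < height t)%N ->
  (forall u v, level t u = j -> level t v = j.+1 -> (lam t v < lam t u)%N) ->
  forall v, merge_expo G j t v = 0%N.
Proof.
move=> jt d v; apply/eqP; rewrite sum_nat_eq0; apply/forallP => u /=.
rewrite nxt_lt //.
have [vj|_] := eqVneq (level t v) j.+1; last by rewrite muln0.
have [uj|_] := eqVneq (level t u) j; last by rewrite muln0.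
rewrite muln1 eqn0Ngt -/(adj G v u) adj_sym; apply/negP => uv.
by have := @lam_lt t u v uv; rewrite uj vj => /(_ (ltnSn _)); have := d u v uj vj; lia.
Qed.

Lemma regular_face t j k : (j < height t)%N -> orient (face j t) = orient t ->
  (k < j)%N -> regular t k -> regular (face j t) k.
Proof.
move=> jt oj kj /andP [/singleP st dt].
have [fj hj] : _ /\ _ := @faceP V q j t ltac:(lia) ltac:(lia).
have lamE : lam (face j t) = lam t by apply: labelling_eq.
apply/andP; split.
  apply/singleP => u v; rewrite !fj lamE => /eqP + /eqP.
  by rewrite !faceF_lt ?level_le // => /eqP uk /eqP vk; apply: st.
have kt : (k < height t)%N by lia.
have [u [v [uk vk uv]]] := not_descentP kt dt.
apply/not_descentP; first by rewrite hj; lia.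
exists u, v; rewrite !fj lamE; split=> //; apply: faceF_le => //; exact: ltnW.
Qed.

Lemma mu_spec t : src t -> [/\ orient (mu t) = orient t, tgt (mu t),
  first_irregular (mu t) = first_irregular t, height t = (height (mu t)).+1
  & forall v, merge_expo G (first_irregular t) t v = 0%N].
Proof.
move=> st; have [it sgl dsc reg] := srcP st; set i := first_irregular t in it sgl dsc reg *.
have e0 := descent_merge_expo it dsc.
have ot : orient (mu t) = orient t by apply: orientation_face.
have [fi hi] : _ /\ _ := @faceP V q i t ltac:(lia) ltac:(lia).
have lamE : lam (mu t) = lam t by apply: labelling_eq.
have ns : ~~ single (mu t) i.
  have [u ui] := level_onto (ltnW it); have [v vi] := level_onto it.
  apply/negP => /singleP/(_ u v); rewrite !fi ui vi lamE /faceF leqnn ltnn ltn_eqF //=.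
  by move=> /(_ erefl erefl); have := dsc u v ui vi; lia.
have fE : first_irregular (mu t) = i.
  apply: first_irregular_eq; first by rewrite hi; lia.
    by rewrite /regular (negbTE ns).
  by move=> k ki; apply: regular_face => //; apply: reg.
split=> //; last by rewrite hi; lia.
by rewrite /tgt fE ns andbT hi; lia.
Qed.

(** Inverse of [mu]: the part of largest label stays at level i and the rest of its block moves up,
    which inserts a bar after the first letter of the block. *)
Definition split_level (s : T) (v : V) : nat :=
  let i := first_irregular s in
  if (level s v < i)%N then level s v else
  if level s v == i then (if [forall u, (level s u == i) ==> (lam s u <= lam s v)%N] then i else i.+1)
  else (level s v).+1.

Lemma src_split t v : src t -> level t v = split_level (mu t) v.
Proof.
move=> st; have [it sgl dsc reg] := srcP st; have [ot _ fE ht e0] := mu_spec st.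
have [fi hi] : _ /\ _ := @faceP V q (first_irregular t) t ltac:(lia) ltac:(lia).
rewrite /split_level fE (labelling_eq ot); set i := first_irregular t in it sgl dsc reg fi hi *.
have lt_v := level_le t v.
have block u : level (mu t) u = i -> level t u = i \/ level t u = i.+1.
  by rewrite fi; have := level_le t u; rewrite /faceF; split_ifs; lia.
have -> : (level (mu t) v < i)%N = (level t v < i)%N.
  by rewrite fi /faceF; split_ifs; lia.
case: ltnP => iv; first by rewrite fi /faceF; split_ifs; lia.
have -> : (level (mu t) v == i) = (level t v == i) || (level t v == i.+1).
  by rewrite fi /faceF; split_ifs; lia.
have [vi|vi] /= := eqVneq (level t v) i.
  case: ifP => // /negbT; rewrite negb_forall => /existsP [u].
  rewrite negb_imply => /andP [/eqP /block [ui|ui]]; first by rewrite (sgl u v) ?leqnn.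
  by have := dsc v u vi ui; lia.
have [vi1|vi1] /= := eqVneq (level t v) i.+1.
  case: ifP => // /forallP; have [u ui] := level_onto (ltnW it).
  have mi : level (mu t) u = i by rewrite fi ui /faceF; split_ifs; lia.
  by move=> /(_ u); rewrite mi eqxx /=; have := dsc u v ui vi1; lia.
by rewrite fi /faceF; split_ifs; lia.
Qed.

Lemma mu_tgt t : src t -> tgt (mu t).
Proof. by case/mu_spec. Qed.

Lemma mu_inj : {in src &, injective mu}.
Proof.
by move=> t t' st st' mm; apply: level_inj => v; rewrite !src_split // mm.
Qed.

Lemma mu_surj s : tgt s -> exists2 t, src t & mu t = s.
Proof.
case/andP; set i := first_irregular s => is_ ns.
have reg k : (k < i)%N -> regular s k.
  by move=> ki; apply: before_first => //; apply: leq_trans (ltnW ki) is_.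
pose top v := [forall u, (level s u == i) ==> (lam s u <= lam s v)%N].
have topP v u : top v -> level s u = i -> (lam s u <= lam s v)%N.
  by move=> /forallP/(_ u) + ui; rewrite ui eqxx.
have fE v : split_level s v = if (level s v < i)%N then level s v else
   if level s v == i then (if top v then i else i.+1) else (level s v).+1 by [].
have [m mi topm] : exists2 m, level s m = i & top m.
  have [v0 /eqP v0i] := level_onto is_.
  case: (arg_maxnP (P := fun v => level s v == i) (lam s) v0i) => m /eqP mi mmax.
  by exists m => //; apply/forallP => u; apply/implyP => /mmax.
have [w wi ntopw] : exists2 w, level s w = i & ~~ top w.
  move: ns; rewrite /single negb_forall => /existsP [u].
  rewrite negb_forall => /existsP [v]; rewrite negb_imply => /andP [/andP [/eqP ui /eqP vi] uv].
  have [tu|] := boolP (top u); last by exists u.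
  exists v => //; apply/negP => tv; case/negP: uv.
  by rewrite eqn_leq (topP v u) // (topP u v).
have [tf ht] : level (mk_leveling q (split_level s)) =1 split_level s /\
   height (mk_leveling q (split_level s)) = (height s).+1.
  apply: mk_levelingP; split=> [|v|k].
  (* If the first block is split, q must stay at level 0: its part has the largest label there. *)
  - rewrite fE level_q; case: ltnP => //; rewrite leqn0 => /eqP i0.
    suff -> : top q by rewrite i0.
    by apply/forallP => u; rewrite i0; apply/implyP => /eqP; apply: lam_first_block.
  - by have := level_le s v; rewrite fE; split_ifs; lia.
  have [ki|ki|->] := ltngtP k i; last by move=> _; exists m; rewrite fE mi ltnn eqxx topm.
    move=> _; have [v vk] : exists v, level s v = k.
      by apply: level_onto; apply: leq_trans (ltnW ki) is_.
    by exists v; rewrite fE vk ki.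
  have [->|ki1] := eqVneq k i.+1.
    by move=> _; exists w; rewrite fE wi ltnn eqxx (negbTE ntopw).
  move=> ks; have [v vk] : exists v, level s v = k.-1 by apply: level_onto; lia.
  by exists v; rewrite fE vk; split_ifs; lia.
set t := mk_leveling q (split_level s) in tf ht.
have it : (i < height t)%N by rewrite ht ltnS.
(* Adjacent vertices of one block have equal labels, so the split separates no edge. *)
have ot : orient t = orient s.
  apply/setP => -[u v]; rewrite !inE /=; case uv: (adj G u v) => //=.
  rewrite !tf !fE.
  have : level s u = i -> level s v = i -> top u = top v.
    by move=> ui vi; rewrite /top (lam_adj (t := s) uv) // ui.
  by case: (top u) (top v) => -[]; split_ifs; lia.
have lamE : lam t = lam s by apply: labelling_eq.
have ti u : level t u = i -> level s u = i /\ top u.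
  by rewrite tf fE; case: (top u); split_ifs; lia.
have ti1 u : level t u = i.+1 -> level s u = i /\ ~~ top u.
  by rewrite tf fE; case: (top u); split_ifs; lia.
have sti : single t i.
  apply/singleP => u v /ti [ui tu] /ti [vi tv]; rewrite lamE.
  by apply/eqP; rewrite eqn_leq (topP v u) // (topP u v).
have dti : descent t i.
  apply/descentP => // u v /ti [ui tu] /ti1 [vi]; rewrite lamE.
  rewrite /top negb_forall => /existsP [x]; rewrite negb_imply -ltnNge => /andP [/eqP xi vx].
  by apply: leq_trans vx _; apply: topP.
have fT : first_irregular t = i.
  apply: first_irregular_eq; first exact: ltnW.
    by rewrite /regular dti andbF.
  move=> k ki; have /andP [/singleP sk dk] := reg k ki.
  have tk u : level t u = k -> level s u = k.
    by rewrite tf fE; case: (top u); split_ifs; lia.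
  apply/andP; split; first by apply/singleP => u v /tk uk /tk vk; rewrite lamE; apply: sk.
  have ks : (k < height s)%N by apply: leq_trans ki is_.
  have [u [v [uk vk uv]]] := not_descentP ks dk.
  have uT : level t u = k by rewrite tf fE uk ki.
  apply/not_descentP; first exact: ltn_trans ki it.
  have [ki1|ki1] := ltnP k.+1 i.
    by exists u, v; rewrite lamE uT tf fE vk ki1.
  (* The witness v of the non-descent may have moved up; the vertex m of largest label stays in
     block i and serves as well. *)
  have {ki1}ki1 : k.+1 = i by apply/eqP; rewrite eqn_leq ki1 ki.
  exists u, m; rewrite lamE uT tf fE mi ltnn eqxx topm ki1; split=> //.
  by apply: leq_trans uv _; apply: topP => //; rewrite vk.
exists t; first by rewrite /src fT (ltnW it).
have [fi hi] : _ /\ _ := @faceP V q i t ltac:(lia) ltac:(lia).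
rewrite /mu fT; apply: level_inj => v; rewrite fi ht tf fE /faceF.
by have := level_le s v; case: (top v); split_ifs; lia.
Qed.

Definition inversions (t : T) : nat :=
  #|[set e : V * V | (lam t e.2 < lam t e.1)%N && (level t e.1 <= level t e.2)%N]|.

Definition matching_rank (t : T) : nat :=
  (leveling_weight G t * (#|V| * #|V|).+1 + (#|V| * #|V| - inversions t))%N.

Lemma inversions_max t : (inversions t <= #|V| * #|V|)%N.
Proof. by rewrite -card_prod max_card. Qed.

(** The cyclic merge and inner merges with a nontrivial monomial lower the weight, which [mu] keeps.
    Any other merge keeps labels and weight but creates an inversion, while [mu], merging at a
    descent, creates none. *)
Lemma matching_rank_face t j : src t -> (j <= height t)%N -> j != first_irregular t ->
  tgt (face j t) -> (matching_rank (face j t) < matching_rank (mu t))%N.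
Proof.
move=> st jt ji sj; have [it sgl dsc reg] := srcP st.
have [ot tm fm hm e0] := mu_spec st.
have wm : leveling_weight G (mu t) = leveling_weight G t.
  by rewrite -(inner_weight G it) big1 ?addn0 // => v _; rewrite e0 muln0.
have := inversions_max (mu t); have := inversions_max (face j t).
suff : (leveling_weight G (face j t) < leveling_weight G t)%N \/
  leveling_weight G (face j t) = leveling_weight G t /\ (inversions (mu t) < inversions (face j t))%N.
  by rewrite /matching_rank wm => -[] *; nia.
move: jt; rewrite leq_eqVlt => /predU1P [jE|jt].
  left; have := cyclic_weight G (t := t) ltac:(lia); rewrite -jE.
  by apply: leq_ltn_trans; rewrite leq_addr.
have wj := inner_weight G jt.
case: (EM (forall v, merge_expo G j t v = 0%N)) => [ej|/existsNP [v /eqP ev]]; last first.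
  left; rewrite -wj -[X in (X < _)%N]addn0 ltn_add2l (bigD1 v) //= addn_gt0 muln_gt0.
  rewrite [(0 < merge_expo _ _ _ _)%N]lt0n ev andbT weight_gt0 //.
  apply: contraNneq ev => ->; rewrite /merge_expo big1 // => u _.
  by rewrite level_q nxt_lt //= muln0.
right; have wjt : leveling_weight G (face j t) = leveling_weight G t.
  by rewrite -wj big1 ?addn0 // => v _; rewrite ej muln0.
split=> //; have oj := orientation_face jt ej.
have [fj hj] : _ /\ _ := @faceP V q j t ltac:(lia) ltac:(lia).
have [fi hi] : _ /\ _ := @faceP V q (first_irregular t) t ltac:(lia) ltac:(lia).
have lamj : lam (face j t) = lam t by apply: labelling_eq.
have lami : lam (mu t) = lam t by apply: labelling_eq.
(* Otherwise j would be a descent too. Before the first irregular block this contradicts regularity;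
   after it, that block remains a single part followed by a descent, so the face would not be a
   target. *)
have [u [v [uj vj uv]]] : exists u v, [/\ level t u = j, level t v = j.+1 & (lam t u < lam t v)%N].
  apply/not_existsP => no.
  have dj u v : level t u = j -> level t v = j.+1 -> (lam t v < lam t u)%N.
    move=> uj vj; rewrite ltnNge leq_eqVlt; apply/norP; split.
      by apply/eqP => /lam_level; rewrite uj vj; lia.
    by apply/negP => uv; apply: (no u); exists v.
  have [lt_ji|le_ij] := ltnP j (first_irregular t).
    by have /andP [_ /negP] := reg j lt_ji; apply; apply/descentP.
  set i := first_irregular t in ji it sgl dsc reg le_ij fi hi.
  have lt_ij : (i < j)%N by rewrite ltn_neqAle eq_sym ji.
  have sfi : single (face j t) i.
    apply/singleP => u v; rewrite !fj lamj => /eqP + /eqP.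
    by rewrite !faceF_lt ?level_le // => /eqP ui /eqP vi; apply: sgl.
  have ifj : first_irregular (face j t) = i.
    apply: first_irregular_eq; first by rewrite hj; lia.
      suff di : descent (face j t) i by rewrite /regular di andbF.
      apply/descentP; first by rewrite hj; lia.
      move=> u v; rewrite !fj lamj => /eqP; rewrite faceF_lt ?level_le // => /eqP ui vi.
      have [vi1|[jE vi2]] : level t v = i.+1 \/ j = i.+1 /\ level t v = i.+2.
        by move: vi; have := level_le t v; rewrite /faceF; split_ifs; lia.
        exact: dsc.
      have [x xj] := level_onto (ltnW jt).
      apply: (@ltn_trans (lam t x)); first by apply: dj; rewrite // jE.
      by apply: dsc; rewrite ?xj.
    by move=> k ki; apply: regular_face => //; [apply: ltn_trans lt_ij | apply: reg].
  by move: sj; rewrite /tgt ifj sfi andbF.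
apply: (@leq_ltn_trans (inversions t)).
  rewrite /inversions lami; apply/subset_leq_card/subsetP => -[a b]; rewrite !inE /=.
  move=> /andP [ab]; rewrite ab !fi /= => fab.
  have := dsc b a; have := level_le t a; have := level_le t b.
  by move: fab; rewrite /faceF; split_ifs; lia.
rewrite /inversions lamj; apply/proper_card/properP; split.
  apply/subsetP => -[a b]; rewrite !inE /= => /andP [-> ab] /=.
  by rewrite !fj; have := level_le t a; have := level_le t b; rewrite /faceF; split_ifs; lia.
exists (v, u); rewrite !inE /= uv ?uj ?vj ?ltnn //=.
by rewrite !fj uj vj /faceF; split_ifs; lia.
Qed.

Definition critical_leveling := critical src tgt.

Lemma criticalP t : reflect (forall i, (i <= height t)%N -> regular t i) (critical_leveling t).
Proof.
have -> : critical_leveling t = (height t < first_irregular t)%N.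
  rewrite /critical_leveling /critical /src /tgt; case: leqP => //= _.
  by case: (single _ _).
apply: (iffP idP) => [lt i it|reg]; first by apply: before_first => //; apply: leq_ltn_trans lt.
by rewrite ltnNge; apply/negP => ft; have := first_irregularP ft; rewrite reg.
Qed.

Lemma critical_lam_eq t u v : critical_leveling t -> level t u = level t v -> lam t u = lam t v.
Proof.
move=> /criticalP reg uv; have /andP [/singleP st _] := reg _ (level_le t v).
exact: st.
Qed.

(** A non-descent provides one nondecreasing pair of labels. As both blocks are single parts it
    speaks for all pairs, and equality is excluded since equal labels have equal levels. *)
Lemma critical_lam_lt t u v : critical_leveling t -> (level t u < level t v)%N ->
  (lam t u < lam t v)%N.
Proof.
move=> ct; move: {2}(level t v) (erefl (level t v)) => n; elim: n v => [|n IHn] v vn.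
  by rewrite vn.
have nt : (n < height t)%N by rewrite -vn level_le.
have /criticalP/(_ n (ltnW nt))/andP [_ /(not_descentP nt)] := ct.
move=> [a [b [an bn ab]]]; have {}ab : (lam t a < lam t v)%N.
  have <- : lam t b = lam t v by apply: critical_lam_eq; rewrite // bn vn.
  rewrite ltn_neqAle ab andbT.
  by apply/eqP => /lam_level; rewrite an bn; lia.
rewrite vn ltnS leq_eqVlt => /predU1P [un|un].
  by rewrite (@critical_lam_eq t u a) // an un.
by apply: ltn_trans ab; apply: IHn; rewrite // an.
Qed.

(** The levels of a critical leveling are ordered like its labels and form a good labelling, so its
    orientation has a representative, whose levels are these labels by [labelling_spec]; levelings
    with the same order coincide. Conversely, labels equal to levels leave no descent. *)
Lemma critical_rep t : critical_leveling t = rep t.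
Proof.
apply/idP/idP => [ct|rt].
  have gt : good_labelling G q (orient t) (level t).
    split=> [u v|u v|u v uv|u _].
    - by rewrite inE => /andP [].
    - by rewrite unoriented_level => /andP [_ /eqP].
    - exact/lam_connect/critical_lam_eq.
    - apply: lam_above_q; have [u0|u0] := posnP (level t u).
        by rewrite (critical_lam_eq (v := u)) // level_q u0.
      by apply/ltnW/critical_lam_lt => //; rewrite level_q.
  have [t' rt' ot'] := rep_ex gt; have [_ /(_ t' rt' ot') lt'] := labellingP t.
  suff -> : t = t' by [].
  apply: leveling_order_eq => u v; rewrite !lt'; first exact: critical_lam_lt.
  exact: critical_lam_eq.
have [_ /(_ t rt erefl) lt] := labellingP t.
apply/criticalP => i it; apply/andP; split.
  by apply/singleP => u v; rewrite -!lt => -> ->.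
have [ih|ih] := ltnP i (height t); last by rewrite /descent ltnNge ih.
apply/not_descentP => //; have [u ui] := level_onto it; have [v vi] := level_onto ih.
by exists u, v; rewrite -!lt ui vi.
Qed.

Lemma critical_height t s : critical_leveling t -> critical_leveling s ->
  unoriented_edges G t = unoriented_edges G s -> height t = height s.
Proof.
have fib r u v : critical_leveling r ->
  (level r u == level r v) = connect (unoriented G (orient r)) u v.
  move=> cr; apply/eqP/idP => [uv|/connect_unoriented_level//].
  exact/lam_connect/critical_lam_eq.
move=> ct cs ts; apply: height_of_fibers => u v; rewrite !fib //.
apply: eq_connect => a b; rewrite !unoriented_level.
by have := congr1 (fun E : {set V * V} => (a, b) \in E) ts; rewrite /= !inE.
Qed.

Lemma src_trivial : ~~ src (trivial_leveling q).
Proof.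
apply/negP => /srcP [+ _ _ _]; suff -> : height (trivial_leveling q) = 0%N by [].
by apply/eqP; rewrite height0P.
Qed.

Lemma tgt_trivial : ~~ tgt (trivial_leveling q).
Proof.
set t := trivial_leveling q.
have ht : height t = 0%N by apply/eqP; rewrite height0P.
have lt v : level t v = 0%N by apply/eqP; rewrite -leqn0 -ht level_le.
apply/negP => /andP []; rewrite ht leqn0 => /eqP -> /singleP []; move=> u v _ _.
apply: lam_connected; have := mult_connected G u v; apply: connect_sub => a b ab.
by apply: connect1; rewrite unoriented_level !lt eqxx andbT.
Qed.

Variables (K : fieldType) (eps : bool).
Notation M := (flag_kernel G K eps).

Lemma flag_kernel_mu t : src t -> M t (mu t) = 1 \/ M t (mu t) = -1.
Proof.
move=> st; have [it _ _ _] := srcP st; have [_ tm _ _ e0] := mu_spec st.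
set i := first_irregular t in it e0.
have ilt : (i < (height t).+1)%N by apply: ltnW.
have -> : M t (mu t) = ((-1) ^+ i)%:MP.
  rewrite /flag_kernel (bigD1 (Ordinal ilt)) //= eqxx (leq_ltn_trans _ it) //=.
  rewrite big1 ?addr0 => [|j ji].
    rewrite /face_coef (ltn_eqF it) mulr1 (_ : merge_mnm G i t = 0%MM).
      by rewrite mpolyX0 -mul_mpolyC mulr1.
    by apply/monomP => v; rewrite mnm_of_rank e0 mnm0E.
  (* A second index with the same face would give this face a [matching_rank] below itself. *)
  case: ifP => // /eqP mj.
  have : (matching_rank (face j t) < matching_rank (mu t))%N.
    apply: matching_rank_face; rewrite // -?mj //; first by rewrite -ltnS.
  by rewrite mj ltnn.
by case: (odd i) (signr_odd K i) => <-; [right | left]; rewrite ?expr1 ?mpolyCN ?expr0.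
Qed.

Lemma flag_kernel_triangular t s : src t -> tgt s -> M t s != 0 -> s != mu t ->
  (matching_rank s < matching_rank (mu t))%N.
Proof.
move=> st ts /mpoly_neq0 [m /(flag_kernel_neq0 (f := mcoeff m)) [j [t0 jt sj _]]] smu.
rewrite sj; apply: matching_rank_face; rewrite -?sj //.
by apply: contraNneq smu => ji; rewrite sj ji.
Qed.

End Matching.

(** * The toppling ideal and its initial ideal *)

Section Divisors.
Variables (V : finType) (G : multigraph V).

Lemma degPicD : {morph @degPic V G : x y / x + y}.
Proof. exact: raddfD. Qed.

Lemma degPic_eqP (D E : Div V) :
  degPic G D = degPic G E <-> exists f, D - E = laplacian G f.
Proof.
split=> [DE|[f DE]].
  have : D - E \in principal G by rewrite Quotient.idealrBE; apply/eqP.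
  by move/asboolP.
by apply/eqP; rewrite /degPic -Quotient.idealrBE; apply/asboolP; exists f.
Qed.

Lemma degPic_laplacian f : degPic G (laplacian G f) = 0.
Proof.
have -> : 0 = degPic G 0 by rewrite -(raddf0 (\pi_(Quotient.quot (principal G)))%qT).
by apply/degPic_eqP; exists f; rewrite subr0.
Qed.

Lemma degZD : {morph @degZ V : x y / x + y}.
Proof.
by move=> x y; rewrite /degZ -big_split; apply: eq_bigr => v _; rewrite ffunE.
Qed.

Lemma degZ_laplacian f : degZ (laplacian G f) = 0.
Proof.
rewrite /degZ.
under eq_bigr => v _ do rewrite ffunE; under eq_bigr => v _ do under eq_bigr do rewrite mulrnBl.
under eq_bigr do rewrite sumrB.
rewrite sumrB [X in _ - X]exchange_big; apply/eqP; rewrite subr_eq0; apply/eqP.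
by apply: eq_bigr => v _; apply: eq_bigr => u _; rewrite mult_sym.
Qed.

End Divisors.

(** * Divisors reduced at q and the reverse lexicographic order *)

Section ReducedDivisors.
Variables (V : finType) (G : multigraph V) (q : V).
Notation monom := 'X_{1..#|V|}.
Notation t0 := (trivial_leveling q).
Notation reduced := (@standard V G q t0).

Lemma level_trivial v : level t0 v = 0%N.
Proof. by apply/eqP; rewrite -leqn0 -(eqP (_ : height t0 == 0%N)) ?level_le ?height0P. Qed.

Lemma laplacian_ge (f : V -> int) v (b : V -> bool) :
  (forall w, f w + (b w)%:Z <= f v) ->
  (\sum_(w | b w) mult G v w)%N%:Z <= laplacian G f v.
Proof.
move=> fb; rewrite ffunE (big_morph Posz PoszD (erefl (0%N : int))) big_mkcond /=.
apply: Num.Theory.ler_sum => w _; have := fb w.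
by case: (b w) => /= fw; move: (mult G v w) => k; nia.
Qed.

Lemma div_of_mnmB (m m' : monom) (D : Div V) v : div_of_mnm m - div_of_mnm m' = D ->
  (m (enum_rank v))%:Z - (m' (enum_rank v))%:Z = D v.
Proof. by move=> <-; rewrite !ffunE. Qed.

(* Firing a script that leads from a q-reduced divisor to an effective one
   attains its maximum at q, as otherwise its maximal level set would be legal. *)
Lemma reduced_firing_max (m m' : monom) (f : V -> int) : reduced m ->
  div_of_mnm m - div_of_mnm m' = laplacian G f -> forall v, f v <= f q.
Proof.
move=> red mm'.
have [x _ fx'] := @Order.TotalTheory.arg_maxP _ _ V q predT f isT.
have {fx'}fx v : f v <= f x := fx' v isT.
have [fxq|xq v] := eqVneq (f x) (f q); first by move=> v; rewrite -fxq.
case/negP: red; apply/existsP; exists [set v | f v == f x].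
apply/and3P; split.
- by apply/set0Pn; exists x; rewrite inE.
- by rewrite inE eq_sym.
apply/forall_inP => u; rewrite inE level_trivial /= => /eqP ux.
have -> : (\sum_(w | (level t0 w == 0%N) && (w \notin [set v0 | f v0 == f x])) mult G u w =
  \sum_(w | f w != f x) mult G u w)%N.
  by apply: eq_bigl => w; rewrite level_trivial inE.
have le_lap : (\sum_(w | f w != f x) mult G u w)%N%:Z <= laplacian G f u.
  by apply: laplacian_ge => w; have := fx w; rewrite ux; case: eqP => /=; lia.
move: le_lap; rewrite -(div_of_mnmB u mm'); move: (\sum_(w | _) _)%N => s. move: (m (enum_rank u)) (m' (enum_rank u)) => a b. lia.
Qed.

(** The script joining the two divisors is maximal at q, and so is its negative; hence it is
    constant and its Laplacian vanishes. *)
Lemma reduced_unique (m m' : monom) : reduced m -> reduced m' ->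
  degPic G (div_of_mnm m) = degPic G (div_of_mnm m') -> m = m'.
Proof.
move=> red red' /degPic_eqP [f mm'].
have fq := reduced_firing_max red mm'.
have fq' v : - f v <= - f q.
  apply: (reduced_firing_max (f := fun v => - f v) red' (m' := m)).
  rewrite -[LHS]opprB mm'; apply/ffunP => w; rewrite !ffunE -sumrN.
  by apply: eq_bigr => u _; rewrite -mulNrn; congr (_ *+ _); lia.
have f_const v : f v = f q by have := fq v; have := fq' v; lia.
apply/monomP => v; have := div_of_mnmB v mm'.
rewrite ffunE big1 => [|w _]; last by rewrite !f_const subrr mul0rn.
by lia.
Qed.

Lemma reduced_le (m m' : monom) : ~~ reduced m -> ~~ reduced (m' + m)%MM.
Proof.
rewrite !negbK => /existsP [P /and3P [P0 Pq /forall_inP Pm]].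
apply/existsP; exists P; apply/and3P; split=> //; apply/forall_inP => v vP.
by have /andP [-> Pv] := Pm v vP; rewrite mnmDE (leq_trans Pv) ?leq_addl.
Qed.

Section TermOrder.
Variable xle : rel V.
Hypothesis xle_total : total_order_on predT xle.
Hypothesis xle_dist : forall v w, (dist G w q < dist G v q)%N -> (w != v) && xle w v.

Lemma degrevlex_asym (m m' : monom) : degrevlex_lt xle m m' -> degrevlex_lt xle m' m -> False.
Proof.
have [_ _ _ tot] := xle_total.
case/orP => [lt_deg|/andP [/eqP eq_deg /existsP [v /andP [vm /forallP vP]]]].
  by case/orP => [|/andP [/eqP e _]]; [rewrite ltnNge (ltnW lt_deg) | rewrite e ltnn in lt_deg].
case/orP => [|/andP [_ /existsP [w /andP [wm /forallP wP]]]]; first by rewrite eq_deg ltnn.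
have [vw|vw] := eqVneq v w; first by move: vm; rewrite vw ltnNge (ltnW wm).
have /orP [vlew|wlev] := tot v w isT isT.
  by have := wP v; rewrite vw vlew => /eqP e; rewrite e ltnn in vm.
by have := vP w; rewrite eq_sym vw wlev => /eqP e; rewrite e ltnn in wm.
Qed.

(** The smallest variable with different exponents sits where f is maximal, because [xle] follows
    the distance to q. There the Laplacian is nonnegative, so m has the larger exponent and is the
    smaller monomial. *)
Lemma degrevlex_firing (m m' : monom) (f : V -> int) :
  div_of_mnm m - div_of_mnm m' = laplacian G f -> (forall v, f v <= f q) ->
  m != m' -> degrevlex_lt xle m m'.
Proof.
move=> mm' fq neq; have [refl anti trans tot] := xle_total.
have lapE v := div_of_mnmB v mm'.
have degE : mdeg m = mdeg m'.
  have := congr1 (@degZ V) mm'; rewrite degZ_laplacian degZD.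
  have dE (a : monom) : degZ (div_of_mnm a) = (mdeg a)%:Z.
    rewrite /degZ mdegE (big_morph Posz PoszD (erefl (0%N : int))).
    rewrite [RHS](reindex (@enum_rank V)) /=; last by apply: onW_bij; apply: enum_rank_bij.
    by apply: eq_bigr => v _; rewrite ffunE.
  have -> : degZ (- div_of_mnm m') = - degZ (div_of_mnm m').
    by rewrite /degZ -sumrN; apply: eq_bigr => v _; rewrite ffunE.
  by rewrite !dE; lia.
apply/orP; right; rewrite degE eqxx /=.
have [u um] : exists u, f u < f q.
  apply/not_existsP => no; case/eqP: neq; apply/monomP => v.
  have fc w : f w = f q by have := no w; have := fq w; lia.
  have := lapE v; rewrite ffunE big1 => [|w _]; first by lia.
  by rewrite !fc subrr mul0rn.
pose P v := f v < f q.
(* u is closest to q among the vertices where f is not maximal. Its neighbour w towards q is a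
   maximum with positive Laplacian, and the variable of w precedes those of all vertices off the
   maximum. *)
case: (arg_minnP (P := P) (fun v => dist G v q) um) => {u um} u Pu umin.
have uq : u != q by apply: contraTneq Pu => ->; rewrite /P; lia.
have [w uw wu] := dist_step G uq.
have fw : f w = f q.
  have := fq w; rewrite Order.POrderTheory.le_eqVlt => /predU1P [//|Pw].
  by have := umin w Pw; lia.
have lap_max v : f v = f q -> 0 <= laplacian G f v.
  move=> fv; rewrite ffunE; apply: Num.Theory.sumr_ge0 => x _.
  by have := fq x; rewrite fv; move: (mult G v x) => k; nia.
have lap_w : laplacian G f w != 0.
  suff : 0 < laplacian G f w by lia.
  rewrite ffunE (bigD1 u) //=; apply: Num.Theory.ltr_pwDl.
    have : (0 < mult G w u)%N by rewrite mult_sym.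
    by move: Pu; rewrite /P fw; move: (mult G w u) => k; nia.
  apply: Num.Theory.sumr_ge0 => x _.
  by have := fq x; rewrite fw; move: (mult G w x) => k; nia.
pose below v := #|[set x | xle x v]|.
case: (arg_minnP (P := fun v => laplacian G f v != 0) below lap_w) => v lap_v vmin.
have {}vmin x : laplacian G f x != 0 -> xle v x.
  move=> lap_x; have /orP [//|xv] := tot v x isT isT.
  have [->|xv'] := eqVneq x v; first exact: refl.
  have := vmin x lap_x; rewrite leqNgt => /negP; case; apply/proper_card/properP; split.
    by apply/subsetP => y; rewrite !inE => yx; apply: (trans x) => //.
  exists v; rewrite !inE; first exact: refl.
  by apply/negP => vx; case/eqP: xv'; apply: anti => //; rewrite xv vx.
have fv : f v = f q.
  have := fq v; rewrite Order.POrderTheory.le_eqVlt => /predU1P [//|Pv].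
  have /andP [wv xwv] : (w != v) && xle w v.
    by apply: xle_dist; apply: leq_trans wu _; apply: umin.
  by case/eqP: wv; apply: anti => //; rewrite xwv vmin.
apply/existsP; exists v; apply/andP; split.
  move: (lap_max v fv) lap_v (lapE v) => /=.
  by move: (m _) (m' _) (laplacian G f v) => a b c; lia.
apply/forallP => x; apply/implyP => /andP [xv xlexv].
have [lap0|/vmin vx] := eqVneq (laplacian G f x) 0.
  by have := lapE x; rewrite lap0; move: (m _) (m' _) => a b; lia.
by case/eqP: xv; apply: anti => //; rewrite xlexv vx.
Qed.
End TermOrder.
End ReducedDivisors.

Section TopplingIdeal.
Variables (V : finType) (G : multigraph V) (q : V) (K : fieldType).
Notation R := {mpoly K[#|V|]}.
Notation monom := 'X_{1..#|V|}.
Notation IG := (@toppling_ideal V K G).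
Notation t0 := (trivial_leveling q).
Notation reduced := (@standard V G q t0).

Lemma mnm_of_divK (D : Div V) : effective D -> div_of_mnm (mnm_of_div D) = D.
Proof.
move=> /forallP D0; apply/ffunP => v; rewrite ffunE mnmE enum_rankK.
by have := D0 v; case: (D v).
Qed.

Section Homogeneity.
Variables (A : zmodType) (deg : Div V -> A).
Hypothesis degD : {morph deg : x y / x + y}.
Hypothesis deg_laplacian : forall f, deg (laplacian G f) = 0.

Lemma toppling_hpart d p : IG p -> IG (hpart deg d p).
Proof.
apply: ideal_gen_hpart => // g [D1 [D2 [e1 e2 /degPic_eqP [f D12] ->]]].
exists (deg D1); apply: homogeneousD.
  by rewrite -{1}(mnm_of_divK e1); apply: homogeneousX.
apply: homogeneousN; suff -> : deg D1 = deg D2.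
  by rewrite -{1}(mnm_of_divK e2); apply: homogeneousX.
by rewrite -(subrK D2 D1) D12 degD deg_laplacian add0r.
Qed.

Lemma initial_hpart (xle : rel V) (I : R -> Prop) d p :
  initial_ideal xle I p -> initial_ideal xle I (hpart deg d p).
Proof.
apply: ideal_gen_hpart => // g [h [m [_ _ ->]]].
by exists (mdg deg m); apply: homogeneousX.
Qed.

End Homogeneity.

(** Generators are homogeneous for [degPic] and vanish where all variables are 1, so the same holds
    for every graded component of the ideal. In particular no such component is a single term. *)
Lemma toppling_eval c p : IG p -> (hpart (degPic G) c p).@[fun=> 1] = 0.
Proof.
have eval1 (m : monom) : ('X_[m] : R).@[fun=> 1] = 1.
  by rewrite mevalX big1 // => i _; rewrite expr1n.
move=> [s [a [g [gP ->]]]]; have -> : hpart (degPic G) c (\sum_(t < s) a t * g t) =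
  \sum_(t < s) hpart (degPic G) c (a t * g t) by apply: linear_sum.
rewrite (raddf_sum (meval (fun=> 1))) big1 // => i _.
have [D1 [D2 [e1 e2 /degPic_eqP [f D12] gE]]] := gP i.
have hg : homogeneous (degPic G) (degPic G D1) (g i).
  rewrite gE; apply: homogeneousD.
    by rewrite -{1}(mnm_of_divK e1); apply: homogeneousX.
  apply: homogeneousN; have -> : degPic G D1 = degPic G D2 by apply/degPic_eqP; exists f.
  by rewrite -{1}(mnm_of_divK e2); apply: homogeneousX.
by rewrite (hpartMr (@degPicD V G) _ _ hg) /= mevalM gE mevalB !eval1 subrr mulr0.
Qed.

Lemma toppling_partner p m : IG p -> m \in msupp p ->
  exists m', [/\ m' \in msupp p, m' != m & degPic G (div_of_mnm m) = degPic G (div_of_mnm m')].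
Proof.
move=> Ip mp; apply/not_existsP => no.
have := toppling_eval (mdg (degPic G) m) Ip.
have -> : hpart (degPic G) (mdg (degPic G) m) p = p@_m *: 'X_[m].
  rewrite /hpart (big_rem m) //= eqxx big_seq_cond big1 ?addr0 // => m'.
  rewrite mem_rem_uniq ?msupp_uniq // inE => /andP [/andP [m'm m'p] /eqP e].
  by case: (no m'); split.
rewrite mevalZ mevalX big1 ?mulr1 => [/eqP|i _]; last by rewrite expr1n.
by rewrite mcoeff_eq0 mp.
Qed.

Lemma toppling_reduced p : IG p -> (forall m, m \in msupp p -> reduced m) -> p = 0.
Proof.
move=> Ip red; apply/msuppnil0; case pE : (msupp p) => [//|m r].
have mp : m \in msupp p by rewrite pE mem_head.
have [m' [m'p m'm mm']] := toppling_partner Ip mp.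
by rewrite (reduced_unique (red m mp) (red m' m'p) mm') eqxx in m'm.
Qed.

Lemma face_height1 j (t : leveling q) : height t = 1%N -> (j <= 1)%N -> face j t = t0.
Proof.
move=> t1 j1; apply/eqP; rewrite -height0P (faceP _ _).2 t1 //.
Qed.

Lemma flag_kernel_trivial eps (t : leveling q) : height t = 1%N ->
  flag_kernel G K eps t t0 =
  'X_[merge_mnm G 0 t] - (eps%:R : K) *: 'X_[merge_mnm G 1 t].
Proof.
move=> t1; rewrite /flag_kernel /face_coef t1 big_ord_recl big_ord1 /=.
rewrite !face_height1 // eqxx /= expr0 expr1 mul1r scale1r.
by rewrite mulN1r scaleNr.
Qed.

Lemma merge_degPic (t : leveling q) : height t = 1%N ->
  degPic G (div_of (merge_expo G 0 t)) = degPic G (div_of (merge_expo G 1 t)).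
Proof.
move=> t1; have hD := @degPicD V G; have hL := @degPic_laplacian V G.
have := @leveling_deg_face V G q _ _ hD hL 0 t; have := @leveling_deg_face V G q _ _ hD hL 1 t.
rewrite t1 => /(_ isT isT) -> /(_ isT isT).
by rewrite !face_height1 // !mdg_mnm_of => /addIr ->.
Qed.

Lemma mnm_of_div_of (f : V -> nat) : mnm_of_div (div_of f) = mnm_of f.
Proof. by apply/mnmP => i; rewrite !mnmE ffunE. Qed.

Lemma effective_div_of (f : V -> nat) : effective (div_of f).
Proof. by apply/forallP => v; rewrite ffunE. Qed.

Lemma toppling_binomial (t : leveling q) : height t = 1%N ->
  IG ('X_[merge_mnm G 0 t] - 'X_[merge_mnm G 1 t]).
Proof.
move=> t1; apply: ideal_gen_sub.
exists (div_of (merge_expo G 0 t)), (div_of (merge_expo G 1 t)).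
by rewrite !mnm_of_div_of; split=> //; [apply: effective_div_of.. | apply: merge_degPic].
Qed.

Lemma toppling_flag_kernel t : IG (flag_kernel G K true t t0).
Proof.
have [I0 _ _] := ideal_gen_ideal (fun p : R => exists D1 D2 : Div V,
    [/\ effective D1, effective D2, degPic G D1 = degPic G D2
      & p = 'X_[mnm_of_div D1] - 'X_[mnm_of_div D2]]).
have [->//|/flag_kernel_height t1] := eqVneq (flag_kernel G K true t t0) 0.
have {}t1 : height t = 1%N by rewrite t1; congr S; apply/eqP; rewrite height0P.
by rewrite flag_kernel_trivial // scale1r; apply: toppling_binomial.
Qed.

Section InitialIdeal.
Variable xle : rel V.
Hypothesis xle_total : total_order_on predT xle.
Hypothesis xle_dist : forall v w, (dist G w q < dist G v q)%N -> (w != v) && xle w v.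
Notation inIG := (initial_ideal xle IG).

(** The script is the indicator of the first block, maximal at q. The monomials differ because the
    cyclic merge loses weight and the inner one does not. *)
Lemma merge_degrevlex (t : leveling q) : height t = 1%N ->
  degrevlex_lt xle (merge_mnm G 1 t) (merge_mnm G 0 t) /\ merge_mnm G 1 t != merge_mnm G 0 t.
Proof.
move=> t1; have neq : merge_mnm G 1 t != merge_mnm G 0 t.
  apply/eqP => e; have := cyclic_weight G (t := t); rewrite t1 => /(_ isT).
  have := @inner_weight V G q 0 t; rewrite t1 => /(_ isT) <-.
  rewrite !face_height1 // (eq_bigr (fun v => weight G q v * merge_expo G 0 t v)%N) ?ltnn //.
  by move=> v _; have := congr1 (fun m : monom => m (enum_rank v)) e; rewrite !mnm_of_rank => ->.
split=> //; apply: (degrevlex_firing (G := G) (q := q) xle_total xle_dist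
  (f := fun v => (level t v == 0%N)%:R)) => // [|v]; last first.
  by rewrite level_q; case: (_ == _).
apply/ffunP => v; rewrite !ffunE !mnm_of_rank.
rewrite !(big_morph Posz PoszD (erefl (0%N : int))) -sumrB; apply: eq_bigr => u _.
rewrite /nxt t1 /=; have := level_le t v; have := level_le t u; rewrite t1.
move: (mult G v u) => k.
by case: (level t v) => [|[|?]]; case: (level t u) => [|[|?]] //= _ _;
  rewrite ?muln1 ?muln0 ?subr0 ?sub0r ?subrr ?mul0rn ?mulNrn ?natz ?pmulrn ?intz.
Qed.

Lemma initial_flag_kernel t : inIG (flag_kernel G K false t t0).
Proof.
have [I0 _ _] := ideal_gen_ideal (fun g : R => exists (p : R) (m : monom),
    [/\ IG p, is_initial_mnm xle p m & g = 'X_[m]]).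
have [->//|/flag_kernel_height t1] := eqVneq (flag_kernel G K false t t0) 0.
have {}t1 : height t = 1%N by rewrite t1; congr S; apply/eqP; rewrite height0P.
rewrite flag_kernel_trivial // scale0r subr0; apply: ideal_gen_sub.
have [lt neq] := merge_degrevlex t1.
exists ('X_[merge_mnm G 0 t] - 'X_[merge_mnm G 1 t]), (merge_mnm G 0 t).
split=> //; first exact: toppling_binomial.
split; first by rewrite mcoeff_msupp mcoeffB !mcoeffX eqxx (negbTE neq) subr0 oner_eq0.
move=> m'; rewrite mcoeff_msupp mcoeffB !mcoeffX => + m'm.
rewrite [merge_mnm G 0 t == _]eq_sym (negbTE m'm) sub0r oppr_eq0.
by have [<- //|_] := eqVneq (merge_mnm G 1 t) m'; rewrite eqxx.
Qed.

(** Were m reduced, the script to another monomial of p in its class would be maximal at q, which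
    makes m the smaller of the two. *)
Lemma initial_not_reduced p m : IG p -> is_initial_mnm xle p m -> ~~ reduced m.
Proof.
move=> Ip [mp mmax]; apply/negP => red.
have [m' [m'p m'm /degPic_eqP [f mm']]] := toppling_partner Ip mp.
apply: (degrevlex_asym xle_total (mmax m' m'p m'm)).
have fq := reduced_firing_max red mm'.
by apply: (degrevlex_firing xle_total xle_dist mm' fq); rewrite eq_sym.
Qed.

Lemma initial_reduced p : inIG p -> (forall m, m \in msupp p -> reduced m) -> p = 0.
Proof.
move=> [s [c [g [gP pE]]]] red; apply/msuppnil0; case mE : (msupp p) => [//|m r].
have mp : m \in msupp p by rewrite mE mem_head.
have := red m mp; suff /negbTE -> : ~~ reduced m by [].
move: mp; rewrite pE => /msupp_sum_le /flatten_mapP [i _].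
have [h [m1 [Ih hm1 ->]]] := gP i.
move=> /msuppM_le /allpairsP [[a b] /= [_]]; rewrite msuppX inE => /eqP -> ->.
exact/reduced_le/(initial_not_reduced Ih hm1).
Qed.

End InitialIdeal.
End TopplingIdeal.

(** * Connected flags *)

Section ConnectedFlags.
Variables (V : finType) (G : multigraph V) (q : V).
Notation T := (leveling q).

Definition flag_of k (t : T) : k.-tuple {set V} :=
  [tuple [set v | (level t v <= l)%N] | l < k].

Lemma nth_flag_of k t l : (l < k)%N ->
  nth set0 (flag_of k t) l = [set v | (level t v <= l)%N].
Proof. by move=> lk; rewrite -[l]/(val (Ordinal lk)) nth_mktuple. Qed.

Lemma connected_flagP h (U : h.+1.-tuple {set V}) : reflect
  [/\ q \in nth set0 U 0, nth set0 U h = [set: V] &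
      forall l, (l < h)%N -> [/\ nth set0 U l \proper nth set0 U l.+1,
        induced_connected G (nth set0 U l) &
        induced_connected G (nth set0 U l.+1 :\: nth set0 U l)]]
  (connected_flag G q U).
Proof.
have lastE : last set0 U = nth set0 U h by rewrite -nth_last size_tuple.
apply: (iffP and3P) => [[q0 /eqP Uh /forallP Ul]|[q0 Uh Ul]].
  split=> //; first by rewrite -lastE.
  by move=> l lh; have /and3P := Ul (Ordinal lh).
split=> //; first by rewrite lastE Uh.
by apply/forallP => l; apply/and3P/Ul; apply: ltn_ord.
Qed.

Lemma induced_connectedP (U : {set V}) : reflect
  (U != set0 /\ forall u v, u \in U -> v \in U ->
     connect (fun a b => [&& a \in U, b \in U & adj G a b]) u v)
  (induced_connected G U).
Proof.
apply: (iffP andP) => [[U0 /forall_inP c]|[U0 c]]; split=> //.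
  by move=> u v uU vU; have /forall_inP := c u uU; apply.
by apply/forall_inP => u uU; apply/forall_inP => v vU; apply: c.
Qed.

Lemma flag_chain h (U : h.+1.-tuple {set V}) l m : connected_flag G q U ->
  (l <= m)%N -> (m <= h)%N -> nth set0 U l \subset nth set0 U m.
Proof.
move=> /connected_flagP [_ _ Ul]; elim: m => [|m IHm]; first by rewrite leqn0 => /eqP ->.
rewrite leq_eqVlt => /predU1P [->|lm mh]; first by rewrite subxx.
apply: subset_trans (IHm lm (ltnW mh)) _.
by have [/proper_sub] := Ul m mh.
Qed.

Lemma flag_q h (U : h.+1.-tuple {set V}) l : connected_flag G q U -> (l <= h)%N ->
  q \in nth set0 U l.
Proof.
move=> cU lh; apply: (subsetP (flag_chain cU (leq0n l) lh)).
by have /connected_flagP [] := cU.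
Qed.

Lemma leveling_of_flag h (U : h.+1.-tuple {set V}) : connected_flag G q U ->
  exists2 t, height t = h & flag_of h.+1 t = U.
Proof.
move=> cU; have /connected_flagP [q0 Uh Ul] := cU.
pose f v := find (fun X : {set V} => v \in X) U.
have hasf v : has (fun X : {set V} => v \in X) U.
  apply/hasP; exists (nth set0 U h); last by rewrite Uh inE.
  by rewrite mem_nth // size_tuple.
have f_le v : (f v <= h)%N by rewrite -ltnS -[X in (_ < X)%N](size_tuple U) -has_find.
have f_in v : v \in nth set0 U (f v) by apply: (nth_find set0 (hasf v)).
have fE v l : (l <= h)%N -> (f v <= l)%N = (v \in nth set0 U l).
  move=> lh; apply/idP/idP => [fl|vl]; first exact: (subsetP (flag_chain cU fl lh)).
  by rewrite leqNgt; apply/negP => /(before_find set0); rewrite vl.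
have [tf ht] : level (mk_leveling q f) =1 f /\ height (mk_leveling q f) = h.
  apply: mk_levelingP; split=> // [|i ih].
    by apply/eqP; rewrite -leqn0 fE.
  case: i ih => [_|i ih]; first by exists q; apply/eqP; rewrite -leqn0 fE.
  have [/properP [_ [v vi nvi]] _ _] := Ul i ih.
  by exists v; apply/eqP; rewrite eqn_leq fE // vi ltnNge fE ?nvi // ltnW.
exists (mk_leveling q f) => //; apply: eq_from_tnth => i.
rewrite !(tnth_nth set0) nth_flag_of //; apply/setP => v.
by rewrite inE tf fE // -ltnS.
Qed.

Lemma flag_of_inj h (t t' : T) : height t = h -> height t' = h ->
  flag_of h.+1 t = flag_of h.+1 t' -> t = t'.
Proof.
move=> ht ht' tt'; apply: level_inj => v.
have lv l : (l <= h)%N -> (level t v <= l)%N = (level t' v <= l)%N.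
  move=> lh; have := congr1 (fun U : h.+1.-tuple {set V} => v \in nth set0 U l) tt'.
  by rewrite !nth_flag_of // !inE.
have le_t := level_le t v; have le_t' := level_le t' v; rewrite ht in le_t; rewrite ht' in le_t'.
by apply/eqP; rewrite eqn_leq lv // leqnn -lv // leqnn.
Qed.

Lemma flag_orientation_of h (t : T) : height t = h ->
  flag_orientation G (flag_of h.+1 t) = orientation G t.
Proof.
move=> ht; apply/setP => -[u v]; rewrite !inE /=; congr (_ && _).
apply/existsP/idP => [[l]|uv].
  have lh := ltn_ord l; have lh' : (l < h.+1)%N by apply: ltnW.
  rewrite !nth_flag_of // !inE /= => /andP [ul /andP [vl _]].
  by apply: leq_ltn_trans ul _; rewrite ltnNge.
have vh : ((level t v).-1 < h)%N by have := level_le t v; rewrite ht; lia.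
exists (Ordinal vh); have vh' : ((level t v).-1 < h.+1)%N by apply: ltnW.
by rewrite !nth_flag_of //= !inE; lia.
Qed.

Lemma flag_div_of h (t : T) : height t = h ->
  flag_div G (flag_of h.+1 t) = div_of (indeg G t).
Proof.
move=> ht; apply/ffunP => v; rewrite /flag_div sum_ffunE ffunE /=.
have blockE (l : 'I_h) : div_between G
    (nth set0 (flag_of h.+1 t) l.+1 :\: nth set0 (flag_of h.+1 t) l)
    (nth set0 (flag_of h.+1 t) l) v =
  if level t v == l.+1 then (indeg G t v)%:Z else 0.
  have lh := ltn_ord l; have lh' : (l < h.+1)%N by apply: ltnW.
  rewrite ffunE !nth_flag_of // !inE -ltnNge eqn_leq andbC; case: ifP => // vl.
  congr Posz; rewrite /indeg big_mkcond; apply: eq_bigr => u _; rewrite inE.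
  have -> : (level t u < level t v)%N = (level t u <= l)%N by move: vl; lia.
  by case: (_ <= _)%N; rewrite ?muln1 ?muln0.
under eq_bigr do rewrite blockE.
have nh := level_le t v; rewrite ht in nh.
case vE : (level t v) nh => [|n] nh.
  rewrite big1 // /indeg big1 // => u _; by rewrite vE ltn0 muln0.
rewrite (bigD1 (Ordinal nh)) //= eqxx big1 ?addr0 // => l.
by rewrite -val_eqE /= eqSS eq_sym => /negbTE ->.
Qed.

Lemma path_crossing (e : rel V) (P : pred V) u v : connect e u v -> P u -> ~~ P v ->
  exists a b, [/\ e a b, P a & ~~ P b].
Proof.
case/connectP => p; elim: p u => [|w p IHp] u /=; first by move=> _ -> ->.
move=> /andP [uw wp] lv Pu nPv; have [Pw|nPw] := boolP (P w); first exact: IHp wp lv Pw nPv.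
by exists u, w.
Qed.

(** Connected blocks are exactly the parts, and connected sublevel sets give every later block an
    edge from below, so everything lies above q and the levels can serve as labels. *)
Lemma good_of_connected_flag (t : T) : connected_flag G q (flag_of (height t).+1 t) ->
  good_labelling G q (orientation G t) (level t).
Proof.
move=> /connected_flagP [_ _ Ul]; set h := height t in Ul.
have down l u v : (l <= h)%N -> (level t u <= l)%N -> (level t v <= l)%N ->
    connect (fun a b => [&& (level t a <= l)%N, (level t b <= l)%N & adj G a b]) u v.
  rewrite leq_eqVlt => /predU1P [->|lh] ul vl.
    have := mult_connected G u v; apply: connect_sub => a b ab; apply: connect1.
    by rewrite !level_le.
  have [_ /induced_connectedP [_ c] _] := Ul l lh.
  have lh' : (l < h.+1)%N by apply: ltnW.
  rewrite nth_flag_of // in c; have := c u v; rewrite !inE => /(_ ul vl).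
  by apply: connect_sub => a b; rewrite !inE => ab; apply: connect1.
have block u v : level t u = level t v -> connect (unoriented G (orientation G t)) u v.
  move=> uv; case ul : (level t u) uv => [|l] uv.
    have := down 0%N u v (leq0n _); rewrite -uv ul leqnn => /(_ isT isT).
    apply: connect_sub => a b; rewrite !leqn0 => /and3P [/eqP a0 /eqP b0 ab].
    by apply: connect1; rewrite unoriented_level ab a0 b0 eqxx.
  have lh : (l < h)%N by rewrite -ul level_le.
  have lh' : (l < h.+1)%N by apply: ltnW.
  have [_ _ /induced_connectedP [_ c]] := Ul l lh.
  rewrite !nth_flag_of // in c; have := c u v; rewrite !inE -uv ul ltnn leqnn => /(_ isT isT).
  apply: connect_sub => a b; rewrite !inE => /and3P [al bl ab].
  by apply: connect1; rewrite unoriented_level ab /=; lia.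
split=> // [u v|u v|u _].
- by rewrite inE => /andP [].
- by rewrite unoriented_level => /andP [_ /eqP].
move: {2}(level t u) (leqnn (level t u)) => n; elim: n u => [|n IHn] u.
  by rewrite leqn0 => /eqP u0; apply/connect_unoriented_upward/block; rewrite level_q u0.
rewrite leq_eqVlt => /predU1P [un|]; last exact: IHn.
have nh : (n < h)%N by rewrite -un level_le.
have := down n.+1 q u nh; rewrite level_q un leqnn => /(_ isT isT) qu.
(* A path from q to u within levels at most n+1 has to leave the levels at most n, and the edge
   where it does so enters the block of u. *)
have [||a [b [/and3P [_ bn ab] an nbn]]] :=
  @path_crossing _ (fun v => (level t v <= n)%N) _ _ qu; rewrite ?level_q ?un ?ltnn //.
have {nbn bn}bn : level t b = n.+1 by apply/eqP; rewrite eqn_leq bn ltnNge.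
apply: (@connect_trans _ _ b); last first.
  by apply/connect_unoriented_upward/block; rewrite bn.
apply: connect_trans (IHn a an) (connect1 _); rewrite upward_level ab bn.
exact: leqW.
Qed.

(** An upward path never exceeds the level of its end, so sublevel sets are connected through q;
    blocks are connected because equal levels are joined by unoriented edges. *)
Lemma connected_flag_of_good (t : T) :
  good_labelling G q (orientation G t) (level t) ->
  connected_flag G q (flag_of (height t).+1 t).
Proof.
move=> [_ _ block up]; set h := height t.
have down l u : (level t u <= l)%N ->
    connect (fun a b => [&& (level t a <= l)%N, (level t b <= l)%N & adj G a b]) q u.
  move=> ul; have := up u; rewrite level_q => /(_ isT) /connectP [p].
  have low p' w : path (upward G (orientation G t)) w p' -> last w p' = u ->
      (level t w <= l)%N.
    elim: p' w => [|y p' IHp] w /=; first by move=> _ ->.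
    rewrite upward_level => /andP [/andP [_ wy] yp] lu.
    exact: leq_trans wy (IHp y yp lu).
  have walk p' w : path (upward G (orientation G t)) w p' -> last w p' = u ->
      connect (fun a b => [&& (level t a <= l)%N, (level t b <= l)%N & adj G a b]) w u.
    elim: p' w => [|y p' IHp] w; first by move=> _ /= ->.
    move=> wp lu; have /= /andP [wy yp] := wp.
    apply: connect_trans (IHp y yp lu); apply: connect1.
    rewrite (low _ _ wp lu) (low _ _ yp lu).
    by move: wy; rewrite upward_level => /andP [].
  by move=> qp lu; apply: (walk p).
have sym_down l : connect_sym (fun a b => [&& (level t a <= l)%N, (level t b <= l)%N & adj G a b]).
  by apply: sym_connect_sym => a b; rewrite andbCA adj_sym.
apply/connected_flagP; split.
- by rewrite nth_flag_of // inE level_q.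
- by rewrite nth_flag_of //; apply/setP => v; rewrite !inE level_le.
move=> l lh; have lh' : (l < h.+1)%N by apply: ltnW.
have [w wl] := level_onto lh; rewrite !nth_flag_of //; split.
- apply/properP; split; first by apply/subsetP => v; rewrite !inE; apply: leqW.
  by exists w; rewrite inE wl ?leqnn // ltnn.
- apply/induced_connectedP; split; first by apply/set0Pn; exists q; rewrite inE level_q.
  move=> u v; rewrite !inE => ul vl.
  have : connect (fun a b => [&& (level t a <= l)%N, (level t b <= l)%N & adj G a b]) u v.
    by apply: connect_trans (down l v vl); rewrite sym_down; apply: down.
  by apply: connect_sub => a b ab; apply: connect1; rewrite !inE.
- apply/induced_connectedP; split.
    by apply/set0Pn; exists w; rewrite !inE wl ltnn leqnn.
  move=> u v; rewrite !inE => ul vl; have uv : level t u = level t v by lia.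
  have /connectP [p up' ->] := block u v uv.
  elim: p u ul up' {uv} => [|a p IHp] u ul /=; first by rewrite connect0.
  rewrite unoriented_level => /andP [/andP [ua /eqP lua] ap].
  apply: connect_trans (IHp a _ ap); last by rewrite -lua.
  by apply: connect1; rewrite !inE -lua ul ua.
Qed.

(** * Minimal flags of the equivalence classes *)

Section Representatives.
Variable sle : rel {set V}.
Hypothesis sle_total : total_order_on [pred U : {set V} | q \in U] sle.

Lemma flag_lt_trans h (U W X : h.+1.-tuple {set V}) : connected_flag G q U ->
  connected_flag G q W -> connected_flag G q X ->
  flag_lt sle U W -> flag_lt sle W X -> flag_lt sle U X.
Proof.
move=> cU cW cX /existsP [l /and3P [UWl sUW /forallP UWm]] /existsP [m /and3P [WXm sWX /forallP WXn]].
have [_ anti trans _] := sle_total.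
have UW (n : 'I_h) : (l < n)%N -> nth set0 U n = nth set0 W n.
  by move=> ln; apply/eqP; have := UWm n; rewrite ln.
have WX (n : 'I_h) : (m < n)%N -> nth set0 W n = nth set0 X n.
  by move=> mn; apply/eqP; have := WXn n; rewrite mn.
have qin (Z : h.+1.-tuple {set V}) (n : 'I_h) : connected_flag G q Z -> q \in nth set0 Z n.
  by move=> cZ; apply: flag_q => //; apply: ltnW.
apply/existsP; case: (ltngtP l m) => lm.
- exists m; rewrite UW // WXm sWX /=; apply/forallP => n; apply/implyP => mn.
  by rewrite UW ?WX // (ltn_trans lm mn).
- exists l; rewrite -WX // UWl sUW /=; apply/forallP => n; apply/implyP => ln.
  by rewrite UW ?WX // (ltn_trans lm ln).
have {lm}lm : l = m by apply: val_inj.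
subst m; exists l; apply/and3P; split.
- apply: contraNneq UWl => UX; apply/eqP; apply: anti; rewrite ?inE ?qin //.
  by rewrite sUW UX sWX.
- by apply: (trans (nth set0 W l)); rewrite ?inE ?qin.
by apply/forallP => n; apply/implyP => ln; rewrite UW ?WX.
Qed.

Lemma flag_lt_total h (U W : h.+1.-tuple {set V}) : connected_flag G q U ->
  connected_flag G q W -> U != W -> flag_lt sle U W || flag_lt sle W U.
Proof.
move=> cU cW UW; have [_ _ _ tot] := sle_total.
have [_ Uh _] := connected_flagP _ cU; have [_ Wh _] := connected_flagP _ cW.
have [l0 l0P] : exists l : 'I_h, nth set0 U l != nth set0 W l.
  apply/existsP; apply: contraNT UW; rewrite negb_exists => /forallP eqUW.
  apply/eqP/eq_from_tnth => i; rewrite !(tnth_nth set0).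
  have [ih|ih] := ltnP i h; first by have := eqUW (Ordinal ih); rewrite negbK => /eqP.
  have -> : nat_of_ord i = h by apply/eqP; rewrite eqn_leq ih -ltnS ltn_ord.
  by rewrite Uh Wh.
case: (arg_maxnP (P := fun l : 'I_h => nth set0 U l != nth set0 W l) val l0P) => l lP lmax.
have above (m : 'I_h) : (l < m)%N -> nth set0 U m = nth set0 W m.
  move=> lm; apply/eqP; apply: contraLR lm => mP; rewrite -leqNgt; exact: lmax.
have qin (Z : h.+1.-tuple {set V}) : connected_flag G q Z -> q \in nth set0 Z l.
  by move=> cZ; apply: flag_q => //; apply: ltnW.
have /orP [UlW|WlU] := tot _ _ (qin U cU) (qin W cW); apply/orP; [left|right];
  apply/existsP; exists l; apply/and3P; split=> //; try by rewrite eq_sym.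
  by apply/forallP => m; apply/implyP => lm; rewrite above.
by apply/forallP => m; apply/implyP => lm; rewrite above.
Qed.

Lemma flag_reps_unique h (U W : h.+1.-tuple {set V}) :
  U \in flag_reps G q sle h.+1 -> W \in flag_reps G q sle h.+1 ->
  flag_orientation G U = flag_orientation G W -> U = W.
Proof.
rewrite !inE => /andP [cU /forallP minU] /andP [cW /forallP minW] UW.
apply/eqP/negPn/negP => neq; have /orP [UltW|WltU] := flag_lt_total cU cW neq.
  by have := minW U; rewrite cU UW eqxx UltW.
by have := minU W; rewrite cW UW eqxx WltU.
Qed.

Lemma flag_reps_exist h (U : h.+1.-tuple {set V}) : connected_flag G q U ->
  exists2 W : h.+1.-tuple {set V}, W \in flag_reps G q sle h.+1
    & flag_orientation G W = flag_orientation G U.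
Proof.
move=> cU; pose C := [pred W : h.+1.-tuple {set V} | connected_flag G q W &&
  (flag_orientation G W == flag_orientation G U)].
pose below (W : h.+1.-tuple {set V}) := #|[set X | C X && flag_lt sle X W]|.
have CU : C U by rewrite /= cU eqxx.
case: (arg_minnP (P := C) below CU) => W /andP [cW /eqP WU] Wmin.
exists W => //; rewrite inE cW /=; apply/forallP => X; apply/implyP => /andP [cX XW].
apply/negP => XltW; have CX : C X by rewrite /= cX -WU.
have := Wmin X CX; rewrite leqNgt => /negP; apply; apply/proper_card/properP; split.
  apply/subsetP => Y; rewrite !inE => /andP [/andP [cY YU] YX].
  by rewrite cY YU; apply: flag_lt_trans XltW.
exists X; rewrite inE /= cX -WU XW //=; apply/existsP => -[l].
by rewrite eqxx.
Qed.

Definition is_rep (t : T) : bool := flag_of (height t).+1 t \in flag_reps G q sle (height t).+1.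

Lemma is_rep_good (t : T) : is_rep t -> good_labelling G q (orientation G t) (level t).
Proof. by rewrite /is_rep inE => /andP [/good_of_connected_flag]. Qed.

Lemma is_repE h (t : T) : height t = h -> is_rep t = (flag_of h.+1 t \in flag_reps G q sle h.+1).
Proof. by move=> <-. Qed.

Lemma is_rep_ex (t : T) : good_labelling G q (orientation G t) (level t) ->
  exists2 t', is_rep t' & orientation G t' = orientation G t.
Proof.
move=> /connected_flag_of_good /flag_reps_exist [W rW WO].
have cW : connected_flag G q W by move: rW; rewrite inE => /andP [].
have [t' ht' WE] := leveling_of_flag cW; exists t'; first by rewrite (is_repE ht') WE.
by rewrite -(flag_orientation_of ht') WE WO flag_orientation_of.
Qed.

Lemma is_rep_uniq (t t' : T) : is_rep t -> is_rep t' -> orientation G t = orientation G t' -> t = t'.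
Proof.
move=> rt rt' tt'; have [_ _ ct _] := is_rep_good rt; have [_ _ ct' _] := is_rep_good rt'.
have hh : height t = height t'.
  apply: height_of_fibers => u v; apply/eqP/eqP => [/ct|/ct'].
    by rewrite tt'; apply: connect_unoriented_level.
  by rewrite -tt'; apply: connect_unoriented_level.
rewrite (is_repE hh) in rt; apply: (flag_of_inj hh erefl); apply: flag_reps_unique => //.
by rewrite (flag_orientation_of hh) (flag_orientation_of erefl).
Qed.

Lemma card_flag_reps_deg (A : zmodType) (deg : Div V -> A) i j :
  #|[set t : T | [&& is_rep t, height t == i & leveling_deg G deg t == j]]| =
  #|flag_reps_deg G q sle deg i.+1 j|.
Proof.
rewrite -(card_in_imset (f := flag_of i.+1)); last first.
  move=> t t'; rewrite !inE => /and3P [_ /eqP ti _] /and3P [_ /eqP t'i _].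
  exact: flag_of_inj.
congr #|pred_of_set _|; apply/setP => U; rewrite [RHS]inE.
apply/imsetP/andP => [[t]|[rU Uj]].
  rewrite inE => /and3P [rt /eqP ti tj] ->; rewrite (is_repE ti) in rt.
  by rewrite flag_div_of // rt.
have [t ti tU] : exists2 t, height t = i & flag_of i.+1 t = U.
  by apply: leveling_of_flag; move: rU; rewrite inE => /andP [].
exists t => //; rewrite inE ti eqxx (is_repE ti) tU rU /=.
by move: Uj; rewrite -tU flag_div_of.
Qed.

End Representatives.

End ConnectedFlags.

Section BettiNumbers.
Variables (V : finType) (G : multigraph V) (q : V) (K : fieldType).
Variable sle : rel {set V}.
Hypothesis sle_total : total_order_on [pred U : {set V} | q \in U] sle.
Variables (A : zmodType) (deg : Div V -> A).
Hypothesis degD : {morph deg : x y / x + y}.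
Hypothesis deg_laplacian : forall f, deg (laplacian G f) = 0.
Notation R := {mpoly K[#|V|]}.
Notation t0 := (trivial_leveling q).

(** Stated for any ideal with these properties, so that it applies to the toppling ideal with [eps]
    true and to its initial ideal with [eps] false. *)
Lemma flag_betti (I : R -> Prop) (eps : bool) i j : is_ideal I ->
  (forall d p, I p -> I (hpart deg d p)) ->
  (forall t, I (flag_kernel G K eps t t0)) ->
  (forall p, I p -> (forall m, m \in msupp p -> standard G t0 m) -> p = 0) ->
  graded_betti deg I i j #|flag_reps_deg G q sle deg i.+1 j|.
Proof.
move=> idI hI kI redI; have [imI exI] := flag_kernel_exact idI kI redI.
pose rep := @is_rep V G q sle.
have rg := @is_rep_good V G q sle; have re := is_rep_ex sle_total (G := G).
have ru := is_rep_uniq sle_total (G := G).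
have critE := critical_rep rg re ru.
have [F [mF cF]] : exists F : free_complex V K A, minimal_graded_free_resolution deg I F /\
    forall i j, #|[set a : 'I_(rk F i) | gdeg a == j]| =
      #|[set t | [&& critical (src G rep) (tgt G rep) t, height t == i
                   & leveling_deg G deg t == j]]|.
  apply: (@minimal_reduction V K A deg degD (leveling q) _ (flag_kernel G K eps)
    (@height V q) (leveling_deg G deg) (@unoriented_edges V G q) t0 I idI _ _ _ _ exI imI
    _ _ (src G rep) (tgt G rep) (mu G rep) (matching_rank G rep)).
  - exact: flag_kernel_height.
  - exact: flag_kernel_homogeneous.
  - exact: flag_kernel_unoriented.
  - exact: flag_kernel_square.
  - exact: height0P.
  - rewrite /leveling_deg (_ : div_of _ = 0) ?(deg_zero degD) //.
    apply/ffunP => v; rewrite !ffunE /indeg big1 // => u _.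
    by rewrite !level_trivial muln0.
  - by move=> t /andP [_ st]; rewrite /tgt st andbF.
  - exact: src_trivial.
  - exact: tgt_trivial.
  - exact: mu_tgt.
  - exact: mu_inj.
  - exact: mu_surj.
  - exact: flag_kernel_mu.
  - exact: flag_kernel_triangular.
  - exact: critical_height.
rewrite -card_flag_reps_deg.
have <- : #|[set a : 'I_(rk F i) | gdeg a == j]| =
    #|[set t : leveling q | [&& is_rep G sle t, height t == i & leveling_deg G deg t == j]]|.
  by rewrite cF; apply: eq_card => t; rewrite !inE -[critical _ _ _]/(critical_leveling G rep t) critE.
exact: graded_betti_of.
Qed.

Variable xle : rel V.
Hypothesis xle_total : total_order_on predT xle.
Hypothesis xle_dist : forall v w, (dist G w q < dist G v q)%N -> (w != v) && xle w v.

Lemma toppling_betti i j (b := #|flag_reps_deg G q sle deg i.+1 j|) :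
  graded_betti deg (@toppling_ideal V K G) i j b /\
  graded_betti deg (initial_ideal xle (@toppling_ideal V K G)) i j b.
Proof.
split.
  apply: (@flag_betti _ true); [exact: ideal_gen_ideal | exact: toppling_hpart
    | exact: toppling_flag_kernel | exact: toppling_reduced].
apply: (@flag_betti _ false); [exact: ideal_gen_ideal | exact: initial_hpart
  | exact: initial_flag_kernel | exact: initial_reduced].
Qed.

End BettiNumbers.

Local Close Scope ring_scope.

Theorem proposition7p4 (V : finType) (G : multigraph V) (q : V) (K : fieldType)
    (xle : rel V) (xle_total : total_order_on predT xle)
    (xle_dist : forall v w : V,
       dist G w q < dist G v q -> (w != v) && xle w v)
    (sle : rel {set V})
    (sle_total : total_order_on [pred U : {set V} | q \in U] sle)
    (sle_supset : forall U W : {set V},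
       q \in U -> q \in W -> W \subset U -> sle U W) :
  let IG := @toppling_ideal V K G in
  let inIG := initial_ideal xle IG in
  (forall (i : nat) (j : int),
     let b := #|flag_reps_deg G q sle (@degZ V) i.+1 j| in
     graded_betti (@degZ V) IG i j b /\ graded_betti (@degZ V) inIG i j b)
  /\
  (forall (i : nat) (j : Pic G),
     let b := #|flag_reps_deg G q sle (degPic G) i.+1 j| in
     graded_betti (degPic G) IG i j b /\ graded_betti (degPic G) inIG i j b).
Proof.
move=> IG inIG; split=> i j b.
  exact: (toppling_betti K sle_total (@degZD V) (@degZ_laplacian V G) xle_total xle_dist).
exact: (toppling_betti K sle_total (@degPicD V G) (@degPic_laplacian V G) xle_total xle_dist).
Qed.
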